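(* Let $m\ge4$, $\alpha\in(0,1)$, and let $\Gamma\subset O(3)$ be a finite subgroup breaking the action of the conformal group $\mathrm{Conf}(S^2)$. Then any $\Gamma$-invariant function $K:S^2\to\mathbb{R}$ in $C_+^{m-2,\alpha}$ is the Gauss curvature of a $\Gamma$-invariant metric $g$ on $S^2$ pointwise conformal to the round metric $g_{+1}$.
   Context: $g_{+1}$ is the round metric of radius 1 on $S^2\subset\mathbb{R}^3$, with $O(3)=\mathrm{Isom}(S^2,g_{+1})$. $C_+^{m-2,\alpha}$ is the set of $C^{m-2,\alpha}$ functions on $S^2$ that are positive somewhere. $\mathrm{Conf}(S^2)$ is the conformal group of $(S^2,g_{+1})$; $\mathrm{Conf}(S^2)/O(3)\simeq\mathbb{R}^3$ is identified with the set of conformal dilations $\varphi_{p,t}$, $p\in S^2$, $t>0$, where $\varphi_{p,t}(x)=tx$ in the chart given by stereographic projection from the pole $p$. $\Gamma$ breaks the action of $\mathrm{Conf}(S^2)$ if for every conformal dilation $\varphi\neq\mathrm{Id}$ there exists $\gamma\in\Gamma$ with $\gamma\circ\varphi\neq\varphi\circ\gamma$. *)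

(* Defs.v *)
From HB Require Import structures.
From mathcomp Require Import all_boot all_order all_algebra.
From mathcomp Require Import all_classical all_reals all_analysis.
Set Implicit Arguments.
Unset Strict Implicit.
Unset Printing Implicit Defensive.
Import Order.TTheory GRing.Theory Num.Theory.
Import numFieldNormedType.Exports.
Local Open Scope classical_set_scope.
Local Open Scope ring_scope.

(* S^2 is the unit sphere of column vectors in R^3.  Functions, maps and
   tensors on S^2 are represented by total functions on R^3; every predicate
   below inspects only their values on S^2 and on its tangent planes. *)

Definition dotv (R : realType) (n : nat) (v w : 'cV[R]_n) : R :=
  \sum_(i < n) v i 0 * w i 0.

Definition basisv (R : realType) (n : nat) (i : 'I_n) : 'cV[R]_n :=
  delta_mx i 0.

Definition sphere (R : realType) : set 'cV[R]_3 := [set x | dotv x x = 1].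

Definition tangent (R : realType) (x : 'cV[R]_3) : set 'cV[R]_3 :=
  [set v | dotv x v = 0].

(* Stereographic projection from the pole p onto the plane orthogonal to p. *)
Definition stereo (R : realType) (p x : 'cV[R]_3) : 'cV[R]_3 :=
  (1 - dotv x p)^-1 *: (x - dotv x p *: p).

Definition inv_stereo (R : realType) (p y : 'cV[R]_3) : 'cV[R]_3 :=
  (dotv y y + 1)^-1 *: (2 *: y + (dotv y y - 1) *: p).

Definition dilation (R : realType) (p : 'cV[R]_3) (t : R) (x : 'cV[R]_3) :
    'cV[R]_3 :=
  if x == p then p else inv_stereo p (t *: stereo p x).

Definition conformal_dilation (R : realType) (phi : 'cV[R]_3 -> 'cV[R]_3) :
    Prop :=
  exists (p : 'cV[R]_3) (t : R),
    [/\ sphere p, 0 < t & forall x, sphere x -> phi x = dilation p t x].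

Definition finite_subgroup_O3 (R : realType) (G : set 'M[R]_3) : Prop :=
  [/\ finite_set G,
      forall A, G A -> A^T *m A = 1%:M,
      G 1%:M,
      forall A B, G A -> G B -> G (A *m B) &
      forall A, G A -> G (invmx A)].

Definition breaks_conformal_action (R : realType) (G : set 'M[R]_3) : Prop :=
  forall phi : 'cV[R]_3 -> 'cV[R]_3, conformal_dilation phi ->
    ~ (forall x, sphere x -> phi x = x) ->
    exists2 A, G A & ~ (forall x, sphere x -> A *m phi x = phi (A *m x)).

Definition invariant_fun (R : realType) (G : set 'M[R]_3) (f : 'cV[R]_3 -> R) :
    Prop :=
  forall A x, G A -> sphere x -> f (A *m x) = f x.

(* The atlas of S^2: the inverses of the stereographic projections from the
   poles e_3 (b = false) and - e_3 (b = true). *)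
Definition chart (R : realType) (b : bool) (y : 'cV[R]_2) : 'cV[R]_3 :=
  inv_stereo ((-1) ^+ b *: basisv R 2)
    (y 0 0 *: basisv R 0 + y 1 0 *: basisv R 1).

Definition partial (R : realType) (i : 'I_2) (f : 'cV[R]_2 -> R) :
    'cV[R]_2 -> R :=
  'D_(basisv R i) f.

Definition iter_partial (R : realType) (s : seq 'I_2) (f : 'cV[R]_2 -> R) :
    'cV[R]_2 -> R :=
  foldr (@partial R) f s.

(* C^{k,alpha} on every ball of the plane.  As closed balls of the two charts
   cover S^2, requiring this in both charts gives the usual C^{k,alpha} on S^2.
   `|.| is the sup norm on R^2, which only affects the Hoelder constant. *)
Definition holder_plane (R : realType) (k : nat) (alpha : R)
    (f : 'cV[R]_2 -> R) : Prop :=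
  [/\ forall (s : seq 'I_2) (i : 'I_2) (y : 'cV[R]_2), (size s < k)%N ->
        derivable (iter_partial s f) y (basisv R i),
      forall s : seq 'I_2, (size s <= k)%N -> continuous (iter_partial s f) &
      forall s : seq 'I_2, size s = k -> forall r : R, exists C : R,
        forall y z : 'cV[R]_2, `|y| <= r -> `|z| <= r ->
          `|iter_partial s f y - iter_partial s f z| <= C * `|y - z| `^ alpha].

Definition holder_sphere (R : realType) (k : nat) (alpha : R)
    (f : 'cV[R]_3 -> R) : Prop :=
  forall b : bool, holder_plane k alpha (f \o @chart R b).

Definition holder_pos (R : realType) (k : nat) (alpha : R)
    (f : 'cV[R]_3 -> R) : Prop :=
  holder_sphere k alpha f /\ exists2 x, sphere x & 0 < f x.

(* g x v w is the value at x of a 2-tensor on the tangent vectors v, w. *)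
Definition tensor2 (R : realType) : Type :=
  'cV[R]_3 -> 'cV[R]_3 -> 'cV[R]_3 -> R.

Definition round_metric (R : realType) : tensor2 R := fun _ v w => dotv v w.

Definition metric_coef (R : realType) (g : tensor2 R) (b : bool)
    (y : 'cV[R]_2) : 'M[R]_2 :=
  \matrix_(i, j) g (chart b y) ('D_(basisv R i) (@chart R b) y)
                               ('D_(basisv R j) (@chart R b) y).

Definition riemannian_metric (R : realType) (k : nat) (alpha : R)
    (g : tensor2 R) : Prop :=
  [/\ forall x v w, sphere x -> tangent x v -> tangent x w ->
        g x v w = g x w v,
      forall x (a : R) u v w, sphere x ->
        tangent x u -> tangent x v -> tangent x w ->
        g x (a *: u + v) w = a * g x u w + g x v w,
      forall x v, sphere x -> tangent x v -> v != 0 -> 0 < g x v v &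
      forall (b : bool) (i j : 'I_2),
        holder_plane k alpha (fun y => metric_coef g b y i j)].

Definition invariant_metric (R : realType) (G : set 'M[R]_3) (g : tensor2 R) :
    Prop :=
  forall A x v w, G A -> sphere x -> tangent x v -> tangent x w ->
    g (A *m x) (A *m v) (A *m w) = g x v w.

Definition pointwise_conformal (R : realType) (g h : tensor2 R) : Prop :=
  exists lambda : 'cV[R]_3 -> R, forall x, sphere x -> 0 < lambda x /\
    forall v w, tangent x v -> tangent x w -> g x v w = lambda x * h x v w.

(* Gamma^k_{ij} of a metric with coefficient matrix G on the plane. *)
Definition christoffel (R : realType) (G : 'cV[R]_2 -> 'M[R]_2)
    (k i j : 'I_2) (y : 'cV[R]_2) : R :=
  2^-1 * \sum_(l < 2) invmx (G y) k l *
    (partial i (fun z => G z j l) y + partial j (fun z => G z i l) y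
     - partial l (fun z => G z i j) y).

(* The d_l-component of R(d_i, d_j) d_k, where
   R(X, Y) Z = D_X D_Y Z - D_Y D_X Z - D_[X, Y] Z. *)
Definition riemann (R : realType) (G : 'cV[R]_2 -> 'M[R]_2)
    (l i j k : 'I_2) (y : 'cV[R]_2) : R :=
  partial i (christoffel G l j k) y - partial j (christoffel G l i k) y
  + \sum_(s < 2) (christoffel G l i s y * christoffel G s j k y
                  - christoffel G l j s y * christoffel G s i k y).

(* <R(d_0, d_1) d_1, d_0> / det G *)
Definition gauss_curvature_plane (R : realType) (G : 'cV[R]_2 -> 'M[R]_2)
    (y : 'cV[R]_2) : R :=
  (\sum_(l < 2) riemann G l 0 1 1 y * G y l 0) / \det (G y).

Definition is_gauss_curvature (R : realType) (g : tensor2 R)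
    (K : 'cV[R]_3 -> R) : Prop :=
  forall (b : bool) (y : 'cV[R]_2),
    K (chart b y) = gauss_curvature_plane (metric_coef g b) y.

(* Main.v *)
Require Import Defs.
From HB Require Import structures.
From mathcomp Require Import all_boot all_order all_algebra.
From mathcomp Require Import all_classical all_reals all_analysis.
From mathcomp Require Import ring lra zify.
Set Implicit Arguments.
Unset Strict Implicit.
Unset Printing Implicit Defensive.
Import Order.TTheory GRing.Theory Num.Theory.
Import numFieldNormedType.Exports.
Local Open Scope classical_set_scope.
Local Open Scope ring_scope.
From mathcomp Require Import complex.

(** A conformal metric e^(2 v) g_{+1} has curvature K iff v solves the mean
    field equation v = c + L (K e^(2 v)), with mean (K e^(2 v)) = 1, where
    L = sum_n tau^n / n and tau (x, y) = (1 + <x, y>) / 2: up to constants, L is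
    the Green operator of the round sphere. The only integration needed is a
    positive normalised functional on bounded functions for which tau (x, .)^n
    has mean 1 / (n + 1).

    Existence: tau^n is a reproducing kernel with finitely many features, so
    that for the kernel truncated at n <= N the equation is the Euler-Lagrange
    equation of mean (K e^(2 u)) e^(- |u|^2) on a finite-dimensional space of
    Gamma-invariant functions. As Gamma breaks the conformal group, it fixes no
    vector; hence tau (x, .) has average 1/2 on every Gamma-orbit, an orbit
    cannot concentrate at x, and the Gamma-average of the kernel has at most
    half its logarithmic singularity. By duality this gives a subcritical
    Moser-Trudinger inequality, so that maximisers exist, with bounds
    independent of N, and converge along an ultrafilter.

    Regularity: termwise differentiation of sum_n tau^n / n, where derivatives
    of the mean of tau^n vanish and allow one to subtract the value of the
    density at x, gives that L maps C^{0,alpha} to C^{2,alpha}; commuting L with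
    rotations gives C^{k,alpha} to C^{k+2,alpha}. In a chart, the Laplacian of
    tau^n / n telescopes, whence the curvature equation. *)

(** * The mean over the sphere *)

(** The obstacle is the non-compact family of conformal dilations, and it dictates the exponents. If
    exp (s k (x, .)) has bounded mean for the kernel k = - ln (1 - tau), duality gives ln (mean (exp
    (2 u))) <= C + |u|^2 / s. Against exp (- |u|^2) this is coercive only for s > 1, while exp (s k)
    is integrable only for s < 1. Averaging over Gamma halves the singularity and admits every s <
    2; the choice s = 3 / 2 explains the recurring 3 / 4 and 2 / 3.

    The functional is multiplicative because K may change sign: ln (mean (K e^(2 u))) - |u|^2 would
    not be defined everywhere. Positivity of K somewhere enters through one trial function on which
    the functional is positive, with a value independent of N.

    The mean is finitely additive and an iterated limit along an ultrafilter. Hence means are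
    exchanged only through the finite expansions of tau^n, and limits are taken only under uniform
    bounds. Even rotation invariance is deduced: it follows from the mean of tau (x, .)^n being the
    same for all x. *)

Definition ufilter : set_system nat :=
  projT1 (cid (@ultraFilterLemma nat \oo _)).

Lemma ufilter_ultra : UltraFilter ufilter.
Proof. by rewrite /ufilter; case: cid => G []. Qed.

Lemma ufilter_oo : \oo `<=` ufilter.
Proof. by rewrite /ufilter; case: cid => G []. Qed.

#[global] Instance ufilter_proper : ProperFilter ufilter.
Proof. exact: (@ultra_proper _ _ ufilter_ultra). Qed.

Section UltraLimit.
Variable R : realType.

Definition ulim (a : nat -> R) : R := lim (a n @[n --> ufilter]).

(** The sequence has a cluster point in a compact segment. For each neighbourhood of it the
    ultrafilter contains the preimage or the complement of the preimage, and clustering rules out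
    the latter. *)
Lemma ulim_cvg (a : nat -> R) (M : R) :
  (forall n, `|a n| <= M) -> a n @[n --> ufilter] --> ulim a.
Proof.
move=> aM; suff [p pa] : exists p : R, a n @[n --> ufilter] --> p.
  by apply/cvg_ex; exists p.
have [|p [_ clp]] := @segment_compact R (- M) M (a n @[n --> ufilter]) _.
  have /(@filterE _ _ _) : forall n, (a @^-1` `[- M, M]) n.
    by move=> n; rewrite /= in_itv /= -ler_norml.
  exact.
exists p => V Vp.
have [//|aV] := in_ultra_setVsetC (a @^-1` V) ufilter_ultra.
by have [x [] /= h1 h2] := clp _ _ (aV : (a n @[n --> ufilter]) (~` V)) Vp.
Qed.

Lemma cvg_ulim (a : nat -> R) (l : R) : a n @[n --> \oo] --> l -> ulim a = l.
Proof.
move=> al; apply: cvg_lim => //; apply: cvg_trans al.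
by move=> A /= /ufilter_oo.
Qed.

Lemma ulim_cst (c : R) : ulim (fun=> c) = c.
Proof. by apply: cvg_lim => //; exact: cvg_cst. Qed.

Lemma ulimD (a b : nat -> R) (M N : R) : (forall n, `|a n| <= M) ->
  (forall n, `|b n| <= N) -> ulim (fun n => a n + b n) = ulim a + ulim b.
Proof.
by move=> /ulim_cvg ha /ulim_cvg hb; apply: cvg_lim => //; exact: cvgD.
Qed.

Lemma ulimZ (a : nat -> R) (M c : R) : (forall n, `|a n| <= M) ->
  ulim (fun n => c * a n) = c * ulim a.
Proof.
by move=> /ulim_cvg ha; apply: cvg_lim => //; apply: cvgM => //; exact: cvg_cst.
Qed.

Lemma ulim_le (a b : nat -> R) (M N : R) : (forall n, `|a n| <= M) ->
  (forall n, `|b n| <= N) -> (forall n, a n <= b n) -> ulim a <= ulim b.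
Proof.
move=> /ulim_cvg ha /ulim_cvg hb ab.
have h : b n - a n @[n --> ufilter] --> ulim b - ulim a by apply: cvgB.
rewrite -subr_ge0; apply: (cvgr_to_ge h).
by apply: filterE => n; rewrite subr_ge0.
Qed.

Lemma cvg_sumr (T : Type) (F : set_system T) (FF : Filter F) (J : Type) (r : seq J)
    (a : J -> T -> R) (l : J -> R) : (forall j, a j x @[x --> F] --> l j) ->
  \sum_(j <- r) a j x @[x --> F] --> \sum_(j <- r) l j.
Proof.
move=> h; elim: r => [|j r ih].
  rewrite big_nil (_ : (fun _ => _) = fun=> 0); first exact: cvg_cst.
  by apply/funext => x; rewrite big_nil.
rewrite big_cons (_ : (fun _ => _) = fun x => a j x + \sum_(j <- r) a j x).
  exact: cvgD.
by apply/funext => x; rewrite big_cons.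
Qed.

Lemma ulim_inv (a : nat -> R) (l C : R) :
  (forall n, `|a n - l| <= C / n.+1%:R) -> ulim a = l.
Proof.
move=> h; apply: cvg_ulim; apply/cvgrPdist_le => e e0.
have C0 : 0 <= C by have := le_trans (normr_ge0 _) (h 0); rewrite divr1.
have d0 : 0 < e / (C + 1) by rewrite divr_gt0// ltr_wpDl.
near=> n; rewrite distrC; apply: le_trans (h n) _.
have h2 : (n.+1%:R^-1 : R) < (PosNum d0)%:num by near: n; exact: near_infty_natSinv_lt.
apply: (@le_trans _ _ ((C + 1) * n.+1%:R^-1)).
  by rewrite ler_wpM2r ?invr_ge0// lerDl.
by rewrite mulrC -ler_pdivlMr ?ltr_wpDl// ltW.
Unshelve. all: by end_near. Qed.

End UltraLimit.

Definition bounded_on (R : realType) (X : Type) (D : set X) (f : X -> R) :=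
  exists M : R, forall x, D x -> `|f x| <= M.

Section BoundedOn.
Variables (R : realType) (X : Type) (D : set X).
Implicit Types f g : X -> R.

Lemma bounded_onP f : bounded_on D f ->
  exists2 M : R, 0 < M & forall x, D x -> `|f x| <= M.
Proof.
move=> [M h]; exists (`|M| + 1); first by rewrite ltr_pwDr.
by move=> x /h/le_trans; apply; apply: le_trans (ler_norm _) _; rewrite lerDl.
Qed.

Lemma bounded_on_cst (c : R) : bounded_on D (fun=> c).
Proof. by exists `|c|. Qed.

Lemma bounded_onD f g : bounded_on D f -> bounded_on D g ->
  bounded_on D (fun x => f x + g x).
Proof.
move=> [M hM] [N hN]; exists (M + N) => x Dx.
by apply: le_trans (ler_normD _ _) _; apply: lerD; [exact: hM|exact: hN].
Qed.

Lemma bounded_onM f g : bounded_on D f -> bounded_on D g ->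
  bounded_on D (fun x => f x * g x).
Proof.
move=> [M hM] [N hN]; exists (M * N) => x Dx.
by rewrite normrM; apply: ler_pM => //; [exact: hM|exact: hN].
Qed.

Lemma bounded_onZ (c : R) f : bounded_on D f -> bounded_on D (fun x => c * f x).
Proof. by apply: bounded_onM; exact: bounded_on_cst. Qed.

Lemma bounded_onN f : bounded_on D f -> bounded_on D (fun x => - f x).
Proof. by move=> [M h]; exists M => x /h; rewrite normrN. Qed.

Lemma bounded_onB f g : bounded_on D f -> bounded_on D g ->
  bounded_on D (fun x => f x - g x).
Proof. by move=> hf hg; apply: bounded_onD => //; exact: bounded_onN. Qed.

Lemma bounded_onX f n : bounded_on D f -> bounded_on D (fun x => f x ^+ n).
Proof.
move=> h; elim: n => [|n ih]; first by exists 1 => x _; rewrite expr0 normr1.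
have [M hM] := bounded_onM h ih.
by exists M => x Dx; rewrite exprS; exact: hM.
Qed.

Lemma bounded_on_sum (I : Type) (s : seq I) (P : pred I) (F : I -> X -> R) :
  (forall i, bounded_on D (F i)) -> bounded_on D (fun x => \sum_(i <- s | P i) F i x).
Proof.
move=> h; elim: s => [|i s ih]; first by exists 0 => x _; rewrite big_nil normr0.
have [M hM] := bounded_onD (h i) ih; have [N hN] := ih.
exists (Num.max M N) => x Dx; rewrite big_cons le_max.
by case: ifP => _; [rewrite hM|rewrite hN ?orbT].
Qed.

Lemma bounded_on_norm f : bounded_on D f -> bounded_on D (fun x => `|f x|).
Proof. by move=> [M h]; exists M => x /h; rewrite normr_id. Qed.

Lemma bounded_on_le f g : bounded_on D g ->
  (forall x, D x -> `|f x| <= g x) -> bounded_on D f.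
Proof.
move=> [M h] fg; exists M => x Dx.
exact: le_trans (fg _ Dx) (le_trans (ler_norm _) (h _ Dx)).
Qed.

Lemma bounded_on_expR f : bounded_on D f -> bounded_on D (fun x => expR (f x)).
Proof.
move=> [M h]; exists (expR M) => x /h hx; rewrite ger0_norm ?expR_ge0//.
by rewrite ler_expR; exact: le_trans (ler_norm _) hx.
Qed.

End BoundedOn.

Section UltraAverage.
Variables (R : realType) (X : Type) (s : nat -> nat -> X) (D : set X).
Hypothesis sD : forall N i, (i < N.+1)%N -> D (s N i).
Implicit Types f g : X -> R.

(** A finitely additive mean: linear and monotone on functions bounded on [D], and blind to values
    outside [D], where no sample lies. *)
Definition uavg f : R :=
  ulim (fun N => N.+1%:R^-1 * \sum_(i < N.+1) f (s N i)).

Lemma avg_bound f M N : (forall x, D x -> `|f x| <= M) ->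
  `|N.+1%:R^-1 * \sum_(i < N.+1) f (s N i)| <= M.
Proof.
move=> h; rewrite normrM ger0_norm ?invr_ge0// ler_pdivrMl ?ltr0n//.
apply: le_trans (ler_norm_sum _ _ _) _.
rewrite -[N.+1 in leRHS]card_ord mulrC mulr_natr -sumr_const.
by apply: ler_sum => i _; exact/h/sD.
Qed.

Lemma uavg_ext f g : (forall x, D x -> f x = g x) -> uavg f = uavg g.
Proof.
move=> fg; congr (ulim _); apply/funext => N; congr (_ * _).
by apply: eq_bigr => i _; exact/fg/sD.
Qed.

Lemma uavg_cst c : uavg (fun=> c) = c.
Proof.
rewrite -[RHS](ulim_cst c); congr (ulim _); apply/funext => N.
by rewrite (sumr_const 'I_N.+1) card_ord -[c *+ _]mulr_natl mulKf// pnatr_eq0.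
Qed.

Lemma uavgD f g : bounded_on D f -> bounded_on D g ->
  uavg (fun x => f x + g x) = uavg f + uavg g.
Proof.
move=> [M hM] [N hN].
rewrite /uavg -(ulimD (fun n => avg_bound n hM) (fun n => avg_bound n hN)).
by congr (ulim _); apply/funext => n; rewrite big_split mulrDr.
Qed.

Lemma uavgZ c f : bounded_on D f -> uavg (fun x => c * f x) = c * uavg f.
Proof.
move=> [M hM]; rewrite /uavg -(ulimZ c (fun n => avg_bound n hM)).
by congr (ulim _); apply/funext => n; rewrite -mulr_sumr mulrCA.
Qed.

Lemma uavg_le f g : bounded_on D f -> bounded_on D g ->
  (forall x, D x -> f x <= g x) -> uavg f <= uavg g.
Proof.
move=> [M hM] [N hN] fg.
apply: (ulim_le (fun n => avg_bound n hM) (fun n => avg_bound n hN)) => n.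
by rewrite ler_wpM2l ?invr_ge0//; apply: ler_sum => i _; exact/fg/sD.
Qed.

Lemma uavg_bound f M : (forall x, D x -> `|f x| <= M) -> `|uavg f| <= M.
Proof.
move=> h.
have bf : bounded_on D f by exists M.
rewrite ler_norml -[X in X <= _ <= _](uavg_cst (- M)) -[X in _ <= _ <= X](uavg_cst M).
apply/andP; split; apply: uavg_le => //; try exact: bounded_on_cst.
all: by move=> x /h; rewrite ler_norml => /andP[].
Qed.

Lemma uavg_sum (I : Type) (r : seq I) (P : pred I) (F : I -> X -> R) :
  (forall i, bounded_on D (F i)) ->
  uavg (fun x => \sum_(i <- r | P i) F i x) = \sum_(i <- r | P i) uavg (F i).
Proof.
move=> h; elim: r => [|i r ih].
  by rewrite big_nil -[RHS](uavg_cst 0); apply: uavg_ext => x _; rewrite big_nil.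
rewrite big_cons; case: ifP => Pi; last first.
  by rewrite -ih; apply: uavg_ext => x _; rewrite big_cons Pi.
rewrite -ih -uavgD//; last exact: bounded_on_sum.
by apply: uavg_ext => x _; rewrite big_cons Pi.
Qed.

End UltraAverage.

(** * Cesaro means of sequences and Riemann means on the unit interval *)

Section Means.
Variable R : realType.
Implicit Types (a : nat -> R) (p : R -> R).

Definition cesaro a : R := uavg (fun _ i => i) a.

Definition riemann_mean p : R := uavg (fun N i => i%:R / N.+1%:R) p.

Definition unit_itv : set R := [set t : R | 0 <= t <= 1].

Lemma unit_itv_sample N i : (i < N.+1)%N -> unit_itv (i%:R / N.+1%:R).
Proof.
move=> iN; rewrite /unit_itv /= divr_ge0//= ler_pdivrMr ?ltr0n// mul1r ler_nat.
exact: ltnW.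
Qed.

(** The two finite averages differ by the telescoped boundary term (a_{N+1} - a_0) / (N + 1). *)
Lemma cesaro_shift a : bounded_on setT a -> cesaro (fun j => a j.+1) = cesaro a.
Proof.
move=> ba; have [M M0 hM] := bounded_onP ba.
have bS : bounded_on setT (fun j => a j.+1) by exists M => x _; exact: hM.
apply/eqP; rewrite -subr_eq0 -mulN1r; apply/eqP.
rewrite -(@uavgZ R nat _ setT)// -(@uavgD R nat _ setT)//; last exact: bounded_onZ.
apply: (@ulim_inv _ _ _ (2 * M)) => N; rewrite subr0.
have -> : \sum_(i < N.+1) (a i.+1 + -1 * a i) = a N.+1 - a 0.
  rewrite -(telescope_sumr a (leq0n N.+1)) big_mkord.
  by apply: eq_bigr => i _; rewrite mulN1r.
rewrite normrM ger0_norm ?invr_ge0// mulrC ler_wpM2r ?invr_ge0//.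
by apply: le_trans (ler_normB _ _) _; rewrite mulr_natl mulr2n lerD// hM.
Qed.

(** Comparison of a sum of powers with an integral: the increment (N + 1)^(k+1) - N^(k+1) lies
    between (k + 1) N^k and (k + 1) (N + 1)^k. *)
Lemma sum_pow_bounds (k N : nat) :
  0 <= (N%:R : R) ^+ k.+1 - k.+1%:R * \sum_(i < N) i%:R ^+ k
    <= k.+1%:R * (N%:R ^+ k).
Proof.
elim: N => [|N /andP[ih1 ih2]].
  by rewrite big_ord0 mulr0 subr0 expr0n /= lexx mulr_ge0// exprn_ge0.
rewrite big_ord_recr /= mulrDr.
set S := _ * \sum_(i < N) _ in ih1 ih2 *.
have e : (N.+1%:R : R) ^+ k.+1 - N%:R ^+ k.+1
    = \sum_(i < k.+1) N.+1%:R ^+ (k - i) * N%:R ^+ i.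
  by rewrite subrXX -natrB// subSnn mul1r.
have N01 : (N%:R : R) <= N.+1%:R by rewrite ler_nat.
have l1 : k.+1%:R * (N%:R : R) ^+ k <= N.+1%:R ^+ k.+1 - N%:R ^+ k.+1.
  rewrite e mulr_natl -[in leLHS](card_ord k.+1) -sumr_const; apply: ler_sum => i _.
  have ik : (i <= k)%N by rewrite -ltnS.
  by rewrite -{1}(subnK ik) exprD ler_wpM2r ?exprn_ge0// lerXn2r// nnegrE.
have l2 : N.+1%:R ^+ k.+1 - N%:R ^+ k.+1 <= k.+1%:R * (N.+1%:R : R) ^+ k.
  rewrite e mulr_natl -[in leRHS](card_ord k.+1) -sumr_const; apply: ler_sum => i _.
  have ik : (i <= k)%N by rewrite -ltnS.
  by rewrite -[in leRHS](subnK ik) exprD ler_wpM2l ?exprn_ge0// lerXn2r// nnegrE.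
by apply/andP; split; lra.
Qed.

Lemma riemann_meanX k : riemann_mean (fun t => t ^+ k) = k.+1%:R^-1.
Proof.
apply: (@ulim_inv _ _ _ 1) => N.
have N0 : (0 : R) < N.+1%:R by rewrite ltr0n.
have k0 : (0 : R) < k.+1%:R by rewrite ltr0n.
have /andP[h1 h2] := sum_pow_bounds k N.+1.
have -> : \sum_(i < N.+1) (i%:R / N.+1%:R : R) ^+ k
    = (\sum_(i < N.+1) i%:R ^+ k) / N.+1%:R ^+ k.
  by rewrite mulr_suml; apply: eq_bigr => i _; rewrite expr_div_n.
set S := \sum_(i < _) _ in h1 h2 *.
have -> : N.+1%:R^-1 * (S / N.+1%:R ^+ k) - k.+1%:R^-1
   = - ((N.+1%:R ^+ k.+1 - k.+1%:R * S) / (k.+1%:R * N.+1%:R ^+ k.+1)).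
  have : (N.+1%:R : R) ^+ k != 0 by rewrite expf_neq0// gt_eqF.
  rewrite exprS; move: (N.+1%:R ^+ k) => z z0.
  by field; rewrite z0 !gt_eqF.
rewrite normrN ger0_norm; last by rewrite divr_ge0// mulr_ge0// ?exprn_ge0 ?ltW.
rewrite ler_pdivrMr ?mulr_gt0 ?exprn_gt0//; apply: le_trans h2 _.
by rewrite exprS mulrCA mul1r mulKf// gt_eqF.
Qed.

Lemma bounded_unit_powers k j : bounded_on unit_itv (fun t : R => t ^+ k * (1 - t) ^+ j).
Proof.
exists 1 => t /andP[t0 t1]; rewrite normrM !normrX !ger0_norm ?subr_ge0//.
by rewrite mulr_ile1 ?exprn_ge0 ?exprn_ile1 ?subr_ge0// gerBl.
Qed.

(** Euler's Beta integral. Splitting off one factor 1 - t lowers j and raises k, so the monomials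
    settle all cases. *)
Lemma riemann_mean_beta k j :
  riemann_mean (fun t => t ^+ k * (1 - t) ^+ j) = (k`! * j`!)%:R / (k + j).+1`!%:R.
Proof.
elim: j k => [|j ih] k.
  have -> : riemann_mean (fun t => t ^+ k * (1 - t) ^+ 0) = riemann_mean (fun t => t ^+ k).
    by congr (uavg _ _); apply/funext => t; rewrite expr0 mulr1.
  rewrite riemann_meanX addn0 muln1 factS natrM invfM mulrCA.
  by rewrite mulfV ?mulr1// pnatr_eq0 -lt0n fact_gt0.
transitivity (riemann_mean (fun t => t ^+ k * (1 - t) ^+ j)
   + (-1) * riemann_mean (fun t => t ^+ k.+1 * (1 - t) ^+ j)).
  rewrite -(@uavgZ _ _ _ _ unit_itv_sample); last exact: bounded_unit_powers.
  rewrite -(@uavgD _ _ _ _ unit_itv_sample); [|exact: bounded_unit_powers|].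
    by apply: (@uavg_ext _ _ _ _ unit_itv_sample) => t _; rewrite !exprS; ring.
  by apply: bounded_onZ; exact: bounded_unit_powers.
rewrite !ih addnS addSn !factS !natrM.
have f0 n : (n`!%:R : R) != 0 by rewrite pnatr_eq0 -lt0n fact_gt0.
have -> : ((k + j).+2%:R : R) = k%:R + j%:R + 2 by rewrite -!natrD addn2.
have -> : ((k + j).+1%:R : R) = k%:R + j%:R + 1 by rewrite -natrD natr1.
have -> : (k.+1%:R : R) = k%:R + 1 by rewrite natr1.
have -> : (j.+1%:R : R) = j%:R + 1 by rewrite natr1.
have k0 : (0 : R) <= k%:R by []. have j0 : (0 : R) <= j%:R by [].
field; rewrite f0 /=; apply/andP; split; lra.
Qed.

End Means.

(** * An irrational rotation of the circle *)

Section RotationMean.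
Variable R : realType.
Local Notation C := (R[i]).

Definition zeta : C := (3 / 5 +i* (4 / 5))%C.

Lemma zeta_conj : zeta * zeta^*%C = 1.
Proof. by rewrite /zeta; simpc; congr (_ +i* _)%C; field. Qed.

(** Modulo 5 the square of 3 + 4 i is -7 + 24 i = 3 + 4 i, so all its powers are congruent to 3 + 4
    i. Their imaginary part is never 0, hence [zeta] is no root of unity. *)
Lemma zetaX_congr d : exists a b : int,
  5%:R ^+ d.+1 * zeta ^+ d.+1 = ((5 * a + 3)%:~R +i* (5 * b + 4)%:~R)%C.
Proof.
elim: d => [|d [a [b ih]]].
  by exists 0, 0; rewrite !expr1 /zeta; simpc; congr (_ +i* _)%C; field.
exists (3 * a - 4 * b - 2), (4 * a + 3 * b + 4).
have e5 : (5%:R : C) = (5 +i* 0)%C by rewrite -[RHS]/((5%:R : R)%:C)%C rmorph_nat.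
rewrite exprS [zeta ^+ _]exprS mulrACA ih /zeta e5; simpc.
by rewrite !(rmorphD, rmorphM, rmorphB, rmorphN) /=; congr (_ +i* _)%C; field.
Qed.

Lemma zetaX_neq1 d : zeta ^+ d.+1 != 1.
Proof.
apply/eqP => z1; have [a [b]] := zetaX_congr d; rewrite z1 mulr1.
have -> : (5%:R : C) ^+ d.+1 = ((5 ^+ d.+1 : R)%:C)%C.
  by rewrite rmorphXn /= rmorph_nat.
move/eqP; rewrite eq_complex /= => /andP[_ /eqP/esym/eqP].
by rewrite intr_eq0 => /eqP; lia.
Qed.

Lemma bounded_Re_unit_powers (w o : C) : o * o^*%C = 1 ->
  bounded_on setT (fun j => Re (w * o ^+ j)).
Proof.
move=> o1; exists (`|Re w| + `|Im w|) => j _.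
have : (o ^+ j) * (o ^+ j)^*%C = 1 by rewrite rmorphXn /= -exprMn o1 expr1n.
case: (o ^+ j) => a b; simpc => /eqP; rewrite eq_complex /= => /andP[/eqP ab _].
case: w => x y; simpc => /=.
have ab1 : a * a <= 1 /\ b * b <= 1 by split; nra.
have [a1 b1] : `|a| <= 1 /\ `|b| <= 1.
  by split; rewrite -(@expr_le1 _ 2)// real_normK ?num_real// expr2; tauto.
apply: le_trans (ler_normB _ _) _; rewrite !normrM.
by apply: lerD; rewrite ler_piMr.
Qed.

(** For o different from 1 the sequence is a coboundary, w o^j = v o^(j+1) - v o^j with v = w / (o -
    1), and a shift-invariant mean kills it. *)
Lemma cesaro_Re_unit_powers (w o : C) : o * o^*%C = 1 ->
  cesaro (fun j => Re (w * o ^+ j)) = if o == 1 then Re w else 0.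
Proof.
move=> o1; case: eqP => [->|/eqP oN1].
  rewrite -[RHS](@uavg_cst _ _ (fun _ i => i)); congr (uavg _ _).
  by apply/funext => j; rewrite expr1n mulr1.
have o10 : o - 1 != 0 by rewrite subr_eq0.
pose v := w / (o - 1).
have wE : w = v * (o - 1) by rewrite divfK.
have b := bounded_Re_unit_powers v o1.
transitivity (cesaro (fun j => Re (v * o ^+ j.+1)) + (-1) * cesaro (fun j => Re (v * o ^+ j))).
  rewrite /cesaro -(@uavgZ _ _ _ setT)// -(@uavgD _ _ _ setT)//.
  - congr (uavg _ _); apply/funext => j.
    rewrite mulN1r -raddfB /=; congr (Re _).
    by rewrite wE exprS; ring.
  - by case: b => M h; exists M => j _; exact: h.
  - exact: bounded_onZ.
by rewrite (cesaro_shift b) mulN1r subrr.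
Qed.

End RotationMean.

(** * The mean on the sphere and the moments of tau *)

Section SphereMean.
Variable R : realType.
Local Notation V3 := 'cV[R]_3.

Definition mkv3 (a b c : R) : V3 :=
  \col_i (if i == 0 :> nat then a else if i == 1%N :> nat then b else c).

Definition spoint (t : R) (j : nat) : V3 :=
  mkv3 (2 * Num.sqrt (t * (1 - t)) * Re (zeta R ^+ j))
       (2 * Num.sqrt (t * (1 - t)) * Im (zeta R ^+ j)) (2 * t - 1).

(* The mean over the sphere. By Archimedes the height 2 t - 1 is uniformly
   distributed; on each parallel the longitude is averaged along the orbit of
   the irrational rotation zeta. Limits along an ultrafilter make sint total. *)
Definition sint (f : V3 -> R) : R :=
  riemann_mean (fun t => cesaro (fun j => f (spoint t j))).

Lemma dotvE (x y : V3) :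
  dotv x y = x 0 0 * y 0 0 + x 1 0 * y 1 0 + x (2%:R) 0 * y (2%:R) 0.
Proof.
rewrite /dotv !big_ord_recl big_ord0 addr0 addrA.
by congr (_ * _ + _ * _ + _ * _); congr (_ _ _); apply: val_inj.
Qed.

Lemma mkv3E (a b c : R) :
  (mkv3 a b c 0 0 = a) * (mkv3 a b c 1 0 = b) * (mkv3 a b c (2%:R) 0 = c).
Proof. by rewrite /mkv3 !mxE. Qed.

Lemma dotvC (x y : V3) : dotv x y = dotv y x.
Proof. by apply: eq_bigr => i _; rewrite mulrC. Qed.

Lemma zetaX_norm j : Re (zeta R ^+ j) ^+ 2 + Im (zeta R ^+ j) ^+ 2 = 1.
Proof.
have : (zeta R ^+ j) * (zeta R ^+ j)^*%C = 1.
  by rewrite rmorphXn /= -exprMn zeta_conj expr1n.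
case: (zeta R ^+ j) => a b; simpc => /eqP; rewrite eq_complex /= => /andP[/eqP <- _].
by rewrite !expr2; ring.
Qed.

Lemma spoint_sphere t j : unit_itv t -> @sphere R (spoint t j).
Proof.
move=> /andP[t0 t1]; rewrite /sphere /= dotvE !mkv3E.
have z := zetaX_norm j.
have s2 : Num.sqrt (t * (1 - t)) ^+ 2 = t * (1 - t).
  by rewrite sqr_sqrtr// mulr_ge0// subr_ge0.
move: s2 z; move: (Num.sqrt _) (Re _) (Im _) => s a b s2 z.
have -> : 2 * s * a * (2 * s * a) + 2 * s * b * (2 * s * b) + (2 * t - 1) * (2 * t - 1)
  = 4 * s ^+ 2 * (a ^+ 2 + b ^+ 2) + (2 * t - 1) ^+ 2 by ring.
by rewrite s2 z; ring.
Qed.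

Local Notation S := (@sphere R).
Implicit Types f g : V3 -> R.

Lemma cesaro_spoint_bounded f t : bounded_on S f -> unit_itv t ->
  bounded_on setT (fun j => f (spoint t j)).
Proof. by move=> [M h] ht; exists M => j _; apply/h/spoint_sphere. Qed.

Lemma cesaro_spoint_bound f M t : (forall x, S x -> `|f x| <= M) -> unit_itv t ->
  `|cesaro (fun j => f (spoint t j))| <= M.
Proof.
move=> h ht; apply: (@uavg_bound _ _ _ setT) => // j _.
exact/h/spoint_sphere.
Qed.

Lemma riemann_spoint_bounded f : bounded_on S f ->
  bounded_on (@unit_itv R) (fun t => cesaro (fun j => f (spoint t j))).
Proof. by move=> [M h]; exists M => t; exact: cesaro_spoint_bound. Qed.

Lemma sint_ext f g : (forall x, S x -> f x = g x) -> sint f = sint g.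
Proof.
move=> fg; apply: (uavg_ext (@unit_itv_sample R)) => t ht.
by congr (cesaro _); apply/funext => j; exact/fg/spoint_sphere.
Qed.

Lemma sint_cst c : sint (fun=> c) = c.
Proof.
rewrite -[RHS](uavg_cst (fun N i => i%:R / N.+1%:R : R)).
by congr (uavg _ _); apply/funext => t; exact: uavg_cst.
Qed.

Lemma sintD f g : bounded_on S f -> bounded_on S g ->
  sint (fun x => f x + g x) = sint f + sint g.
Proof.
move=> bf bg.
rewrite /sint /riemann_mean -(uavgD (@unit_itv_sample R)); try exact: riemann_spoint_bounded.
apply: (uavg_ext (@unit_itv_sample R)) => t ht.
by rewrite /cesaro -(@uavgD _ _ _ setT)//; exact: cesaro_spoint_bounded.
Qed.

Lemma sintZ c f : bounded_on S f -> sint (fun x => c * f x) = c * sint f.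
Proof.
move=> bf.
rewrite /sint /riemann_mean -(uavgZ (@unit_itv_sample R)); try exact: riemann_spoint_bounded.
apply: (uavg_ext (@unit_itv_sample R)) => t ht.
by rewrite /cesaro -(@uavgZ _ _ _ setT)//; exact: cesaro_spoint_bounded.
Qed.

Lemma sint_le f g : bounded_on S f -> bounded_on S g ->
  (forall x, S x -> f x <= g x) -> sint f <= sint g.
Proof.
move=> bf bg fg; apply: (uavg_le (@unit_itv_sample R)); try exact: riemann_spoint_bounded.
move=> t ht; apply: (@uavg_le _ _ _ setT) => //; try exact: cesaro_spoint_bounded.
by move=> j _; exact/fg/spoint_sphere.
Qed.

Lemma sint_bound f M : (forall x, S x -> `|f x| <= M) -> `|sint f| <= M.
Proof.
move=> h; apply: (uavg_bound (@unit_itv_sample R)) => t; exact: cesaro_spoint_bound.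
Qed.

Lemma sint_sum (I : Type) (r : seq I) (P : pred I) (F : I -> V3 -> R) :
  (forall i, bounded_on S (F i)) ->
  sint (fun x => \sum_(i <- r | P i) F i x) = \sum_(i <- r | P i) sint (F i).
Proof.
move=> h; elim: r => [|i r ih].
  by rewrite big_nil -[RHS](sint_cst 0); apply: sint_ext => x _; rewrite big_nil.
rewrite big_cons; case: ifP => Pi; last first.
  by rewrite -ih; apply: sint_ext => x _; rewrite big_cons Pi.
rewrite -ih -sintD//; last exact: bounded_on_sum.
by apply: sint_ext => x _; rewrite big_cons Pi.
Qed.

Lemma sintB f g : bounded_on S f -> bounded_on S g ->
  sint (fun x => f x - g x) = sint f - sint g.
Proof.
move=> bf bg; rewrite -mulN1r -sintZ// -sintD//; last exact: bounded_onZ.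
by apply: sint_ext => x _; rewrite mulN1r.
Qed.

Lemma sint_ge0 f : bounded_on S f -> (forall x, S x -> 0 <= f x) -> 0 <= sint f.
Proof.
by move=> bf f0; rewrite -(sint_cst 0); apply: sint_le => //; exact: bounded_on_cst.
Qed.

Lemma sint_norm f : bounded_on S f -> `|sint f| <= sint (fun x => `|f x|).
Proof.
move=> bf; rewrite ler_norml -mulN1r -sintZ; last exact: bounded_on_norm.
have bn := bounded_on_norm bf.
apply/andP; split; apply: sint_le => //; try exact: bounded_onZ.
  by move=> x _; rewrite mulN1r lerNl ler_normr lexx orbT.
by move=> x _; exact: ler_norm.
Qed.

Definition tau (x y : V3) : R := (1 + dotv x y) / 2.

Lemma tauC x y : tau x y = tau y x.
Proof. by rewrite /tau dotvC. Qed.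

Lemma tauE (x y : V3) : S x -> S y -> 1 - tau x y = dotv (x - y) (x - y) / 4.
Proof. by rewrite /sphere /tau /= !dotvE !mxE => x1 y1; lra. Qed.

Lemma dotv_ge0 (x : V3) : 0 <= dotv x x.
Proof. by apply: sumr_ge0 => i _; rewrite -expr2 sqr_ge0. Qed.

Lemma tau_le1 x y : S x -> S y -> tau x y <= 1.
Proof.
by move=> Sx Sy; rewrite -subr_ge0 tauE// divr_ge0// dotv_ge0.
Qed.

Lemma tau_ge0 x y : S x -> S y -> 0 <= tau x y.
Proof.
move=> Sx Sy; suff -> : tau x y = dotv (x + y) (x + y) / 4 by rewrite divr_ge0// dotv_ge0.
by move: Sx Sy; rewrite /sphere /tau /= !dotvE !mxE => x1 y1; lra.
Qed.

Lemma tau_norm_le1 x y : S x -> S y -> `|tau x y| <= 1.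
Proof. by move=> Sx Sy; rewrite ger0_norm ?tau_ge0 ?tau_le1. Qed.

Lemma tau_bounded x : S x -> bounded_on S (tau x).
Proof. by move=> Sx; exists 1 => y; exact: tau_norm_le1. Qed.

(** In half-angle form tau = |p + q zeta^j|^2 along a parallel, with p real and p, q independent of
    j. Thus tau^n is a Laurent polynomial in zeta^j, and averaging over the longitude keeps the
    diagonal terms k = l. The numbers [A] and [B] are the values of tau between x and the south and
    north poles. *)
Lemma cesaro_tauX x n t : S x -> unit_itv t ->
  cesaro (fun j => tau x (spoint t j) ^+ n)
  = \sum_(k < n.+1) 'C(n, k)%:R ^+ 2 * ((1 - x (2%:R) 0) / 2) ^+ (n - k)
      * ((1 + x (2%:R) 0) / 2) ^+ k * (t ^+ k * (1 - t) ^+ (n - k)).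
Proof.
move=> Sx tI; have /andP[t0 t1] := tI.
set A := (1 - x (2%:R) 0) / 2; set B := (1 + x (2%:R) 0) / 2.
have x1 : x 0 0 * x 0 0 + x 1 0 * x 1 0 = 4 * A * B.
  by move: Sx; rewrite /sphere /= dotvE /A /B => h; lra.
have A0 : 0 <= A by rewrite /A; move: Sx; rewrite /sphere /= dotvE => h; nra.
(* The coefficient [b] below divides by the root of A, so the north pole is treated apart; seen from
   there, tau equals t all along the parallel. *)
have [A00|AN0] := eqVneq A 0.
  have B1 : B = 1 by move: A00; rewrite /A /B; lra.
  have x00 : x 0 0 = 0 /\ x 1 0 = 0.
    move: x1; rewrite A00 mulr0 mul0r => h.
    by split; apply/eqP; rewrite -sqrf_eq0; apply/eqP; nra.
  rewrite big_ord_recr /= big1 ?add0r; last first.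
    by move=> k _; rewrite A00 expr0n subn_eq0 leqNgt ltn_ord !(mulr0, mul0r).
  rewrite binn subnn !expr0 B1 !expr1n !mulr1 !mul1r.
  rewrite -[RHS](uavg_cst (fun _ i => i)); congr (uavg _ _); apply/funext => j.
  congr (_ ^+ _); rewrite /tau dotvE !mkv3E x00.1 x00.2 !mul0r !add0r.
  have -> : x (2%:R) 0 = 1 by move: A00; rewrite /A; lra.
  by lra.
pose a := Num.sqrt A; pose s := Num.sqrt (1 - t); pose c := Num.sqrt t.
have a2 : a * a = A by rewrite -expr2 sqr_sqrtr.
have s2 : s * s = 1 - t by rewrite -expr2 sqr_sqrtr// subr_ge0.
have c2 : c * c = t by rewrite -expr2 sqr_sqrtr.
have a0 : a != 0 by apply: contra_neq AN0; rewrite -a2 => ->; rewrite mul0r.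
have sc : Num.sqrt (t * (1 - t)) = c * s by rewrite sqrtrM.
(* Chosen so that a b = (x_0 - i x_1) / 2, which reproduces the cross term of tau; then |b|^2 = B
   because x is a unit vector. *)
pose b : R[i] := (x 0 0 / (2 * a) +i* (- (x 1 0 / (2 * a))))%C.
have bb : b * b^*%C = (B%:C)%C.
  rewrite /b; simpc; congr (_ +i* _)%C; last by ring.
  transitivity ((x 0 0 * x 0 0 + x 1 0 * x 1 0) / (4 * (a * a))); first by field.
  by rewrite x1 a2; field.
pose p := ((a * s)%:C)%C : R[i]; pose q := b * (c%:C)%C.
have tauq j : tau x (spoint t j) = Re ((p + q * zeta R ^+ j) * (p + q * zeta R ^+ j)^*%C).
  rewrite /tau dotvE !mkv3E sc /p /q /b.
  have := zetaX_norm j; case: (zeta R ^+ j) => u v /= uv; simpc => /=.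
  transitivity (a * a * (s * s) + (x 0 0 * x 0 0 + x 1 0 * x 1 0) / (4 * (a * a)) * (c * c) * (u ^+ 2 + v ^+ 2)
     + c * s * (x 0 0 * u + x 1 0 * v)).
    rewrite x1 uv a2 s2 c2 mulr1 (_ : 4 * A * B / (4 * A) = B); last by field.
    by rewrite /A /B; field.
  by field.
have pR : p^*%C = p by rewrite /p conjc_real.
have tauX j : tau x (spoint t j) ^+ n = \sum_(k < n.+1) \sum_(l < n.+1)
   Re (('C(n, k)%:R * 'C(n, l)%:R * p ^+ (n - k) * p ^+ (n - l) * q ^+ k * (q^*%C) ^+ l)
      * (zeta R ^+ k * (zeta R)^*%C ^+ l) ^+ j).
  have -> : tau x (spoint t j) ^+ n
      = Re ((p + q * zeta R ^+ j) ^+ n * ((p + q * zeta R ^+ j)^*%C) ^+ n).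
    rewrite -exprMn tauq; set z := (_ * _).
    have -> : z = ((Re z)%:C)%C.
      rewrite /z; case: (p + _) => u v; simpc; congr (_ +i* _)%C => //; ring.
    by rewrite -rmorphXn.
  have -> : (p + q * zeta R ^+ j)^*%C = p + q^*%C * (zeta R)^*%C ^+ j.
    by rewrite rmorphD rmorphM rmorphXn -[X in X + _ = _]/(p^*%C) pR.
  rewrite !exprDn mulr_suml raddf_sum.
  apply: eq_bigr => k _; rewrite mulr_sumr raddf_sum; apply: eq_bigr => l _.
  congr (Re _); rewrite -[in LHS](mulr_natr _ 'C(n, k)) -[in LHS](mulr_natr _ 'C(n, l)).
  rewrite !exprMn -!exprM ![(j * _)%N]mulnC.
  move: ('C(n, k)%:R) ('C(n, l)%:R) (p ^+ (n - k)) (p ^+ (n - l)) (q ^+ k) (q^*%C ^+ l).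
  move: (zeta R ^+ _) ((zeta R)^*%C ^+ _) => z1 z2 b1 b2 p1 p2 q1 q2.
  by ring.
pose w (k l : 'I_n.+1) : R[i] := 'C(n, k)%:R * 'C(n, l)%:R * p ^+ (n - k) * p ^+ (n - l) * q ^+ k * (q^*%C) ^+ l.
have oo (k l : 'I_n.+1) : (zeta R ^+ k * (zeta R)^*%C ^+ l) * (zeta R ^+ k * (zeta R)^*%C ^+ l)^*%C = 1.
  have zk m : zeta R ^+ m * (zeta R)^*%C ^+ m = 1 by rewrite -exprMn zeta_conj expr1n.
  have -> : (zeta R ^+ k * (zeta R)^*%C ^+ l)^*%C = (zeta R)^*%C ^+ k * zeta R ^+ l.
    by rewrite rmorphM !rmorphXn -[X in _ * X ^+ _]/((zeta R)^*%C^*%C) conjcK.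
  by rewrite mulrACA zk mulrC [X in X * _]mulrC zk mulr1.
have od (k l : 'I_n.+1) : (zeta R ^+ k * (zeta R)^*%C ^+ l == 1) = (l == k).
  have zk m : zeta R ^+ m * (zeta R)^*%C ^+ m = 1 by rewrite -exprMn zeta_conj expr1n.
  case: (ltngtP (l : nat) k) => [lk|kl|/val_inj ->]; last by rewrite zk !eqxx.
  - rewrite -(subnK (ltnW lk)) exprD -mulrA zk mulr1.
    rewrite (_ : (k - l)%N = (k - l).-1.+1); last by rewrite prednK// subn_gt0.
    by rewrite (negPf (zetaX_neq1 _ _)); apply/esym/negP => /eqP/(congr1 val) /= e; rewrite e ltnn in lk.
  - rewrite -(subnK (ltnW kl)) exprD mulrCA zk mulr1.
    rewrite (_ : (l - k)%N = (l - k).-1.+1); last by rewrite prednK// subn_gt0.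
    rewrite -rmorphXn /= (can2_eq (@conjcK _) (@conjcK _)) conjc1.
    by rewrite (negPf (zetaX_neq1 _ _)); apply/esym/negP => /eqP/(congr1 val) /= e; rewrite e ltnn in kl.
transitivity (\sum_(k < n.+1) \sum_(l < n.+1) if l == k then Re (w k l) else 0).
  transitivity (cesaro (fun j => \sum_(k < n.+1) \sum_(l < n.+1)
     Re (w k l * (zeta R ^+ k * (zeta R)^*%C ^+ l) ^+ j))).
    by congr (cesaro _); apply/funext => j; rewrite tauX.
  rewrite /cesaro (@uavg_sum _ _ _ setT)//; last first.
    by move=> k; apply: bounded_on_sum => l; exact: bounded_Re_unit_powers.
  apply: eq_bigr => k _; rewrite (@uavg_sum _ _ _ setT)//; last first.
    by move=> l; exact: bounded_Re_unit_powers.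
  by apply: eq_bigr => l _; rewrite -od -cesaro_Re_unit_powers.
apply: eq_bigr => k _; rewrite -big_mkcond big_pred1_eq /w.
have -> : 'C(n, k)%:R * 'C(n, k)%:R * p ^+ (n - k) * p ^+ (n - k) * q ^+ k * (q^*%C) ^+ k
  = 'C(n, k)%:R ^+ 2 * (p * p) ^+ (n - k) * (q * q^*%C) ^+ k.
  by rewrite !exprMn expr2; ring.
have -> : p * p = ((A * (1 - t))%:C)%C.
  by rewrite /p; simpc; congr (_ +i* _)%C; rewrite -a2 -s2; ring.
have -> : q * q^*%C = ((B * t)%:C)%C.
  have -> : q^*%C = b^*%C * (c%:C)%C.
    by rewrite /q rmorphM -[X in _ * X = _]/((c%:C)^*)%C conjc_real.
  by rewrite mulrACA bb; simpc; rewrite c2.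
have -> : ('C(n, k)%:R : R[i]) = (('C(n, k)%:R)%:C)%C by rewrite rmorph_nat.
by rewrite -!rmorphXn -!rmorphM /= !exprMn; ring.
Qed.

(** The Beta integral cancels one of the two binomial coefficients up to the factor 1 / (n + 1), and
    what remains is (A + B)^n = 1. *)
Lemma sint_tauX x n : S x -> sint (fun y => tau x y ^+ n) = n.+1%:R^-1.
Proof.
move=> Sx.
set A := (1 - x (2%:R) 0) / 2; set B := (1 + x (2%:R) 0) / 2.
transitivity (riemann_mean (fun t => \sum_(k < n.+1) 'C(n, k)%:R ^+ 2 * A ^+ (n - k)
      * B ^+ k * (t ^+ k * (1 - t) ^+ (n - k)))).
  by apply: (uavg_ext (@unit_itv_sample R)) => t ht; rewrite cesaro_tauX.
rewrite /riemann_mean (uavg_sum (@unit_itv_sample R)); last first.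
  by move=> k; apply: bounded_onZ; exact: bounded_unit_powers.
transitivity (\sum_(k < n.+1) n.+1%:R^-1 * (A ^+ (n - k) * B ^+ k *+ 'C(n, k))); last first.
  rewrite -mulr_sumr -exprDn -mulrDl.
  have -> : 1 - x (2%:R) 0 + (1 + x (2%:R) 0) = 2 :> R by ring.
  by rewrite mulfV ?expr1n ?mulr1.
apply: eq_bigr => k _; rewrite (uavgZ (@unit_itv_sample R)); last exact: bounded_unit_powers.
have kn : (k <= n)%N by rewrite -ltnS.
rewrite -/(riemann_mean _) riemann_mean_beta subnKC// -(mulr_natl (_ * _) 'C(n, k)).
have f0 m : (m`!%:R : R) != 0 by rewrite pnatr_eq0 -lt0n fact_gt0.
have -> : ((k`! * (n - k)`!)%:R : R) = n`!%:R / 'C(n, k)%:R.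
  apply: (canRL (mulfK _)); first by rewrite pnatr_eq0 -lt0n bin_gt0.
  by rewrite -natrM mulnC bin_fact.
rewrite factS natrM.
have : ('C(n, k)%:R : R) != 0 by rewrite pnatr_eq0 -lt0n bin_gt0.
have := f0 n; have : (n.+1%:R : R) != 0 by rewrite pnatr_eq0.
move: (n.+1%:R) (n`!%:R) ('C(n, k)%:R) (A ^+ _) (B ^+ _) => c1 c2 c3 c4 c5 h1 h2 h3.
by field; rewrite h1 h2 h3.
Qed.

End SphereMean.

#[global] Opaque sint.

(** * Moments of tau and the operator L *)

Section TauIntegrals.
Variable R : realType.
Local Notation V3 := 'cV[R]_3.
Local Notation S := (@sphere R).
Implicit Types (f g : V3 -> R) (M c : R).

Lemma tauX_bounded x n : S x -> bounded_on S (fun y => tau x y ^+ n).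
Proof. by move=> Sx; apply: bounded_onX; exact: tau_bounded. Qed.

Lemma sint_tau_horner x (p : {poly R}) n : S x -> (size p <= n)%N ->
  sint (fun y => p.[tau x y]) = \sum_(i < n) p`_i / i.+1%:R.
Proof.
move=> Sx pn; transitivity (sint (fun y => \sum_(i < n) p`_i * tau x y ^+ i)).
  by apply: sint_ext => y _; rewrite (horner_coef_wide _ pn).
rewrite sint_sum; last by move=> i; apply: bounded_onZ; exact: tauX_bounded.
by apply: eq_bigr => i _; rewrite sintZ ?sint_tauX//; exact: tauX_bounded.
Qed.

(** Archimedes around the centre x: tau (x, .) is uniformly distributed on [0, 1], so this is the
    fundamental theorem of calculus. *)
Lemma sint_tau_deriv x (p : {poly R}) : S x ->
  sint (fun y => p^`().[tau x y]) = p.[1] - p.[0].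
Proof.
move=> Sx; rewrite (@sint_tau_horner _ _ (size p))//; last first.
  by have [->|/lt_size_deriv/ltnW//] := eqVneq p 0; rewrite deriv0.
have -> : \sum_(i < size p) p^`()`_i / i.+1%:R = \sum_(i < size p) p`_i.+1.
  by apply: eq_bigr => i _; rewrite coef_deriv -[_ *+ i.+1]mulr_natr mulfK// pnatr_eq0.
rewrite horner_coef0 (@horner_coef_wide _ (size p).+1)//.
rewrite big_ord_recl expr0 mulr1 /= addrAC subrr add0r.
by apply: eq_bigr => i _; rewrite expr1n mulr1.
Qed.

Lemma tau_unit x y : S x -> S y -> 0 <= tau x y <= 1.
Proof. by move=> Sx Sy; rewrite tau_ge0 ?tau_le1. Qed.

Lemma tau_beta_bounded x n k : S x ->
  bounded_on S (fun y => tau x y ^+ n * (1 - tau x y) ^+ k).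
Proof.
move=> Sx; apply: bounded_onM; apply: bounded_onX; first exact: tau_bounded.
by apply: bounded_onB; [exact: bounded_on_cst|exact: tau_bounded].
Qed.

(** The exact value is the Beta integral n! k! / (n + k + 1)!. What matters is that each factor 1 -
    tau gains a power of 1 / (n + 1), the scale at which tau^n concentrates. *)
Lemma sint_tau_beta x n k : S x ->
  sint (fun y => tau x y ^+ n * (1 - tau x y) ^+ k) <= k`!%:R / n.+1%:R ^+ k.+1.
Proof.
move=> Sx.
have -> : sint (fun y => tau x y ^+ n * (1 - tau x y) ^+ k)
    = (n`! * k`!)%:R / (n + k).+1`!%:R.
  elim: k n => [|k ih] n.
    transitivity (sint (fun y => tau x y ^+ n)).
      by apply: sint_ext => y _; rewrite expr0 mulr1.
    rewrite sint_tauX// addn0 muln1 factS natrM invfM mulrCA.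
    by rewrite mulfV ?mulr1// pnatr_eq0 -lt0n fact_gt0.
  transitivity (sint (fun y => tau x y ^+ n * (1 - tau x y) ^+ k)
     - sint (fun y => tau x y ^+ n.+1 * (1 - tau x y) ^+ k)).
    rewrite -sintB; try exact: tau_beta_bounded.
    by apply: sint_ext => y _; rewrite !exprS; ring.
  rewrite !ih addnS addSn !factS !natrM.
  have f0 m : (m`!%:R : R) != 0 by rewrite pnatr_eq0 -lt0n fact_gt0.
  have -> : ((n + k).+2%:R : R) = n%:R + k%:R + 2 by rewrite -!natrD addn2.
  have -> : ((n + k).+1%:R : R) = n%:R + k%:R + 1 by rewrite -natrD natr1.
  have -> : (k.+1%:R : R) = k%:R + 1 by rewrite natr1.
  have -> : (n.+1%:R : R) = n%:R + 1 by rewrite natr1.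
  have k0 : (0 : R) <= k%:R by []. have n0 : (0 : R) <= n%:R by [].
  field; rewrite f0 /=; apply/andP; split; lra.
have le : (n`! * n.+1 ^ k.+1 <= (n + k).+1`!)%N.
  elim: k => [|k ih]; first by rewrite addn0 expn1 factS mulnC.
  rewrite addnS [(n + k).+2`!]factS expnS mulnCA leq_mul//.
  by rewrite ltnS -addnS leq_addr.
rewrite ler_pdivrMr ?ltr0n ?fact_gt0// mulrAC ler_pdivlMr ?exprn_gt0 ?ltr0n//.
by rewrite -natrX -!natrM ler_nat mulnAC [leqRHS]mulnC leq_mul2r le orbT.
Qed.

End TauIntegrals.

(** * Approximate identity, rotation invariance of the mean, and the operator L *)

Section UniformlyContinuous.
Variable R : realType.
Local Notation V3 := 'cV[R]_3.
Local Notation S := (@sphere R).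
Implicit Types (f g : V3 -> R) (M c : R).

(* Uniform continuity on the sphere, with 1 - tau x y as squared distance. *)
Definition UC f := forall e : R, 0 < e -> exists2 C : R, 0 <= C &
  forall x y, S x -> S y -> `|f x - f y| <= e + C * (1 - tau x y).

Lemma sphere_nonempty : exists x : V3, S x.
Proof. by exists (spoint 0 0); apply: spoint_sphere; rewrite /unit_itv /= lexx ler01. Qed.

Lemma UC_bounded f : UC f -> bounded_on S f.
Proof.
move=> /(_ 1 ltr01)[C C0 h]; have [x0 Sx0] := sphere_nonempty.
exists (`|f x0| + (1 + C)) => x Sx.
rewrite -(subrK (f x0) (f x)) addrC; apply: le_trans (ler_normD _ _) _.
rewrite lerD2l; apply: le_trans (h x x0 Sx Sx0) _.
by rewrite lerD2l ler_piMr// gerBl tau_ge0.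
Qed.

Lemma UC_cst c : UC (fun=> c).
Proof. by move=> e e0; exists 0 => // x y _ _; rewrite subrr normr0 mul0r addr0 ltW. Qed.

Lemma UC_lip f g (c : R) : UC f ->
  (forall x y, S x -> S y -> `|g x - g y| <= c * `|f x - f y|) -> UC g.
Proof.
move=> uf gf e e0; have c1 : 0 < `|c| + 1 by rewrite ltr_wpDl.
have [C C0 h] := uf _ (divr_gt0 e0 c1).
exists ((`|c| + 1) * C) => [|x y Sx Sy]; first by rewrite mulr_ge0// ltW.
apply: le_trans (gf _ _ Sx Sy) _.
apply: (@le_trans _ _ ((`|c| + 1) * `|f x - f y|)).
  by rewrite ler_wpM2r//; apply: le_trans (ler_norm _) _; rewrite lerDl.
have -> : e + (`|c| + 1) * C * (1 - tau x y)
    = (`|c| + 1) * (e / (`|c| + 1) + C * (1 - tau x y)) by field; rewrite gt_eqF.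
by rewrite ler_pM2l// h.
Qed.

Lemma UCD f g : UC f -> UC g -> UC (fun x => f x + g x).
Proof.
move=> uf ug e e0; have e2 : 0 < e / 2 by rewrite divr_gt0.
have [C C0 hf] := uf _ e2; have [D D0 hg] := ug _ e2.
exists (C + D) => [|x y Sx Sy]; first exact: addr_ge0.
rewrite opprD addrACA; apply: le_trans (ler_normD _ _) _.
by have := hf _ _ Sx Sy; have := hg _ _ Sx Sy; lra.
Qed.

Lemma UCZ c f : UC f -> UC (fun x => c * f x).
Proof. by move=> uf; apply: (UC_lip (c := `|c|) uf) => x y _ _; rewrite -mulrBr normrM. Qed.

Lemma UCM f g : UC f -> UC g -> UC (fun x => f x * g x).
Proof.
move=> uf ug; have [M M0 hM] := bounded_onP (UC_bounded uf).
have [N N0 hN] := bounded_onP (UC_bounded ug).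
move=> e e0.
have N2 : 0 < 2 * N by rewrite mulr_gt0.
have M2 : 0 < 2 * M by rewrite mulr_gt0.
have [C C0 hf] := uf _ (divr_gt0 e0 N2).
have [D D0 hg] := ug _ (divr_gt0 e0 M2).
exists (N * C + M * D) => [|x y Sx Sy]; first by rewrite addr_ge0 ?mulr_ge0// ltW.
have -> : f x * g x - f y * g y = (f x - f y) * g x + f y * (g x - g y) by ring.
apply: le_trans (ler_normD _ _) _; rewrite !normrM.
have h1 : `|f x - f y| * `|g x| <= (e / (2 * N) + C * (1 - tau x y)) * N.
  by apply: ler_pM => //; [exact: hf|exact: hN].
have h2 : `|f y| * `|g x - g y| <= M * (e / (2 * M) + D * (1 - tau x y)).
  by apply: ler_pM => //; [exact: hM|exact: hg].
apply: le_trans (lerD h1 h2) _; rewrite le_eqVlt; apply/orP; left; apply/eqP.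
by field; rewrite !gt_eqF.
Qed.

Lemma UC_sum (I : Type) (r : seq I) (P : pred I) (F : I -> V3 -> R) :
  (forall i, UC (F i)) -> UC (fun x => \sum_(i <- r | P i) F i x).
Proof.
move=> h; elim: r => [|i r ih].
  rewrite (_ : (fun _ => _) = fun=> 0); first exact: UC_cst.
  by apply/funext => x; rewrite big_nil.
case Pi : (P i).
  rewrite (_ : (fun _ => _) = fun x => F i x + \sum_(i <- r | P i) F i x).
    exact: UCD.
  by apply/funext => x; rewrite big_cons Pi.
rewrite (_ : (fun _ => _) = fun x => \sum_(i <- r | P i) F i x) //.
by apply/funext => x; rewrite big_cons Pi.
Qed.

Lemma expR_lip (a b M : R) : a <= M -> b <= M ->
  `|expR a - expR b| <= expR M * `|a - b|.
Proof.
wlog ab : a b / a <= b.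
  by move=> h aM bM; have [/h|/ltW/h] := leP a b; [exact|rewrite distrC (distrC a); exact].
move=> aM bM; rewrite distrC (distrC a) !ger0_norm ?subr_ge0 ?ler_expR//.
have -> : expR b - expR a = expR b * (1 - expR (a - b)).
  by rewrite mulrBr mulr1 -expRD addrCA subrr addr0.
have e1 := expR_ge1Dx (a - b).
by apply: ler_pM; rewrite ?expR_ge0 ?ler_expR ?subr_ge0 ?expR_le1 ?subr_le0//; lra.
Qed.

Lemma UC_expR f : UC f -> UC (fun x => expR (f x)).
Proof.
move=> uf; have [M hM] := UC_bounded uf.
apply: (UC_lip (c := expR M) uf) => x y Sx Sy; apply: expR_lip.
  exact: le_trans (ler_norm _) (hM _ Sx).
exact: le_trans (ler_norm _) (hM _ Sy).
Qed.

Lemma UC_ln f (c : R) : UC f -> 0 < c -> (forall x, S x -> c <= f x) ->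
  UC (fun x => ln (f x)).
Proof.
move=> uf c0 cf; apply: (UC_lip (c := c^-1) uf).
have main x y : S x -> S y -> ln (f x) - ln (f y) <= c^-1 * `|f x - f y|.
  move=> Sx Sy; have fx := lt_le_trans c0 (cf _ Sx); have fy := lt_le_trans c0 (cf _ Sy).
  rewrite -lnV// ?posrE// addrC -lnM ?posrE ?invr_gt0//.
  have := @expR_ge1Dx _ (ln ((f y)^-1 * f x)).
  rewrite lnK ?posrE ?mulr_gt0 ?invr_gt0// -lerBrDl => /le_trans; apply.
  have -> : (f y)^-1 * f x - 1 = (f y)^-1 * (f x - f y) by field; rewrite gt_eqF.
  apply: le_trans (ler_norm _) _; rewrite normrM ler_wpM2r//.
  rewrite ger0_norm ?lef_pV2 ?posrE ?cf//.
  by rewrite invr_ge0 ltW.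
move=> x y Sx Sy; rewrite ler_norml lerNl opprB main// andbT.
by rewrite distrC main.
Qed.

Lemma dotv_CS (x y : V3) : dotv x y ^+ 2 <= dotv x x * dotv y y.
Proof.
rewrite !dotvE -subr_ge0.
set a := x 0 0; set b := x 1 0; set c := x (2%:R) 0.
set u := y 0 0; set v := y 1 0; set w := y (2%:R) 0.
rewrite (_ : _ - _ = (a * v - b * u) ^+ 2 + (a * w - c * u) ^+ 2 + (b * w - c * v) ^+ 2); last by ring.
by rewrite !addr_ge0 ?sqr_ge0.
Qed.

(** Turns a bound on a square, which is what 1 - tau controls, into the affine shape required by
    [UC]. *)
Lemma ler_of_sqr (a b e : R) : 0 < e -> a ^+ 2 <= b -> `|a| <= e + b / e.
Proof.
move=> e0 ab; have b0 : 0 <= b by apply: le_trans ab; exact: sqr_ge0.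
have [ae|/ltW ea] := leP `|a| e.
  by apply: le_trans ae _; rewrite lerDl divr_ge0// ltW.
apply: (@le_trans _ _ (b / e)); last by rewrite lerDr ltW.
rewrite ler_pdivlMr//; apply: le_trans ab.
by rewrite -real_normK ?num_real// expr2 ler_wpM2l.
Qed.

Lemma tau_lip (x y z : V3) : S x -> S y -> S z ->
  (tau x y - tau x z) ^+ 2 <= 1 - tau y z.
Proof.
move=> Sx Sy Sz; rewrite tauE//.
have -> : tau x y - tau x z = dotv x (y - z) / 2.
  by rewrite /tau !dotvE !mxE; field.
rewrite expr_div_n ler_pdivrMr// (_ : _ / 4 * 2 ^+ 2 = dotv (y - z) (y - z)); last by field.
by apply: le_trans (dotv_CS _ _) _; rewrite (Sx : dotv x x = 1) mul1r.
Qed.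

Lemma UC_tauX x n : S x -> UC (fun y => tau x y ^+ n).
Proof.
move=> Sx; elim: n => [|n ih].
  by rewrite (_ : (fun _ => _) = fun=> 1); [exact: UC_cst|apply/funext => y; rewrite expr0].
rewrite (_ : (fun _ => _) = fun y => tau x y * tau x y ^+ n).
  apply: UCM => // e e0; exists e^-1 => [|y z Sy Sz]; first by rewrite invr_ge0 ltW.
  by rewrite [e^-1 * _]mulrC; apply: ler_of_sqr => //; exact: tau_lip.
by apply/funext => y; rewrite exprS.
Qed.

Lemma natr_ge (r : R) : exists N0 : nat, forall N, (N0 <= N)%N -> r <= N.+1%:R.
Proof.
exists (Num.bound `|r|) => N h; apply: le_trans (ler_norm r) _.
apply: le_trans (ltW (archi_boundP (normr_ge0 r))) _.
by rewrite ler_nat leqW.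
Qed.

Definition Vop n f x := sint (fun y => tau x y ^+ n * f y).

Lemma tauXM_bounded x n f : S x -> bounded_on S f ->
  bounded_on S (fun y => tau x y ^+ n * f y).
Proof. by move=> Sx bf; apply: bounded_onM => //; exact: tauX_bounded. Qed.

Lemma Vop_bound n f M x : S x -> (forall y, S y -> `|f y| <= M) ->
  `|Vop n f x| <= M / n.+1%:R.
Proof.
move=> Sx fM; have bf : bounded_on S f by exists M.
have bt := tauXM_bounded n Sx bf.
apply: le_trans (sint_norm bt) _.
rewrite -(sint_tauX n Sx) -sintZ; last exact: tauX_bounded.
apply: sint_le; [exact: bounded_on_norm|exact/bounded_onZ/tauX_bounded|].
move=> y Sy; rewrite normrM [leRHS]mulrC ler_pM ?fM// normrX.
by rewrite ger0_norm ?tau_ge0.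
Qed.

(** (N + 1) tau^N is an approximate identity. As the majorant in [UC] is affine in 1 - tau, two
    moments suffice and the estimate is uniform in x. *)
Lemma Vop_approx f (e : R) : UC f -> 0 < e -> exists N0 : nat, forall N x, (N0 <= N)%N ->
  S x -> `|N.+1%:R * Vop N f x - f x| <= e.
Proof.
move=> uf e0; have e2 : 0 < e / 2 by rewrite divr_gt0.
have [C C0 h] := uf _ e2; have bf := UC_bounded uf.
have [N1 hN1] := natr_ge (C / (e / 2)); exists N1 => N x NN Sx.
have N0 : (0 : R) < N.+1%:R by rewrite ltr0n.
have bt := tauX_bounded N Sx; have btf := tauXM_bounded N Sx bf.
have -> : N.+1%:R * Vop N f x - f x = N.+1%:R * sint (fun y => tau x y ^+ N * (f y - f x)).
  rewrite (_ : sint (fun y => _ * (_ - _)) = Vop N f x - f x * sint (fun y => tau x y ^+ N)).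
    by rewrite sint_tauX//; field; rewrite gt_eqF.
  rewrite -sintZ// -sintB//; last exact: bounded_onZ.
  by apply: sint_ext => y _; ring.
rewrite normrM ger0_norm// mulrC -ler_pdivlMr//.
have bd : bounded_on S (fun y => tau x y ^+ N * (f y - f x)).
  by apply: tauXM_bounded => //; apply: bounded_onB => //; exact: bounded_on_cst.
apply: le_trans (sint_norm bd) _.
have b1 := tau_beta_bounded N 1 Sx.
apply: (@le_trans _ _ (sint (fun y => e / 2 * tau x y ^+ N + C * (tau x y ^+ N * (1 - tau x y) ^+ 1)))).
  apply: sint_le; first exact: bounded_on_norm.
    by apply: bounded_onD; exact: bounded_onZ.
  move=> y Sy; rewrite normrM normrX ger0_norm ?tau_ge0// expr1.
  have := h _ _ Sy Sx; rewrite [tau y x]tauC => hy.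
  have t0 : 0 <= tau x y ^+ N by rewrite exprn_ge0// tau_ge0.
  by nra.
rewrite sintD; [|exact: bounded_onZ|exact: bounded_onZ].
rewrite !sintZ// sint_tauX//.
have hb := sint_tau_beta N 1 Sx.
apply: (@le_trans _ _ (e / 2 / N.+1%:R + C * (1`!%:R / N.+1%:R ^+ 2))).
  by rewrite lerD2l ler_wpM2l.
have := hN1 _ NN; rewrite ler_pdivrMr// => hC.
have -> : e / 2 / N.+1%:R + C * (1`!%:R / N.+1%:R ^+ 2) = (e / 2 + C / N.+1%:R) / N.+1%:R.
  by rewrite -[1`!%:R]/1; field; rewrite gt_eqF.
rewrite ler_pM2r ?invr_gt0//.
have : C / N.+1%:R <= e / 2 by rewrite ler_pdivrMr// mulrC.
by move: (C / _) => z; lra.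
Qed.

Lemma orth_dotv (A : 'M[R]_3) (x y : V3) : dotv (A *m x) y = dotv x (A^T *m y).
Proof.
rewrite /dotv; under eq_bigr do rewrite mxE mulr_suml.
rewrite exchange_big /=; apply: eq_bigr => j _.
by rewrite mxE mulr_sumr; apply: eq_bigr => i _; rewrite mxE; ring.
Qed.

Lemma orth_dotvM (A : 'M[R]_3) (x y : V3) : A^T *m A = 1%:M ->
  dotv (A *m x) (A *m y) = dotv x y.
Proof. by move=> AA; rewrite orth_dotv mulmxA AA mul1mx. Qed.

Lemma orth_sphere (A : 'M[R]_3) (x : V3) : A^T *m A = 1%:M -> S x -> S (A *m x).
Proof. by move=> AA; rewrite /sphere /= orth_dotvM. Qed.

Lemma orth_tr (A : 'M[R]_3) : A^T *m A = 1%:M -> (A^T)^T *m A^T = 1%:M.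
Proof. by move=> AA; rewrite trmxK; exact: mulmx1C. Qed.

Lemma orth_tau (A : 'M[R]_3) (x y : V3) : A^T *m A = 1%:M ->
  tau (A *m x) (A *m y) = tau x y.
Proof. by move=> AA; rewrite /tau orth_dotvM. Qed.

Lemma UC_orth f (A : 'M[R]_3) : A^T *m A = 1%:M -> UC f -> UC (fun x => f (A *m x)).
Proof.
move=> AA uf e /uf[C C0 h]; exists C => // x y Sx Sy.
by apply: le_trans (h _ _ (orth_sphere AA Sx) (orth_sphere AA Sy)) _; rewrite orth_tau.
Qed.

Lemma bounded_on_orth f (A : 'M[R]_3) : A^T *m A = 1%:M -> bounded_on S f ->
  bounded_on S (fun x => f (A *m x)).
Proof. by move=> AA [M h]; exists M => x Sx; apply/h/orth_sphere. Qed.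

(** tau (x, y) is the inner product of (1, x) and (1, y), each divided by sqrt 2. The products
    [feat] are then the coordinates of the n-th tensor power. *)
Definition coord4 (i : 'I_4) (x : V3) : R := (Num.sqrt 2)^-1 *
  (if i == 0 :> nat then 1 else if i == 1%N :> nat then x 0 0
   else if i == 2%N :> nat then x 1 0 else x (2%:R) 0).

Definition feat n (phi : {ffun 'I_n -> 'I_4}) (x : V3) : R :=
  \prod_(k < n) coord4 (phi k) x.

Lemma tau_coord4 (x y : V3) : tau x y = \sum_(i < 4) coord4 i x * coord4 i y.
Proof.
rewrite !big_ord_recl big_ord0 /coord4 /= /tau dotvE.
have s2 : (Num.sqrt 2)^-1 * (Num.sqrt 2)^-1 = 2^-1 :> R.
  by rewrite -invfM -expr2 sqr_sqrtr.
move: s2; move: (Num.sqrt 2)^-1 => s s2.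
transitivity (s * s * (1 + (x 0 0 * y 0 0 + x 1 0 * y 1 0 + x (2%:R) 0 * y (2%:R) 0))).
  by rewrite s2; field.
by ring.
Qed.

Lemma tauX_feat n (x y : V3) :
  tau x y ^+ n = \sum_(phi : {ffun 'I_n -> 'I_4}) feat phi x * feat phi y.
Proof.
rewrite -[n in LHS]card_ord -prodr_const tau_coord4 bigA_distr_bigA /=.
by apply: eq_bigr => phi _; rewrite -big_split.
Qed.

Lemma sphere_coord (x : V3) i : S x -> `|x i 0| <= 1.
Proof.
move=> Sx; rewrite -(@expr_le1 _ 2)// real_normK ?num_real//.
rewrite -(Sx : dotv x x = 1) /dotv (bigD1 i)//= -expr2 lerDl.
by apply: sumr_ge0 => j _; rewrite -expr2 sqr_ge0.
Qed.

Lemma coord4_bounded i : bounded_on S (coord4 i).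
Proof.
apply: bounded_onZ; exists 1 => x Sx.
by do 3?case: ifP => _; rewrite ?normr1// sphere_coord.
Qed.

Lemma feat_bounded n (phi : {ffun 'I_n -> 'I_4}) : bounded_on S (feat phi).
Proof.
rewrite /feat; elim: (index_enum _) => [|k r ih].
  by exists 1 => x _; rewrite big_nil normr1.
have [M h] := bounded_onM (coord4_bounded (phi k)) ih.
by exists M => x Sx; rewrite big_cons h.
Qed.

Lemma Vop_feat n f x : bounded_on S f ->
  Vop n f x = \sum_(phi : {ffun 'I_n -> 'I_4}) feat phi x * sint (fun y => feat phi y * f y).
Proof.
move=> bf.
transitivity (sint (fun y => \sum_(phi : {ffun 'I_n -> 'I_4}) feat phi x * (feat phi y * f y))).
  by apply: sint_ext => y _; rewrite tauX_feat mulr_suml; apply: eq_bigr => phi _; rewrite mulrA.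
have bff phi : bounded_on S (fun y => @feat n phi y * f y).
  by apply: bounded_onM => //; exact: feat_bounded.
rewrite sint_sum; last by move=> phi; apply: bounded_onZ.
by apply: eq_bigr => phi _; rewrite sintZ.
Qed.

(** For [Vop N f] this is an exchange of means through finitely many features: the mean over x of
    tau (A x, y)^N is taken around A^T y, where it is 1 / (N + 1) as around any point. Uniform
    approximation of f by (N + 1) [Vop N f] does the rest. *)
Lemma sint_orth f (A : 'M[R]_3) : A^T *m A = 1%:M -> UC f ->
  sint (fun x => f (A *m x)) = sint f.
Proof.
move=> AA uf; have bf := UC_bounded uf.
apply/eqP; rewrite -subr_eq0 -normr_eq0; apply/eqP/le_anti; rewrite normr_ge0 andbT.
apply/ler_addgt0Pr => e e0; rewrite add0r.
have [N hN] := Vop_approx uf e0.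
have bV : bounded_on S (fun x => Vop N f (A *m x)).
  have [M hM] := bf; exists (M / N.+1%:R) => x Sx.
  by apply: Vop_bound hM; exact: orth_sphere.
have -> : sint f = N.+1%:R * sint (fun x => Vop N f (A *m x)).
  transitivity (N.+1%:R * sint (fun y => N.+1%:R^-1 * f y)).
    by rewrite sintZ// mulVKf// pnatr_eq0.
  congr (_ * _).
  pose c phi := sint (fun y => @feat N phi y * f y).
  pose d phi := sint (fun x => @feat N phi (A *m x)).
  have bff phi : bounded_on S (fun y => @feat N phi y * f y).
    by apply: bounded_onM => //; exact: feat_bounded.
  have bfA phi : bounded_on S (fun y => @feat N phi (A *m y)).
    by apply: (bounded_on_orth AA); exact: feat_bounded.
  transitivity (\sum_phi d phi * c phi).
    transitivity (sint (fun y => \sum_phi d phi * (@feat N phi y * f y))); last first.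
      rewrite sint_sum; last by move=> phi; apply: bounded_onZ.
      by apply: eq_bigr => phi _; rewrite sintZ.
    apply: sint_ext => y Sy.
    have Ay : S (A^T *m y) by apply: orth_sphere => //; exact: orth_tr.
    rewrite -(sint_tauX N Ay).
    transitivity (sint (fun x => \sum_phi @feat N phi y * @feat N phi (A *m x)) * f y).
      congr (_ * _); apply: sint_ext => x Sx.
      by rewrite -tauX_feat tauC [in RHS]tauC /tau orth_dotv.
    rewrite sint_sum; last by move=> phi; apply: bounded_onZ.
    by rewrite mulr_suml; apply: eq_bigr => phi _; rewrite sintZ//; rewrite /d; ring.
  transitivity (sint (fun x => \sum_phi c phi * @feat N phi (A *m x))).
    rewrite sint_sum; last by move=> phi; apply: bounded_onZ.
    by apply: eq_bigr => phi _; rewrite sintZ// mulrC.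
  by apply: sint_ext => x Sx; rewrite Vop_feat//; apply: eq_bigr => phi _; rewrite mulrC.
rewrite -sintZ// -sintB; [|exact: bounded_on_orth|exact: bounded_onZ].
apply: sint_bound => x Sx; rewrite distrC; apply: hN => //; exact: orth_sphere.
Qed.

Lemma Vop_orth n f (A : 'M[R]_3) x : A^T *m A = 1%:M -> UC f -> S x ->
  Vop n f (A *m x) = Vop n (fun y => f (A *m y)) x.
Proof.
move=> AA uf Sx; rewrite /Vop -(sint_orth AA); last first.
  by apply: UCM => //; apply: UC_tauX; exact: orth_sphere.
by apply: sint_ext => y Sy; rewrite orth_tau.
Qed.

Lemma VopD n f g x : S x -> bounded_on S f -> bounded_on S g ->
  Vop n (fun y => f y + g y) x = Vop n f x + Vop n g x.
Proof.
move=> Sx bf bg; rewrite /Vop -sintD; try exact: tauXM_bounded.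
by apply: sint_ext => y _; rewrite mulrDr.
Qed.

Lemma VopZ n c f x : S x -> bounded_on S f ->
  Vop n (fun y => c * f y) x = c * Vop n f x.
Proof.
move=> Sx bf; rewrite /Vop -sintZ; last exact: tauXM_bounded.
by apply: sint_ext => y _; rewrite mulrCA.
Qed.

Definition Lpart N f x := \sum_(n < N) Vop n.+1 f x / n.+1%:R.

(* The kernel sum_n tau ^ n / n = - ln (1 - tau) is 4 pi times the Green
   function of the sphere, up to an additive constant. *)
Definition Lop f x := ulim (fun N => Lpart N f x).

(** The term of index n is at most M / ((n + 1) (n + 2)), which telescopes. *)
Lemma Lpart_tail f M x N k : S x -> (forall y, S y -> `|f y| <= M) ->
  `|Lpart (N + k) f x - Lpart N f x| <= M / N.+1%:R.
Proof.
move=> Sx fM; have M0 : 0 <= M by have [y Sy] := sphere_nonempty; exact: le_trans (normr_ge0 _) (fM _ Sy).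
apply: (@le_trans _ _ (M * (N.+1%:R^-1 - (N + k).+1%:R^-1))); last first.
  by rewrite ler_wpM2l// gerBl invr_ge0.
elim: k => [|k ih]; first by rewrite addn0 !subrr normr0 mulr0.
rewrite addnS /Lpart big_ord_recr /= -!/(Lpart _ _ _) addrAC.
apply: le_trans (ler_normD _ _) _.
have := Vop_bound (N + k).+1 Sx fM => h.
have : `|Vop (N + k).+1 f x / (N + k).+1%:R| <= M / (N + k).+2%:R / (N + k).+1%:R.
  by rewrite normrM [X in _ * X]ger0_norm ?invr_ge0// ler_wpM2r ?invr_ge0.
have -> : M / (N + k).+2%:R / (N + k).+1%:R = M * ((N + k).+1%:R^-1 - (N + k).+2%:R^-1).
  have a0 : 0 < (N + k).+1%:R :> R by rewrite ltr0n.
  have -> : ((N + k).+2%:R : R) = (N + k).+1%:R + 1 by rewrite natr1.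
  move: ((N + k).+1%:R : R) a0 => a a0.
  by field; apply/andP; split; rewrite gt_eqF// addr_gt0.
by move=> h2; apply: le_trans (lerD ih h2) _; rewrite -mulrDr addrA subrK.
Qed.

Lemma Lpart_bound f M x N : S x -> (forall y, S y -> `|f y| <= M) ->
  `|Lpart N f x| <= M.
Proof.
move=> Sx fM; have := Lpart_tail 0 N Sx fM.
by rewrite add0n {2}/Lpart big_ord0 subr0 divr1.
Qed.

Lemma Lop_tail f M x N : S x -> (forall y, S y -> `|f y| <= M) ->
  `|Lop f x - Lpart N f x| <= M / N.+1%:R.
Proof.
move=> Sx fM; have c := ulim_cvg (fun n => Lpart_bound n Sx fM).
have c2 : `|Lpart n f x - Lpart N f x| @[n --> ufilter] --> `|Lop f x - Lpart N f x|.
  by apply: cvg_norm; apply: cvgB => //; exact: cvg_cst.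
apply: (cvgr_to_le c2); apply: ufilter_oo; exists N => // n /= Nn.
by rewrite -(subnKC Nn); exact: Lpart_tail.
Qed.

Lemma Lop_bound f M x : S x -> (forall y, S y -> `|f y| <= M) -> `|Lop f x| <= M.
Proof.
move=> Sx fM; have := Lop_tail 0 Sx fM.
by rewrite /Lpart big_ord0 subr0 divr1.
Qed.

Lemma Lpart_ext N f g x : (forall y, S y -> f y = g y) -> Lpart N f x = Lpart N g x.
Proof.
move=> fg; apply: eq_bigr => n _; congr (_ / _); apply: sint_ext => y Sy.
by rewrite fg.
Qed.

Lemma Lop_ext f g x : (forall y, S y -> f y = g y) -> Lop f x = Lop g x.
Proof. by move=> fg; congr (ulim _); apply/funext => N; exact: Lpart_ext. Qed.

Lemma LopD f g x : S x -> bounded_on S f -> bounded_on S g ->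
  Lop (fun y => f y + g y) x = Lop f x + Lop g x.
Proof.
move=> Sx bf bg; have [M hM] := bf; have [P hP] := bg.
rewrite /Lop -(ulimD (fun n => Lpart_bound n Sx hM) (fun n => Lpart_bound n Sx hP)).
congr (ulim _); apply/funext => N; rewrite /Lpart -big_split.
by apply: eq_bigr => n _; rewrite VopD// mulrDl.
Qed.

Lemma LopZ c f x : S x -> bounded_on S f -> Lop (fun y => c * f y) x = c * Lop f x.
Proof.
move=> Sx bf; have [M hM] := bf.
rewrite /Lop -(ulimZ c (fun n => Lpart_bound n Sx hM)).
congr (ulim _); apply/funext => N; rewrite /Lpart mulr_sumr.
by apply: eq_bigr => n _; rewrite VopZ// mulrA.
Qed.

Lemma Lop_orth f (A : 'M[R]_3) x : A^T *m A = 1%:M -> UC f -> S x ->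
  Lop f (A *m x) = Lop (fun y => f (A *m y)) x.
Proof.
move=> AA uf Sx; congr (ulim _); apply/funext => N; apply: eq_bigr => n _.
by rewrite Vop_orth.
Qed.

End UniformlyContinuous.

(** * Moser-Trudinger inequality and the variational problem *)

Section ExponentialIntegral.
Variable R : realType.
Local Notation V3 := 'cV[R]_3.
Local Notation S := (@sphere R).

Definition ell N (t : R) : R := \sum_(n < N) t ^+ n.+1 / n.+1%:R.

Lemma expR_le_inv (z : R) : z < 1 -> expR z <= (1 - z)^-1.
Proof.
move=> z1; have h := expR_ge1Dx (- z).
rewrite -[z in leLHS]opprK expRN lef_pV2 ?posrE ?expR_gt0//.
by rewrite subr_gt0.
Qed.

(** With x = s / (k + 1) it is enough that exp (x - x^2) <= 1 + x, which follows from exp z <= 1 /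
    (1 - z) and (1 + x) (1 - x + x^2) = 1 + x^3. The exponential is traded for a polynomial because
    polynomials in tau have explicit means. *)
Lemma expR_le_powS (s : R) k : 0 <= s ->
  expR s <= (1 + s / k.+1%:R) ^+ k.+1 * expR (s ^+ 2 / k.+1%:R).
Proof.
move=> s0; have k0 : (0 : R) < k.+1%:R by rewrite ltr0n.
pose x := s / k.+1%:R; have x0 : 0 <= x by rewrite divr_ge0// ltW.
have sE : s = k.+1%:R * x by rewrite /x; field; rewrite gt_eqF.
have h : expR x <= (1 + x) * expR (x ^+ 2).
  have : expR (x - x ^+ 2) <= 1 + x.
    have z1 : x - x ^+ 2 < 1 by nra.
    apply: le_trans (expR_le_inv z1) _.
    rewrite -[leLHS]div1r ler_pdivrMr ?subr_gt0//.
    have : 0 <= x * x * x by rewrite !mulr_ge0.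
    by nra.
  by rewrite -(ler_pM2r (expR_gt0 (x ^+ 2))) -expRD subrK.
have -> : s ^+ 2 / k.+1%:R = k.+1%:R * x ^+ 2.
  by rewrite sE; field; rewrite gt_eqF.
rewrite -/x [in leLHS]sE !expRM_natl -exprMn lerXn2r// nnegrE ?expR_ge0//.
by rewrite mulr_ge0 ?expR_ge0 ?addr_ge0.
Qed.

Lemma ell_ge0 N t : 0 <= t -> 0 <= ell N t.
Proof. by move=> t0; apply: sumr_ge0 => n _; rewrite divr_ge0// exprn_ge0. Qed.

Lemma ell_le N t : 0 <= t <= 1 -> ell N t <= N%:R.
Proof.
move=> /andP[t0 t1]; rewrite -[N in leRHS]card_ord -sumr_const; apply: ler_sum => n _.
rewrite ler_pdivrMr ?ltr0n// mul1r (le_trans (exprn_ile1 _ t0 t1))//.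
by rewrite ler1n.
Qed.

Lemma ell_tau_bounded N x : S x -> bounded_on S (fun y => ell N (tau x y)).
Proof.
move=> Sx; exists N%:R => y Sy; have t := tau_unit Sx Sy.
by rewrite ger0_norm ?ell_le ?ell_ge0//; case/andP: t.
Qed.

(* With E = (1 + b l / k) ^ k ~ exp (b l), one has (- (1 - t) E)' >= (1 - b) E,
   because (1 - t) l' <= 1; so the mean of E is at most (1 - b) ^ -1. *)
Lemma sint_exp_ell N x (b : R) : S x -> 0 <= b -> b < 1 ->
  sint (fun y => expR (b * ell N (tau x y))) <= expR 1 / (1 - b).
Proof.
move=> Sx b0 b1; pose W := b * N%:R.
(* W bounds b l on [0, 1]. Once k + 1 >= W^2, the error factor exp ((b l)^2 / (k + 1)) is at most e,
   whence the [expR 1] of the statement. *)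
have [N0 hN0] := natr_ge (W ^+ 2); pose k := N0; have hk : W ^+ 2 <= k.+1%:R by exact: hN0.
have k0 : (0 : R) < k.+1%:R by rewrite ltr0n.
pose lP : {poly R} := \sum_(n < N) n.+1%:R^-1 *: 'X^(n.+1).
have lPE t : lP.[t] = ell N t.
  by rewrite /lP horner_sum; apply: eq_bigr => n _; rewrite hornerZ hornerXn mulrC.
have lP' : lP^`() = \sum_(n < N) 'X^n.
  rewrite /lP raddf_sum; apply: eq_bigr => n _ /=.
  by rewrite derivZ derivXn /= -scalerMnr scalerMnl -[_^-1 *+ _]mulr_natr mulVf ?scale1r// pnatr_eq0.
pose p : {poly R} := 1 + (b / k.+1%:R) *: lP.
have pE t : p.[t] = 1 + b * ell N t / k.+1%:R.
  by rewrite /p hornerD hornerZ lPE hornerC mulrAC.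
pose E := p ^+ k.+1; pose Gp := ('X - 1) * E.
have G1 : Gp.[1] = 0 by rewrite /Gp hornerM !hornerE subrr mul0r.
have G0 : Gp.[0] = -1.
  rewrite /Gp hornerM /E horner_exp pE /ell big1 ?mulr0 ?mul0r ?addr0 ?expr1n ?mulr1.
    by rewrite !hornerE.
  by move=> n _; rewrite expr0n mul0r.
have main t : 0 <= t <= 1 -> (1 - b) * E.[t] <= Gp^`().[t].
  move=> t01; have /andP[t0 t1] := t01.
  have d : Gp^`() = E + ('X - 1) * ((b / k.+1%:R) *: (\sum_(n < N) 'X^n) * p ^+ k *+ k.+1).
    rewrite /Gp derivM derivB derivX derivC subr0 mul1r /E deriv_exp /=.
    by rewrite /p derivD derivC add0r derivZ lP'.
  have g : (1 - t) * (\sum_(n < N) 'X^n : {poly R}).[t] = 1 - t ^+ N.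
    rewrite horner_sum -[in RHS](expr1n _ N) subrXX; congr (_ * _).
    apply: eq_bigr => n _; rewrite hornerXn.
    by rewrite expr1n mul1r.
  rewrite d hornerD hornerM hornerMn hornerM hornerZ hornerD hornerN hornerX hornerC.
  rewrite /E !horner_exp exprS.
  set L := (\sum_(n < N) 'X^n).[t] in g *.
  set P := p.[t]; rewrite -[_ *+ k.+1]mulr_natr.
  have P1 : 1 <= P.
    by rewrite /P pE lerDl divr_ge0// mulr_ge0// ell_ge0.
  have Pk : 0 <= P ^+ k by rewrite exprn_ge0// (le_trans ler01).
  have -> : P * P ^+ k + (t - 1) * (b / k.+1%:R * L * P ^+ k * k.+1%:R)
     = P ^+ k * (P - b * ((1 - t) * L)) by field; rewrite gt_eqF.
  rewrite g mulrA [leLHS]mulrC ler_wpM2l//.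
  have : 0 <= t ^+ N by rewrite exprn_ge0.
  by nra.
have bE : bounded_on S (fun y => E.[tau x y]).
  have [M hM] := ell_tau_bounded N Sx.
  apply: (@bounded_on_le _ _ _ _ (fun=> (1 + b * N%:R / k.+1%:R) ^+ k.+1)); first exact: bounded_on_cst.
  move=> y Sy; have t := tau_unit Sx Sy; have /andP[t0 t1] := t.
  rewrite /E horner_exp pE normrX lerXn2r// ?nnegrE//.
    by rewrite addr_ge0// divr_ge0// mulr_ge0.
  rewrite ger0_norm ?lerD2l ?ler_wpM2r ?invr_ge0// ?ler_wpM2l ?ell_le//.
  by rewrite addr_ge0// divr_ge0// mulr_ge0// ell_ge0.
have bG : bounded_on S (fun y => Gp^`().[tau x y]).
  apply: (@bounded_on_le _ _ _ _ (fun y => \sum_(i < size Gp^`()) `|Gp^`()`_i|)).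
    exact: bounded_on_cst.
  move=> y Sy; rewrite horner_coef; apply: le_trans (ler_norm_sum _ _ _) _.
  apply: ler_sum => i _; rewrite normrM ler_piMr// normrX exprn_ile1//.
  exact: tau_norm_le1.
have sE : (1 - b) * sint (fun y => E.[tau x y]) <= 1.
  rewrite -sintZ//; apply: (@le_trans _ _ (sint (fun y => Gp^`().[tau x y]))).
    by apply: sint_le => //; [exact: bounded_onZ|move=> y Sy; apply/main/tau_unit].
  by rewrite sint_tau_deriv// G1 G0 sub0r opprK.
have b1' : 0 < 1 - b by rewrite subr_gt0.
apply: (@le_trans _ _ (sint (fun y => expR 1 * E.[tau x y]))).
  apply: sint_le; [|exact: bounded_onZ|].
    by apply/bounded_on_expR/bounded_onZ/ell_tau_bounded.
  move=> y Sy; have t := tau_unit Sx Sy; have /andP[t0 t1] := t.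
  have l0 : 0 <= b * ell N (tau x y) by rewrite mulr_ge0// ell_ge0.
  apply: le_trans (expR_le_powS k l0) _; rewrite mulrC /E horner_exp pE.
  rewrite ler_wpM2r ?ler_expR//.
    by rewrite exprn_ge0// addr_ge0// divr_ge0// ltW.
  rewrite ler_pdivrMr// mul1r; apply: le_trans hk.
  rewrite lerXn2r ?nnegrE ?l0 ?mulr_ge0//.
  by rewrite ler_wpM2l// ell_le.
rewrite sintZ// ler_wpM2l ?expR_ge0// -[leRHS]div1r ler_pdivlMr//.
by rewrite mulrC.
Qed.

End ExponentialIntegral.

(** * The functional on a finite-dimensional space, its maximum and the Euler-Lagrange equation *)

Section Variational.
Variable R : realType.
Local Notation V3 := 'cV[R]_3.
Local Notation S := (@sphere R).
Variables (I : finType) (e : I -> V3 -> R).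
Hypothesis be : forall i, bounded_on S (e i).
Implicit Types p q : I -> R.

Definition lincomb p x := \sum_i p i * e i x.

Definition normsq p := \sum_i p i ^+ 2.

Lemma lincomb_bounded p : bounded_on S (lincomb p).
Proof. by apply: bounded_on_sum => i; exact: bounded_onZ. Qed.

Lemma exp2_bounded (u : V3 -> R) : bounded_on S u ->
  bounded_on S (fun x => expR (2 * u x)).
Proof. by move=> bu; apply/bounded_on_expR/bounded_onZ. Qed.

(* Moser-Trudinger by duality: Gibbs' inequality, applied to the density
   proportional to exp (2 u), bounds its energy by its entropy. *)
Lemma moser_trudinger (C : R) :
  (forall x, S x -> sint (fun y => expR (3 / 2 * \sum_i e i x * e i y)) <= expR C) ->
  forall p, sint (fun x => expR (2 * lincomb p x)) <= expR (C + 2 / 3 * normsq p).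
Proof.
move=> hC p; set Z := sint _; pose u := lincomb p.
have bu : bounded_on S u by exact: lincomb_bounded.
have b2 : bounded_on S (fun x => expR (2 * u x)) by exact: exp2_bounded.
have Z0 : 0 < Z.
  have [M hM] := bu; apply: (@lt_le_trans _ _ (expR (2 * - M))); first exact: expR_gt0.
  rewrite -(sint_cst (expR _)); apply: sint_le => //; first exact: bounded_on_cst.
  by move=> x /hM; rewrite ler_expR ler_norml ler_pM2l// => /andP[].
pose rho x := expR (2 * u x) / Z.
have brho : bounded_on S rho.
  by have [M h] := bounded_onZ Z^-1 b2; exists M => x /h; rewrite mulrC.
have rho1 : sint rho = 1.
  transitivity (Z^-1 * Z); last by rewrite mulVf// gt_eqF.
  by rewrite -[in RHS]sintZ//; apply: sint_ext => x _; rewrite mulrC.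
have rho0 x : 0 < rho x by rewrite divr_gt0// expR_gt0.
pose m i := sint (fun x => rho x * e i x).
have bm i : bounded_on S (fun x => rho x * e i x) by exact: bounded_onM.
(* The entropy of rho, that is, the mean of rho ln rho. *)
pose H := 2 * sint (fun x => rho x * u x) - ln Z.
have su : sint (fun x => rho x * u x) = \sum_i p i * m i.
  transitivity (sint (fun x => \sum_i p i * (rho x * e i x))).
    by apply: sint_ext => x _; rewrite mulr_sumr; apply: eq_bigr => i _; ring.
  rewrite sint_sum; last by move=> i; exact: bounded_onZ.
  by apply: eq_bigr => i _; rewrite sintZ.
(* The entropy is compared with that of exp (g - C), whose mass is at most 1 by hypothesis; the
   pointwise inequality is exp s >= 1 + s. Averaging over x with weight rho then gives [mm]. *)
have gibbs x : S x -> 3 / 2 * \sum_i e i x * m i <= H + C.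
  move=> Sx; pose g y := 3 / 2 * \sum_i e i x * e i y.
  have bg : bounded_on S g.
    by apply: bounded_onZ; apply: bounded_on_sum => i; exact: bounded_onZ.
  have b3 : bounded_on S (fun y => rho y * g y) by exact: bounded_onM.
  have b4 : bounded_on S (fun y => rho y * u y) by exact: bounded_onM.
  have sg : sint (fun y => rho y * g y) = 3 / 2 * \sum_i e i x * m i.
    transitivity (sint (fun y => 3 / 2 * \sum_i e i x * (rho y * e i y))).
      apply: sint_ext => y _; rewrite mulrCA mulr_sumr; congr (_ * _).
      by apply: eq_bigr => i _; ring.
    rewrite sintZ; last by apply: bounded_on_sum => i; exact: bounded_onZ.
    rewrite sint_sum; last by move=> i; exact: bounded_onZ.
    by congr (_ * _); apply: eq_bigr => i _; rewrite sintZ.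
  have : sint (fun y => rho y * g y + (- 2) * (rho y * u y) + (ln Z - C + 1) * rho y)
      <= sint (fun y => expR (- C) * expR (g y)).
    apply: sint_le.
    - apply: bounded_onD; [apply: bounded_onD|]; rewrite //; exact: bounded_onZ.
    - by apply/bounded_onZ/bounded_on_expR.
    move=> y Sy; have h := expR_ge1Dx (g y - C - 2 * u y + ln Z).
    have -> : expR (- C) * expR (g y) = rho y * expR (g y - C - 2 * u y + ln Z).
      rewrite /rho [expR (g y - C - 2 * u y + ln Z)]expRD lnK ?posrE//.
      rewrite mulrAC mulrA mulfK ?gt_eqF// -!expRD; congr expR; ring.
    apply: le_trans (ler_wpM2l (ltW (rho0 y)) h); rewrite le_eqVlt; apply/orP; left.
    by apply/eqP; ring.
  rewrite sintD; [|apply: bounded_onD => //; exact: bounded_onZ|exact: bounded_onZ].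
  rewrite sintD//; last exact: bounded_onZ.
  rewrite !sintZ//; last exact: bounded_on_expR.
  rewrite rho1 sg mulr1 => h1.
  have : expR (- C) * sint (fun y => expR (g y)) <= 1.
    by rewrite expRN mulrC ler_pdivrMr ?expR_gt0// mul1r hC.
  by rewrite /H; lra.
have mm : 3 / 2 * \sum_i m i ^+ 2 <= H + C.
  have -> : H + C = sint (fun x => (H + C) * rho x) by rewrite sintZ// rho1 mulr1.
  have -> : 3 / 2 * \sum_i m i ^+ 2 = sint (fun x => \sum_i (3 / 2 * m i) * (rho x * e i x)).
    rewrite sint_sum; last by move=> i; exact: bounded_onZ.
    by rewrite mulr_sumr; apply: eq_bigr => i _; rewrite sintZ// expr2 mulrA.
  apply: sint_le; [|exact: bounded_onZ|].
    by apply: bounded_on_sum => i; exact: bounded_onZ.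
  move=> x Sx; rewrite [leRHS]mulrC.
  have -> : \sum_i 3 / 2 * m i * (rho x * e i x) = rho x * (3 / 2 * \sum_i e i x * m i).
    by rewrite !mulr_sumr; apply: eq_bigr => i _; ring.
  by rewrite ler_wpM2l ?gibbs// ltW.
(* Young's inequality with reciprocal weights 2 / 3 and 3 / 2, so that the term in m is exactly the
   one bounded by [mm]. *)
have pm : 2 * \sum_i p i * m i <= 2 / 3 * normsq p + 3 / 2 * \sum_i m i ^+ 2.
  rewrite /normsq !mulr_sumr -big_split /=; apply: ler_sum => i _.
  have := sqr_ge0 (2 * p i - 3 * m i); rewrite !expr2; nra.
have : ln Z <= C + 2 / 3 * normsq p by move: mm; rewrite /H su; lra.
by rewrite -ler_expR lnK.
Qed.

Variable K : V3 -> R.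
Hypothesis bK : bounded_on S K.

Definition Jfun p := sint (fun x => K x * expR (2 * lincomb p x - normsq p)).

Lemma JfunE p : Jfun p = expR (- normsq p) * sint (fun x => K x * expR (2 * lincomb p x)).
Proof.
rewrite -sintZ; last by apply: bounded_onM => //; exact/exp2_bounded/lincomb_bounded.
by apply: sint_ext => x _; rewrite expRD; ring.
Qed.

Lemma normsq_ge0 p : 0 <= normsq p.
Proof. by apply: sumr_ge0 => i _; exact: sqr_ge0. Qed.

(** As the Moser-Trudinger constant 2 / 3 is below 1, the factor exp (- |p|^2) wins and leaves the
    decay exp (- |p|^2 / 3). *)
Lemma Jfun_le (C Km : R) p : (forall x, S x -> `|K x| <= Km) ->
  sint (fun x => expR (2 * lincomb p x)) <= expR (C + 2 / 3 * normsq p) ->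
  Jfun p <= Km * expR (C - normsq p / 3).
Proof.
move=> hK h; rewrite JfunE.
have b2 := exp2_bounded (lincomb_bounded p).
have Km0 : 0 <= Km.
  by have [x Sx] := sphere_nonempty R; exact: le_trans (normr_ge0 _) (hK _ Sx).
have h1 : sint (fun x => K x * expR (2 * lincomb p x)) <= Km * expR (C + 2 / 3 * normsq p).
  apply: (@le_trans _ _ (Km * sint (fun x => expR (2 * lincomb p x)))); last by rewrite ler_wpM2l.
  rewrite -sintZ//; apply: sint_le; [exact: bounded_onM|exact: bounded_onZ|].
  move=> x Sx; rewrite ler_wpM2r ?expR_ge0//.
  exact: le_trans (ler_norm _) (hK _ Sx).
apply: le_trans (ler_wpM2l (expR_ge0 _) h1) _.
rewrite mulrCA -expRD le_eqVlt; apply/orP; left; apply/eqP; congr (_ * expR _).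
by field.
Qed.

Lemma Jfun_lip (B : R) : 0 <= B -> exists2 L : R, 0 <= L & forall p q,
  (forall i, `|p i| <= B) -> (forall i, `|q i| <= B) ->
  Jfun p <= Jfun q + L * \sum_i `|p i - q i|.
Proof.
move=> B0; have [Km Km0 hK] := bounded_onP bK.
have [E E0 hE] : exists2 E : R, 0 <= E & forall i x, S x -> `|e i x| <= E.
  have /choice[F hF] : forall i, exists M : R, forall x, S x -> `|e i x| <= M by move=> i; exact: be.
  exists (\sum_i `|F i|) => [|i x Sx]; first exact: sumr_ge0.
  apply: le_trans (hF i x Sx) _; apply: le_trans (ler_norm _) _.
  by rewrite (bigD1 i)//= lerDl sumr_ge0.
pose W := \sum_(i : I) 2 * (B * E).
exists (Km * (expR W * (2 * E + 2 * B))) => [|p q pB qB].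
  by rewrite !mulr_ge0 ?expR_ge0 ?addr_ge0 ?mulr_ge0// ltW.
pose g p x := 2 * lincomb p x - normsq p.
have bg r : bounded_on S (fun x => K x * expR (g r x)).
  apply: bounded_onM => //; apply: bounded_on_expR; apply: bounded_onB.
    exact/bounded_onZ/lincomb_bounded.
  exact: bounded_on_cst.
rewrite -lerBlDl -sintB; [|exact: bg|exact: bg].
have gW r x : (forall i, `|r i| <= B) -> S x -> g r x <= W.
  move=> rB Sx; apply: (@le_trans _ _ (2 * lincomb r x)); first by rewrite gerBl normsq_ge0.
  rewrite /lincomb mulr_sumr; apply: ler_sum => i _; rewrite ler_pM2l//.
  by apply: le_trans (ler_norm _) _; rewrite normrM ler_pM// hE.
apply: le_trans (ler_norm _) _; apply: sint_bound => x Sx.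
rewrite -mulrBr normrM -mulrA ler_pM// ?hK//.
apply: le_trans (expR_lip (gW _ _ pB Sx) (gW _ _ qB Sx)) _.
rewrite -[leRHS]mulrA ler_wpM2l ?expR_ge0//.
have -> : g p x - g q x = \sum_i (p i - q i) * (2 * e i x - (p i + q i)).
  rewrite /g /lincomb /normsq !mulr_sumr -!sumrB; apply: eq_bigr => i _.
  by ring.
apply: le_trans (ler_norm_sum _ _ _) _; rewrite mulr_sumr; apply: ler_sum => i _.
rewrite normrM mulrC ler_wpM2r//; apply: le_trans (ler_normB _ _) _.
apply: lerD; first by rewrite normrM ger0_norm// ler_pM2l// hE.
by apply: le_trans (ler_normD _ _) _; rewrite mulr_natl mulr2n lerD.
Qed.

(** A maximising sequence stays in the box of side B, so each coordinate converges along the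
    ultrafilter, and the Lipschitz bound carries the supremum to the limit. *)
Lemma coercive_max (J : (I -> R) -> R) q0 (B ub : R) :
  (forall p, J p <= ub) -> (forall p, J q0 <= J p -> forall i, `|p i| <= B) ->
  (exists2 L : R, 0 <= L & forall p q,
    (forall i, `|p i| <= B) -> (forall i, `|q i| <= B) ->
    J p <= J q + L * \sum_i `|p i - q i|) ->
  exists p, forall q, J q <= J p.
Proof.
move=> hub hB [L L0 hL]; pose A := range J.
have hA : has_sup A by split; [exists (J q0), q0|exists ub => _ [p _ <-]].
pose M := sup A.
have leM q : J q <= M by apply: sup_upper_bound => //; exists q.
have /choice[P hP] : forall k : nat, exists p, J q0 <= J p /\ M - k.+1%:R^-1 <= J p.
  move=> k; have k0 : (0 : R) < k.+1%:R^-1 by rewrite invr_gt0.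
  have [_ [r _ <-] hr] := sup_adherent k0 hA.
  have [h|/ltW h] := leP (J q0) (J r).
    by exists r; split => //; exact: ltW.
  by exists q0; split => //; apply: le_trans h; exact: ltW.
have PD k i : `|P k i| <= B by apply: hB; have [] := hP k.
pose pl i := ulim (fun k => P k i).
have cP i : P k i @[k --> ufilter] --> pl i by exact: (ulim_cvg (fun k => PD k i)).
have plD i : `|pl i| <= B.
  by apply: (cvgr_to_le (cvg_norm (cP i))); apply: filterE => k; exact: PD.
exists pl => q; apply: le_trans (leM q) _.
have h k : 0 <= J pl + L * \sum_i `|P k i - pl i| + k.+1%:R^-1 - M.
  have := hL _ _ (PD k) plD; have [_] := hP k.
  by move: (k.+1%:R^-1) => z; lra.
have c : J pl + L * \sum_i `|P k i - pl i| + k.+1%:R^-1 - M @[k --> ufilter]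
    --> J pl + L * (\sum_(i : I) `|pl i - pl i|) + 0 - M.
  apply: cvgB; last exact: cvg_cst.
  apply: cvgD.
    apply: cvgD; first exact: cvg_cst.
    apply: cvgM; first exact: cvg_cst.
    apply: cvg_sumr => i; apply: cvg_norm; apply: cvgB => //; exact: cvg_cst.
  by apply: cvg_trans (@cvg_harmonic R) => X /=; exact: ufilter_oo.
have : 0 <= J pl + L * (\sum_(i : I) `|pl i - pl i|) + 0 - M.
  by apply: (cvgr_to_ge c); exact: filterE.
rewrite big1 ?mulr0 ?addr0; last by move=> i _; rewrite subrr normr0.
by rewrite subr_ge0.
Qed.

Lemma normsq_bound (A B s : R) : 0 < A -> A <= B * expR (- (s / 3)) -> s <= 3 * (B / A).
Proof.
move=> A0; rewrite expRN ler_pdivlMr ?expR_gt0// mulrC -ler_pdivlMr// => h.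
by have := expR_ge1Dx (s / 3); lra.
Qed.

Lemma Jfun_max (C Km : R) q0 : (forall x, S x -> `|K x| <= Km) ->
  (forall p, sint (fun x => expR (2 * lincomb p x)) <= expR (C + 2 / 3 * normsq p)) ->
  0 < Jfun q0 -> exists2 p, (forall q, Jfun q <= Jfun p) &
    normsq p <= 3 * (Km * expR C / Jfun q0).
Proof.
move=> hK hC J0.
have Jle p := Jfun_le hK (hC p).
have Km0 : 0 <= Km.
  by have [x Sx] := sphere_nonempty R; exact: le_trans (normr_ge0 _) (hK _ Sx).
have lip := Jfun_lip; move: Jfun J0 Jle lip => J J0 Jle lip.
pose D := 3 * (Km * expR C / J q0).
have D0 : 0 <= D by rewrite mulr_ge0// divr_ge0 ?mulr_ge0 ?expR_ge0// ltW.
have ns p : J q0 <= J p -> normsq p <= D.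
  move=> h; apply: normsq_bound => //; apply: le_trans h _; apply: le_trans (Jle p) _.
  by rewrite expRD mulrA.
have [p hp] : exists p, forall q, J q <= J p.
  apply: (@coercive_max J q0 (1 + D) (Km * expR C)).
  - move=> p; apply: le_trans (Jle p) _; rewrite ler_wpM2l// ler_expR gerBl.
    by rewrite divr_ge0// normsq_ge0.
  - move=> p /ns h i; have h5 : p i ^+ 2 <= D.
      apply: le_trans h; rewrite /normsq (bigD1 i)//= lerDl.
      by apply: sumr_ge0 => j _; exact: sqr_ge0.
    by have := ler_of_sqr ltr01 h5; rewrite divr1.
  - by apply: lip; rewrite addr_ge0.
by exists p => //; exact: ns.
Qed.

Lemma expR_taylor2 (s : R) : `|s| <= 2^-1 -> `|expR s - 1 - s| <= 2 * s ^+ 2.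
Proof.
move=> /[dup] s2; rewrite ler_norml => /andP[s3 s4].
have h1 := expR_ge1Dx s.
have s1 : s < 1 by lra.
have h2 := expR_le_inv s1.
rewrite ger0_norm; last by lra.
suff : (1 - s)^-1 <= 1 + s + 2 * s ^+ 2 by lra.
rewrite -[leLHS]div1r ler_pdivrMr ?subr_gt0// expr2.
have : 0 <= s * s * (1 - 2 * s) by rewrite mulr_ge0 -?expr2 ?sqr_ge0//; lra.
by nra.
Qed.

(** Small t of both signs force |c| <= D |t|. This yields the first-order condition at a maximum
    from a Taylor estimate, without differentiating a mean. *)
Lemma quad_coef0 (c D d : R) : 0 < d -> 0 <= D ->
  (forall t : R, `|t| <= d -> t * c <= D * t ^+ 2) -> c = 0.
Proof.
move=> d0 D0 h; apply/eqP; rewrite -normr_eq0 eq_le normr_ge0 andbT.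
apply/ler_addgt0Pr => r r0; rewrite add0r.
pose t := Num.min d (r / (D + 1)).
have D1 : 0 < D + 1 by rewrite ltr_wpDl.
have t0 : 0 < t by rewrite lt_min d0 divr_gt0.
have td : `|t| <= d by rewrite ger0_norm ?(ltW t0)// ge_min lexx.
have tr : D * t <= r.
  apply: (@le_trans _ _ ((D + 1) * t)); first by rewrite ler_wpM2r ?(ltW t0)// lerDl.
  by rewrite mulrC -ler_pdivlMr// ge_min lexx orbT.
have h1 := h _ td; have := h (- t); rewrite normrN => /(_ td) h2.
rewrite ler_norml; apply/andP; split.
  rewrite -(ler_pM2l t0); rewrite sqrrN in h2; nra.
by rewrite -(ler_pM2l t0); nra.
Qed.

(** Only coordinate i varies. The change of exp (- |q|^2) is absorbed in the exponent t c - t^2,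
    with c = 2 (e_i - p_i), and the second-order error is uniform on the sphere. *)
Lemma euler_lagrange p : (forall q, Jfun q <= Jfun p) ->
  forall i, p i * sint (fun x => K x * expR (2 * lincomb p x))
            = sint (fun x => K x * expR (2 * lincomb p x) * e i x).
Proof.
move=> hp i; pose E x := K x * expR (2 * lincomb p x).
have bE : bounded_on S E by apply: bounded_onM => //; exact/exp2_bounded/lincomb_bounded.
have [Em Em0 hEm] := bounded_onP bE; have [F F0 hF] := bounded_onP (be i).
(* a - 1 bounds c on the sphere; the extra 1 absorbs t^2 when |t| <= 1. *)
pose a := 2 * F + 2 * `|p i| + 1.
have a1 : 0 < a by rewrite ltr_wpDl// addr_ge0// mulr_ge0// ltW.
apply/eqP; rewrite eq_sym -subr_eq0; apply/eqP.
pose c x := 2 * (e i x - p i).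
suff : sint (fun x => E x * c x) = 0.
  rewrite (_ : sint _ = 2 * (sint (fun x => E x * e i x) - p i * sint E)); last first.
    have b1 : bounded_on S (fun x => E x * e i x) by exact: bounded_onM.
    rewrite -sintZ// -sintB//; last exact: bounded_onZ.
    rewrite -sintZ; last by apply: bounded_onB => //; exact: bounded_onZ.
    by apply: sint_ext => x _; rewrite /c; ring.
  by move/eqP; rewrite mulf_eq0 pnatr_eq0 /= => /eqP.
have bc : bounded_on S c.
  by apply: bounded_onZ; apply: bounded_onB => //; exact: bounded_on_cst.
have ca x : S x -> `|c x| <= a - 1.
  move=> Sx; rewrite /c normrM ger0_norm// /a addrK -mulrDr ler_pM2l//.
  by apply: le_trans (ler_normB _ _) _; rewrite lerD2r hF.
apply: (@quad_coef0 _ (Em * (2 * a ^+ 2 + 1)) (Num.min 1 (2 * a)^-1)).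
- by rewrite lt_min ltr01 invr_gt0 mulr_gt0.
- by rewrite mulr_ge0 ?addr_ge0 ?mulr_ge0 ?sqr_ge0// ltW.
move=> t; rewrite le_min => /andP[t1 t2].
pose q j := if j == i then p j + t else p j.
have lq x : lincomb q x = lincomb p x + t * e i x.
  rewrite /lincomb (bigD1 i)//= [in RHS](bigD1 i)//= /q eqxx.
  rewrite (eq_bigr (fun j => p j * e j x)); last by move=> j /negPf ->.
  by ring.
have nq : normsq q = normsq p + 2 * t * p i + t ^+ 2.
  rewrite /normsq (bigD1 i)//= [in RHS](bigD1 i)//= /q eqxx.
  rewrite (eq_bigr (fun j => p j ^+ 2)); last by move=> j /negPf ->.
  by ring.
have := hp q; rewrite !JfunE nq.
have -> : sint (fun x => K x * expR (2 * lincomb q x))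
    = expR (2 * t * p i + t ^+ 2) * sint (fun x => E x * expR (t * c x - t ^+ 2)).
  rewrite -sintZ; last first.
    apply: bounded_onM => //; apply: bounded_on_expR; apply: bounded_onB.
      exact: bounded_onZ.
    exact: bounded_on_cst.
  apply: sint_ext => x _; rewrite lq /E.
  have -> : 2 * (lincomb p x + t * e i x)
    = (2 * t * p i + t ^+ 2) + 2 * lincomb p x + (t * c x - t ^+ 2).
    by rewrite /c; ring.
  by rewrite 2!expRD; ring.
rewrite mulrA -expRD.
have -> : - (normsq p + 2 * t * p i + t ^+ 2) + (2 * t * p i + t ^+ 2) = - normsq p by ring.
rewrite ler_pM2l ?expR_gt0// -/E => hJ.
have tn0 := normr_ge0 t.
have t2' : t ^+ 2 <= `|t| by rewrite -real_normK ?num_real// expr2 ler_piMl.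
have sm x : S x -> `|t * c x - t ^+ 2| <= `|t| * a.
  move=> Sx; apply: le_trans (ler_normB _ _) _; rewrite normrM normrX.
  apply: (@le_trans _ _ (`|t| * (a - 1) + `|t|)); last first.
    by rewrite -[X in _ + X]mulr1 -mulrDr subrK.
  apply: lerD; last by rewrite expr2 ler_piMl.
  by rewrite ler_wpM2l ?ca.
have ta : `|t| * a <= 2^-1.
  by rewrite -ler_pdivlMr// -invfM.
have -> : t * sint (fun x => E x * c x) = sint (fun x => t * (E x * c x)).
  by rewrite sintZ//; exact: bounded_onM.
have b5 : bounded_on S (fun x => E x * expR (t * c x - t ^+ 2)).
  apply: bounded_onM => //; apply: bounded_on_expR; apply: bounded_onB.
    exact: bounded_onZ.
  exact: bounded_on_cst.
have b6 : bounded_on S (fun x => t * (E x * c x)) by apply/bounded_onZ/bounded_onM.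
apply: (@le_trans _ _ (sint (fun x => t * (E x * c x)) + (sint E - sint (fun x => E x * expR (t * c x - t ^+ 2))))).
  by rewrite lerDl subr_ge0.
rewrite -sintB// -sintD//; last exact: bounded_onB.
apply: le_trans (ler_norm _) _; apply: sint_bound => x Sx.
have -> : t * (E x * c x) + (E x - E x * expR (t * c x - t ^+ 2))
  = - (E x * ((expR (t * c x - t ^+ 2) - 1 - (t * c x - t ^+ 2)) - t ^+ 2)) by ring.
rewrite normrN normrM -mulrA ler_pM ?hEm//.
apply: le_trans (ler_normB _ _) _.
have h := expR_taylor2 (le_trans (sm _ Sx) ta).
have h2 : (t * c x - t ^+ 2) ^+ 2 <= t ^+ 2 * a ^+ 2.
  rewrite -exprMn -[leLHS]real_normK ?num_real// -[leRHS]real_normK ?num_real//.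
  rewrite lerXn2r ?nnegrE//; apply: le_trans (sm _ Sx) _.
  by rewrite normrM ler_wpM2l// ler_norm.
rewrite [`|t ^+ 2|]ger0_norm ?sqr_ge0//.
apply: (@le_trans _ _ (2 * (t ^+ 2 * a ^+ 2) + t ^+ 2)).
  by rewrite lerD2r; apply: le_trans h _; rewrite ler_pM2l.
by rewrite le_eqVlt; apply/orP; left; apply/eqP; ring.
Qed.

End Variational.

Lemma seq_max (R : realType) (T : eqType) (s : seq T) (f : T -> R) a : a \in s ->
  exists2 b, b \in s & forall c, c \in s -> f c <= f b.
Proof.
elim: s a => [//|d s ih] a _; have [->|] := eqVneq s [::].
  by exists d; rewrite ?mem_head// => c; rewrite inE => /eqP ->.
case: s ih => [//|d' s] ih _; have [b bs hb] := ih d' (mem_head _ _).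
have [db|/ltW bd] := leP (f d) (f b).
  by exists b; [rewrite inE bs orbT|move=> c; rewrite inE => /predU1P[->|/hb]].
by exists d; [rewrite mem_head|move=> c; rewrite inE => /predU1P[->//|/hb/le_trans]; exact].
Qed.

(** * Invariant solutions of the mean field equation *)

Section Group.
Variables (R : realType) (G : seq 'M[R]_3).
Local Notation V3 := 'cV[R]_3.
Local Notation S := (@sphere R).
Hypothesis Gu : uniq G.
Hypothesis Go : forall A, A \in G -> A^T *m A = 1%:M.
Hypothesis G1 : 1%:M \in G.
Hypothesis GM : forall A B, A \in G -> B \in G -> A *m B \in G.
Hypothesis GT : forall A, A \in G -> A^T \in G.
Hypothesis Gfix : forall x : V3, \sum_(A <- G) A *m x = 0.

Lemma gsum_perm (h k : 'M[R]_3 -> 'M[R]_3) (F : 'M[R]_3 -> R) :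
  (forall A, A \in G -> h A \in G) -> (forall A, A \in G -> k A \in G) ->
  (forall A, A \in G -> k (h A) = A) -> (forall A, A \in G -> h (k A) = A) ->
  \sum_(A <- G) F (h A) = \sum_(A <- G) F A.
Proof.
move=> hG kG kh hk; rewrite -(big_map h predT F); apply: perm_big; apply: uniq_perm => //.
  rewrite map_inj_in_uniq// => A B AG BG e.
  by rewrite -(kh A AG) -(kh B BG) e.
move=> A; apply/mapP/idP => [[B BG ->]|AG]; first exact: hG.
by exists (k A); rewrite ?kG ?hk.
Qed.

Lemma gsum_mull B (F : 'M[R]_3 -> R) : B \in G ->
  \sum_(A <- G) F (B *m A) = \sum_(A <- G) F A.
Proof.
move=> BG; have BB := Go BG; have BB' : B *m B^T = 1%:M by exact: mulmx1C.
apply: (@gsum_perm _ (mulmx B^T)) => A AG; rewrite ?GM ?GT//.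
  by rewrite mulmxA BB mul1mx.
by rewrite mulmxA BB' mul1mx.
Qed.

Lemma gsum_mulr B (F : 'M[R]_3 -> R) : B \in G ->
  \sum_(A <- G) F (A *m B) = \sum_(A <- G) F A.
Proof.
move=> BG; have BB := Go BG; have BB' : B *m B^T = 1%:M by exact: mulmx1C.
apply: (@gsum_perm (mulmx^~ B) (mulmx^~ B^T)) => A AG; rewrite ?GM ?GT//.
  by rewrite -mulmxA BB' mulmx1.
by rewrite -mulmxA BB mulmx1.
Qed.

Let g : R := (size G)%:R.

Lemma size_G_gt0 : 0 < g.
Proof. by rewrite ltr0n; case: G G1. Qed.
Let g0 := size_G_gt0.

Lemma gsum_cst (c : R) : \sum_(A <- G) c = g * c.
Proof. by rewrite big_const_seq count_predT iter_addr_0 mulr_natl. Qed.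

Lemma gavg_bound (F : 'M[R]_3 -> R) (M : R) : (forall A, A \in G -> `|F A| <= M) ->
  `|g^-1 * \sum_(A <- G) F A| <= M.
Proof.
move=> h; rewrite normrM ger0_norm ?invr_ge0 ?(ltW g0)// mulrC ler_pdivrMr//.
apply: le_trans (ler_norm_sum _ _ _) _; rewrite mulrC -gsum_cst big_seq [leRHS]big_seq.
by apply: ler_sum => A; exact: h.
Qed.

(** The linear part of tau averages to 0 because orbit sums vanish. *)
Lemma gsum_tau (x y : V3) : \sum_(A <- G) tau x (A *m y) = g / 2.
Proof.
rewrite /tau -mulr_suml big_split /= gsum_cst mulr1; congr (_ / _).
suff -> : \sum_(A <- G) dotv x (A *m y) = 0 by rewrite addr0.
rewrite /dotv exchange_big /=; rewrite big1// => i _.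
rewrite -mulr_sumr; have := Gfix y => /(congr1 (fun M : V3 => M i 0)).
by rewrite summxE mxE => ->; rewrite mulr0.
Qed.

Lemma tau_tr (A : 'M[R]_3) (x y : V3) : tau (A *m x) y = tau x (A^T *m y).
Proof. by rewrite /tau orth_dotv. Qed.

Definition kernG N x y := g^-1 * \sum_(A <- G) ell N (tau x (A *m y)).

Definition featT N (n : 'I_N) : finType := {ffun 'I_n.+1 -> 'I_4}.

Definition tagF N (n : 'I_N) (phi : featT n) : {n : 'I_N & featT n} :=
  existT (fun n : 'I_N => featT n : Type) n phi.

(** The weight makes block n contribute tau^(n+1) / (n + 1) to the kernel; blocks are counted from 0
    while exponents start at 1. *)
Definition featG N (i : {n : 'I_N & featT n}) (x : V3) : R :=
  (Num.sqrt (tag i).+1%:R)^-1 * (g^-1 * \sum_(A <- G) feat (tagged i) (A *m x)).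

Lemma featG_bounded N i : bounded_on S (@featG N i).
Proof.
apply: bounded_onZ; apply: bounded_onZ.
have [M M0 hM] := bounded_onP (feat_bounded R (tagged i)).
exists (\sum_(A <- G) M) => x Sx; apply: le_trans (ler_norm_sum _ _ _) _.
rewrite big_seq [leRHS]big_seq; apply: ler_sum => A AG; apply: hM.
exact: orth_sphere (Go AG) Sx.
Qed.

(** Averaging both arguments amounts to averaging one of them: tau (A x, B y) = tau (x, A^T B y),
    and left translation permutes the group. *)
Lemma featG_block N (n : 'I_N) x y :
  \sum_(phi : featT n) featG (tagF phi) x * featG (tagF phi) y
  = n.+1%:R^-1 * (g^-1 * \sum_(A <- G) tau x (A *m y) ^+ n.+1).
Proof.
have s2 : (Num.sqrt n.+1%:R)^-1 * (Num.sqrt n.+1%:R)^-1 = n.+1%:R^-1 :> R.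
  by rewrite -invfM -expr2 sqr_sqrtr.
transitivity (n.+1%:R^-1 * (g^-1 * (g^-1 * \sum_(A <- G) \sum_(B <- G) tau (A *m x) (B *m y) ^+ n.+1))).
  transitivity (\sum_(phi : featT n) n.+1%:R^-1 * (g^-1 * (g^-1 *
      \sum_(A <- G) \sum_(B <- G) feat phi (A *m x) * feat phi (B *m y)))).
    apply: eq_bigr => phi _; rewrite /featG /= -s2.
    have -> : \sum_(A <- G) \sum_(B <- G) feat phi (A *m x) * feat phi (B *m y)
        = (\sum_(A <- G) feat phi (A *m x)) * (\sum_(A <- G) feat phi (A *m y)).
      by rewrite mulr_suml; apply: eq_bigr => A _; rewrite mulr_sumr.
    by ring.
  rewrite -!mulr_sumr; congr (_ * (_ * (_ * _))).
  rewrite exchange_big; apply: eq_bigr => A _; rewrite exchange_big; apply: eq_bigr => B _.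
  by rewrite tauX_feat.
congr (_ * (_ * _)); apply: (canLR (mulKf _)); first by rewrite gt_eqF.
rewrite -gsum_cst big_seq [RHS]big_seq; apply: eq_bigr => A AG.
rewrite -[RHS](gsum_mull (fun B => tau x (B *m y) ^+ n.+1) (GT AG)); apply: eq_bigr => B _.
by rewrite tau_tr mulmxA.
Qed.

Lemma featG_kernel N x y : \sum_i @featG N i x * featG i y = kernG N x y.
Proof.
have := @sig_big_dep R 0 +%R 'I_N (@featT N) xpredT (fun=> xpredT)
  (fun n phi => featG (tagF phi) x * featG (tagF phi) y).
rewrite /= => h; transitivity (\sum_(n < N) \sum_(phi : featT n)
    featG (tagF phi) x * featG (tagF phi) y).
  by rewrite h; apply: eq_bigr => -[n phi].
rewrite /kernG /ell exchange_big mulr_sumr; apply: eq_bigr => n _ /=.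
by rewrite featG_block -mulr_suml; ring.
Qed.

(** Let t be the largest tau (x, A y). From tau_B^(n+1) <= tau_B t^n and the orbit sum g / 2 of tau,
    the averaged kernel is at most l (t) / (2 t). Then (1 - t) l (t) <= t turns this into (l (t) +
    1) / 2. *)
Lemma ell_avg N x y : S x -> S y -> exists2 A, A \in G &
  3 / 2 * kernG N x y <= 3 / 4 * (ell N (tau x (A *m y)) + 1).
Proof.
move=> Sx Sy; have [A AG hA] := seq_max (fun A => tau x (A *m y)) G1.
exists A => //; set t := tau x (A *m y) in hA *.
have tau01 B : B \in G -> 0 <= tau x (B *m y) <= 1.
  by move=> BG; apply: tau_unit => //; exact: orth_sphere (Go BG) Sy.
have /andP[t0 t1] : 0 <= t <= 1 := tau01 _ AG.
have t2 : 1 / 2 <= t.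
  rewrite -(ler_pM2l g0) mulrA mulr1 -(gsum_tau x y) -gsum_cst.
  by rewrite big_seq [leRHS]big_seq; apply: ler_sum => B; exact: hA.
have h1 : t * \sum_(B <- G) ell N (tau x (B *m y)) <= g / 2 * ell N t.
  rewrite -(gsum_tau x y) mulr_sumr mulr_suml big_seq [leRHS]big_seq; apply: ler_sum => B BG.
  rewrite /ell !mulr_sumr; apply: ler_sum => n _.
  have /andP[b0 b1] := tau01 _ BG; have bt := hA _ BG.
  rewrite !mulrA ler_wpM2r ?invr_ge0// !exprS.
  by rewrite mulrCA ler_wpM2l// ler_wpM2l// lerXn2r ?nnegrE.
have h2 : (1 - t) * ell N t <= t.
  apply: (@le_trans _ _ ((1 - t) * \sum_(n < N) t ^+ n.+1)).
    rewrite ler_wpM2l ?subr_ge0//; apply: ler_sum => n _.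
    by rewrite ler_pdivrMr ?ltr0n// ler_peMr ?exprn_ge0// ler1n.
  have -> : (1 - t) * \sum_(n < N) t ^+ n.+1 = t * (1 - t ^+ N).
    under eq_bigr => n _ do rewrite exprS.
    rewrite -mulr_sumr mulrCA; congr (_ * _).
    rewrite -[in RHS](expr1n _ N) subrXX; congr (_ * _).
    by apply: eq_bigr => n _; rewrite expr1n mul1r.
  by rewrite ler_piMr// gerBl exprn_ge0.
have h3 : kernG N x y * (2 * t) <= ell N t.
  rewrite /kernG -mulrA ler_pdivrMl//.
  by move: h1; set s := \sum_(B <- G) _; lra.
have l0 := ell_ge0 N t0.
have : kernG N x y * (2 * t) <= (1 / 2) * (ell N t + 1) * (2 * t) by lra.
have t20 : 0 < 2 * t by lra.
by rewrite ler_pM2r//; lra.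
Qed.

(** Its exponential is the product of exp (3 / 4), from the additive 1 in [ell_avg], of e / (1 - 3 /
    4), from [sint_exp_ell], and of the number g of group elements. *)
Definition mtC : R := 7 / 4 + ln (4 * g).

Lemma kernG_exp N x : S x ->
  sint (fun y => expR (3 / 2 * \sum_i @featG N i x * featG i y)) <= expR mtC.
Proof.
move=> Sx.
have bA A : A \in G -> bounded_on S (fun y => expR (3 / 4 * ell N (tau (A^T *m x) y))).
  move=> AG; apply: bounded_on_expR; apply: bounded_onZ; apply: ell_tau_bounded.
  exact: orth_sphere (Go (GT AG)) Sx.
(* The best A depends on y, so its exponential is bounded by the sum over the whole group. The
   default 0 outside [G] makes the summand bounded for every index, as [sint_sum] requires. *)
pose H A y := if A \in G then expR (3 / 4 * ell N (tau (A^T *m x) y)) else 0.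
have bH A : bounded_on S (H A).
  by rewrite /H; case: (boolP (A \in G)) => [/bA//|_]; exact: bounded_on_cst.
have kb : bounded_on S (fun y => \sum_i @featG N i x * featG i y).
  by apply: bounded_on_sum => i; apply: bounded_onZ; exact: featG_bounded.
apply: (@le_trans _ _ (sint (fun y => expR (3 / 4) * \sum_(A <- G) H A y))).
  apply: sint_le; [by apply/bounded_on_expR/bounded_onZ|by apply/bounded_onZ/bounded_on_sum|].
  move=> y Sy; rewrite featG_kernel; have [A AG hA] := ell_avg N Sx Sy.
  apply: (@le_trans _ _ (expR (3 / 4 * (ell N (tau x (A *m y)) + 1)))); first by rewrite ler_expR.
  rewrite mulrDr mulr1 addrC expRD ler_wpM2l ?expR_ge0//.
  have hAy : H A y = expR (3 / 4 * ell N (tau x (A *m y))).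
    by rewrite /H AG tau_tr trmxK.
  rewrite (big_rem A)//= -hAy lerDl; apply: sumr_ge0 => B _.
  by rewrite /H; case: ifP => // _; exact: expR_ge0.
rewrite sintZ; last exact: bounded_on_sum.
rewrite sint_sum//.
have hs : \sum_(A <- G) sint (H A) <= g * (expR 1 / (1 - 3 / 4)).
  rewrite -gsum_cst big_seq [leRHS]big_seq; apply: ler_sum => A AG.
  have -> : H A = fun y => expR (3 / 4 * ell N (tau (A^T *m x) y)).
    by apply/funext => y; rewrite /H AG.
  by apply: sint_exp_ell; [exact: orth_sphere (Go (GT AG)) Sx|lra|lra].
apply: le_trans (ler_wpM2l (expR_ge0 _) hs) _.
rewrite /mtC expRD lnK ?posrE ?mulr_gt0//.
have -> : 7 / 4 = 3 / 4 + 1 :> R by field.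
rewrite expRD le_eqVlt; apply/orP; left; apply/eqP.
have -> : (1 - 3 / 4 : R) = 4^-1 by field.
by rewrite invrK; ring.
Qed.

Lemma featG_mt N p : sint (fun x => expR (2 * lincomb (@featG N) p x))
  <= expR (mtC + 2 / 3 * normsq p).
Proof. by apply: moser_trudinger; [exact: featG_bounded|exact: kernG_exp]. Qed.

End Group.

(** * Square-integrable densities have bounded potentials *)

Section L2Bound.
Variable R : realType.
Local Notation V3 := 'cV[R]_3.
Local Notation S := (@sphere R).

(** Cauchy-Schwarz in the form a c <= (s a^2 + c^2 / s) / 2, where s = sqrt (n + 1) balances the
    mean 1 / (2 n + 1) of tau^(2 n). *)
Lemma Vop_L2 n (w : V3 -> R) (B : R) x : S x -> bounded_on S w ->
  sint (fun y => w y ^+ 2) <= B -> `|Vop n w x| <= (1 + B) / Num.sqrt n.+1%:R.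
Proof.
move=> Sx bw hB; pose s : R := Num.sqrt n.+1%:R.
have s0 : 0 < s by rewrite sqrtr_gt0 ltr0n.
have s2 : s * s = n.+1%:R by rewrite -expr2 sqr_sqrtr.
have b1 := tauXM_bounded n Sx bw; have b2 := tauX_bounded (2 * n) Sx.
have b3 := bounded_onX 2 bw.
apply: le_trans (sint_norm b1) _.
apply: (@le_trans _ _ (sint (fun y => s / 2 * tau x y ^+ (2 * n) + (2 * s)^-1 * w y ^+ 2))).
  apply: sint_le; [exact: bounded_on_norm|by apply: bounded_onD; exact: bounded_onZ|].
  move=> y Sy; rewrite normrM normrX ger0_norm ?tau_ge0// mulnC exprM.
  rewrite -[w y ^+ 2]real_normK ?num_real//.
  move: (tau x y ^+ n) (`|w y|) => a c.
  have : 0 <= (s * a - c) ^+ 2 / (2 * s) by rewrite divr_ge0 ?sqr_ge0// mulr_ge0// ltW.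
  have -> : (s * a - c) ^+ 2 / (2 * s) = s / 2 * a ^+ 2 + (2 * s)^-1 * c ^+ 2 - a * c.
    by field; rewrite gt_eqF.
  by lra.
rewrite sintD; [|exact: bounded_onZ|exact: bounded_onZ].
rewrite !sintZ// sint_tauX//.
have B0 : 0 <= B by apply: le_trans hB; apply: sint_ge0 => // y _; exact: sqr_ge0.
have h1 : s / 2 * (2 * n).+1%:R^-1 <= s^-1 * 1.
  rewrite mulr1 -[leRHS]div1r ler_pdivlMr//.
  have -> : s / 2 * (2 * n).+1%:R^-1 * s = s * s / (2 * (2 * n).+1%:R).
    have : (2 * n).+1%:R != 0 :> R by rewrite pnatr_eq0.
    by move: ((2 * n).+1%:R : R) => z z0; field.
  rewrite s2 ler_pdivrMr ?mulr_gt0 ?ltr0n// mul1r -natrM ler_nat.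
  by lia.
have h2 : (2 * s)^-1 * sint (fun y => w y ^+ 2) <= s^-1 * B.
  apply: ler_pM => //; first by rewrite invr_ge0 mulr_ge0// ltW.
    by apply: sint_ge0 => // y _; exact: sqr_ge0.
  by rewrite lef_pV2 ?posrE ?mulr_gt0// ler_peMl ?(ltW s0)// ler1n.
by apply: le_trans (lerD h1 h2) _; rewrite -mulrDr mulrC.
Qed.

(** Each term is at most 4 (1 / sqrt (n + 1) - 1 / sqrt (n + 2)), which telescopes. *)
Lemma sum_inv_sqrt N : \sum_(n < N) (Num.sqrt n.+2%:R)^-1 / n.+1%:R <= 4 :> R.
Proof.
suff h : \sum_(n < N) (Num.sqrt n.+2%:R)^-1 / n.+1%:R <= 4 * (1 - (Num.sqrt N.+1%:R)^-1) :> R.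
  by apply: le_trans h _; rewrite ler_piMr// gerBl invr_ge0 sqrtr_ge0.
elim: N => [|N ih]; first by rewrite big_ord0 sqrtr1 invr1 subrr mulr0.
rewrite big_ord_recr /=.
set a : R := Num.sqrt N.+1%:R in ih *; set b : R := Num.sqrt N.+2%:R.
have a2 : a * a = N.+1%:R by rewrite -expr2 sqr_sqrtr.
have b2 : b * b = a * a + 1 by rewrite -expr2 sqr_sqrtr// a2 natr1.
have a0 : 0 < a by rewrite sqrtr_gt0 ltr0n.
have b0 : 0 < b by rewrite sqrtr_gt0 ltr0n.
have a1 : 1 <= a * a by rewrite a2 ler1n.
suff : b^-1 / N.+1%:R <= 4 * (a^-1 - b^-1).
  move: ih; move: (b^-1 / _) (\sum_(i < N) _) => z1 z2.
  by move: a^-1 b^-1 => z3 z4; lra.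
rewrite -a2.
have -> : b^-1 / (a * a) = 1 / (a * a * b) by field; rewrite !gt_eqF.
have -> : 4 * (a^-1 - b^-1) = 4 * a * (b - a) / (a * a * b) by field; rewrite !gt_eqF.
rewrite ler_pM2r ?invr_gt0 ?mulr_gt0//.
have ab : b <= 3 * a.
  rewrite -(@ler_pXn2r _ 2) ?nnegrE ?mulr_ge0 ?(ltW a0) ?(ltW b0)// !expr2 b2; nra.
have : (b - a) * (b + a) = 1 by rewrite mulrDr !mulrBl b2; ring.
by nra.
Qed.

Lemma Lpart_L2 N (w : V3 -> R) (B : R) x : S x -> bounded_on S w ->
  sint (fun y => w y ^+ 2) <= B -> `|Lpart N w x| <= 4 * (1 + B).
Proof.
move=> Sx bw hB.
have B0 : 0 <= B.
  by apply: le_trans hB; apply: sint_ge0 => [|y _]; [exact: bounded_onX|exact: sqr_ge0].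
apply: le_trans (ler_norm_sum _ _ _) _.
apply: (@le_trans _ _ (\sum_(n < N) (1 + B) * ((Num.sqrt n.+2%:R)^-1 / n.+1%:R))).
  apply: ler_sum => n _; rewrite normrM [X in _ * X]ger0_norm ?invr_ge0// mulrA.
  by rewrite ler_wpM2r ?invr_ge0//; exact: Vop_L2.
by rewrite -mulr_sumr mulrC ler_wpM2r ?addr_ge0// sum_inv_sqrt.
Qed.

End L2Bound.

(** * Uniform convergence along the ultrafilter *)

Section EquiConvergence.
Variable R : realType.
Local Notation V3 := 'cV[R]_3.
Local Notation S := (@sphere R).
Implicit Types v w : nat -> V3 -> R.

(** A uniform Cauchy condition in which h may depend on e. It passes to sums and holds for
    finite-rank operators, and so takes the place of the Arzela-Ascoli theorem. *)
Definition equicvg v := forall e : R, 0 < e -> exists h : V3 -> R,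
  ufilter [set k | forall x, S x -> `|v k x - h x| <= e].

Lemma equicvgD v w : equicvg v -> equicvg w -> equicvg (fun k x => v k x + w k x).
Proof.
move=> hv hw e e0; have e2 : 0 < e / 2 by rewrite divr_gt0.
have [f hf] := hv _ e2; have [g hg] := hw _ e2.
exists (fun x => f x + g x); apply: filterS (filterI hf hg) => k [/= h1 h2] x Sx.
rewrite opprD addrACA; apply: le_trans (ler_normD _ _) _.
by have := h1 _ Sx; have := h2 _ Sx; lra.
Qed.

Lemma equicvg_sum (I : Type) (r : seq I) (F : I -> nat -> V3 -> R) :
  (forall i, equicvg (F i)) -> equicvg (fun k x => \sum_(i <- r) F i k x).
Proof.
move=> h; elim: r => [|i r ih].
  move=> e e0; exists (fun=> 0); apply: filterE => k x _.
  by rewrite big_nil subrr normr0 ltW.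
have H := equicvgD (h i) ih.
rewrite (_ : (fun k x => _) = fun k x => F i k x + \sum_(i <- r) F i k x)//.
by apply/funext => k; apply/funext => x; rewrite big_cons.
Qed.

Lemma equicvg_scal (f : V3 -> R) (c : nat -> R) (M : R) : bounded_on S f ->
  (forall k, `|c k| <= M) -> equicvg (fun k x => f x * c k).
Proof.
move=> bf cM e e0; have [F F0 hF] := bounded_onP bf.
have cc := ulim_cvg cM; exists (fun x => f x * ulim c).
move/cvgrPdist_le : cc => /(_ _ (divr_gt0 e0 F0)); apply: filterS => k /= h x Sx.
rewrite -mulrBr normrM distrC; apply: le_trans (ler_pM _ _ (hF _ Sx) h) _ => //.
by rewrite mulrC divfK// gt_eqF.
Qed.

Lemma equicvg_ulim v (M : R) : equicvg v -> (forall k x, S x -> `|v k x| <= M) ->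
  forall e : R, 0 < e ->
  ufilter [set k | forall x, S x -> `|v k x - ulim (v^~ x)| <= e].
Proof.
move=> hv hM e e0; have e2 : 0 < e / 2 by rewrite divr_gt0.
have [h hh] := hv _ e2.
have lh x : S x -> `|ulim (v^~ x) - h x| <= e / 2.
  move=> Sx; have c := ulim_cvg (fun k => hM k x Sx).
  have c2 : `|v k x - h x| @[k --> ufilter] --> `|ulim (v^~ x) - h x|.
    by apply: cvg_norm; apply: cvgB => //; exact: cvg_cst.
  by apply: (cvgr_to_le c2); apply: filterS hh => k /(_ x Sx).
apply: filterS hh => k hk x Sx.
rewrite -(subrK (h x) (v k x)) -addrA; apply: le_trans (ler_normD _ _) _.
by have := hk x Sx; have := lh x Sx; rewrite distrC; lra.
Qed.

(** The truncated operator has finite rank: the sequence enters only through finitely many bounded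
    coefficients, each convergent along the ultrafilter. *)
Lemma equicvg_Lpart m w (M : R) : (forall k x, S x -> `|w k x| <= M) ->
  equicvg (fun k x => Lpart m (w k) x).
Proof.
move=> wM; have bw k : bounded_on S (w k) by exists M => x; exact: wM.
apply: equicvg_sum => n.
rewrite (_ : (fun k x => _) = fun k x => \sum_(phi : {ffun 'I_n.+1 -> 'I_4})
    (n.+1%:R^-1 * feat phi x) * sint (fun y => feat phi y * w k y)).
  apply: equicvg_sum => phi.
  have [F F0 hF] := bounded_onP (feat_bounded R phi).
  apply: (@equicvg_scal _ _ (F * M)); first by apply: bounded_onZ; exact: feat_bounded.
  by move=> k; apply: sint_bound => y Sy; rewrite normrM ler_pM// ?hF ?wM.
apply/funext => k; apply/funext => x; rewrite Vop_feat// mulr_suml.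
by apply: eq_bigr => phi _; rewrite mulrC mulrA.
Qed.

End EquiConvergence.

Section FeatureContinuity.
Variable R : realType.
Local Notation V3 := 'cV[R]_3.
Local Notation S := (@sphere R).

Lemma UC_coord (i : 'I_3) : UC (fun x : V3 => x i 0).
Proof.
move=> e e0; exists (4 / e) => [|x y Sx Sy]; first by rewrite divr_ge0// ltW.
rewrite mulrAC; apply: ler_of_sqr => //.
have -> : 4 * (1 - tau x y) = dotv (x - y) (x - y) by rewrite tauE//; field.
rewrite /dotv (bigD1 i)//= !mxE -expr2 lerDl.
by apply: sumr_ge0 => j _; rewrite -expr2 sqr_ge0.
Qed.

Lemma UC_coord4 i : UC (@coord4 R i).
Proof.
apply: UCZ; case: (nat_of_ord i == 0%N); first exact: UC_cst.
case: (nat_of_ord i == 1%N); first exact: UC_coord.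
by case: (nat_of_ord i == 2%N); exact: UC_coord.
Qed.

Lemma UC_feat n (phi : {ffun 'I_n -> 'I_4}) : UC (@feat R n phi).
Proof.
rewrite /feat; elim: (index_enum _) => [|k r ih].
  rewrite (_ : (fun x => _) = fun=> 1); first exact: UC_cst.
  by apply/funext => x; rewrite big_nil.
rewrite (_ : (fun x => _) = fun x => coord4 (phi k) x * \prod_(k <- r) coord4 (phi k) x).
  by apply: UCM => //; exact: UC_coord4.
by apply/funext => x; rewrite big_cons.
Qed.

End FeatureContinuity.

(** * Solutions of the truncated equations and their limit *)

Section Existence.
Variables (R : realType) (G : seq 'M[R]_3).
Local Notation V3 := 'cV[R]_3.
Local Notation S := (@sphere R).
Hypothesis Gu : uniq G.
Hypothesis Go : forall A, A \in G -> A^T *m A = 1%:M.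
Hypothesis G1 : 1%:M \in G.
Hypothesis GM : forall A B, A \in G -> B \in G -> A *m B \in G.
Hypothesis GT : forall A, A \in G -> A^T \in G.
Hypothesis Gfix : forall x : V3, \sum_(A <- G) A *m x = 0.
Let g : R := (size G)%:R.
Let g0 : 0 < g := size_G_gt0 G1.

Variable K : V3 -> R.
Hypothesis uK : UC K.
Hypothesis KG : forall A x, A \in G -> S x -> K (A *m x) = K x.

Lemma UC_featG N i : UC (@featG R G N i).
Proof.
apply: UCZ; apply: UCZ; rewrite (_ : (fun x => _) =
  fun x => \sum_(A <- G) (if A \in G then feat (tagged i) (A *m x) else 0)).
  apply: UC_sum => A; case: (boolP (A \in G)) => [AG|_]; last exact: UC_cst.
  by apply: UC_orth; [exact: Go|exact: UC_feat].
apply/funext => x; rewrite big_seq [RHS]big_seq; apply: eq_bigr => A AG.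
by rewrite AG.
Qed.

Lemma UC_lincomb N p : UC (lincomb (@featG R G N) p).
Proof. by apply: UC_sum => i; apply: UCZ; exact: UC_featG. Qed.

Lemma featG_inv N i A x : A \in G -> @featG R G N i (A *m x) = featG G i x.
Proof.
move=> AG; congr (_ * (_ * _)).
rewrite -[RHS](gsum_mulr Gu Go GM GT (fun B => feat (tagged i) (B *m x)) AG).
by apply: eq_bigr => B _; rewrite mulmxA.
Qed.

Lemma gavg_bounded n x (f : V3 -> R) : S x -> bounded_on S f ->
  bounded_on S (fun y => g^-1 * \sum_(A <- G) tau x (A *m y) ^+ n * f y).
Proof.
move=> Sx [M hM]; exists M => y Sy; apply: (gavg_bound G1) => A AG.
rewrite normrM -[leRHS]mul1r ler_pM ?hM// normrX exprn_ile1// tau_norm_le1//.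
exact: orth_sphere (Go AG) Sy.
Qed.

(** On invariant functions the averaged kernel acts as the kernel itself; hence critical points
    among invariant functions solve the full equation. *)
Lemma gavg_Vop n x (f : V3 -> R) : S x -> UC f ->
  (forall A y, A \in G -> S y -> f (A *m y) = f y) ->
  sint (fun y => g^-1 * \sum_(A <- G) tau x (A *m y) ^+ n * f y) = Vop n f x.
Proof.
move=> Sx uf fG; have bf := UC_bounded uf.
have bt A : bounded_on S (fun y => if A \in G then tau x (A *m y) ^+ n * f y else 0).
  case: (boolP (A \in G)) => [AG|_]; last exact: bounded_on_cst.
  apply: bounded_onM => //; apply: (bounded_on_orth (Go AG) (f := fun y => tau x y ^+ n)).
  exact: tauX_bounded.
transitivity (sint (fun y => g^-1 * \sum_(A <- G)
    (if A \in G then tau x (A *m y) ^+ n * f y else 0))).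
  apply: sint_ext => y _; congr (_ * _); rewrite big_seq [RHS]big_seq.
  by apply: eq_bigr => A AG; rewrite AG.
rewrite sintZ; last exact: bounded_on_sum.
rewrite sint_sum; last by move=> A.
apply: (canLR (mulKf _)); first by rewrite gt_eqF.
rewrite -(gsum_cst G) big_seq [RHS]big_seq; apply: eq_bigr => A AG.
rewrite AG /Vop -(sint_orth (Go AG) (f := fun y => tau x y ^+ n * f y)); last first.
  by apply: UCM => //; exact: UC_tauX.
by apply: sint_ext => y Sy; rewrite fG.
Qed.

Let bK := UC_bounded uK.

(* Solution of the equation with the kernel truncated at N; all the bounds are
   independent of N. *)
Lemma truncated_solution (Km c0 : R) : (forall x, S x -> `|K x| <= Km) -> 0 < c0 ->
  exists B : R, forall N q0, c0 <= Jfun (@featG R G N) K q0 ->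
  exists2 u : V3 -> R, UC u & let l := sint (fun x => K x * expR (2 * u x)) in
   [/\ forall x, S x -> `|u x| <= B, c0 <= l,
     forall A x, A \in G -> u (A *m x) = u x &
     forall x, S x -> u x = Lpart N (fun y => l^-1 * (K y * expR (2 * u y))) x].
Proof.
move=> hK c00.
have Km0 : 0 <= Km.
  by have [x Sx] := sphere_nonempty R; exact: le_trans (normr_ge0 _) (hK _ Sx).
pose C := mtC G; pose B1 := 3 * (Km * expR C / c0).
pose B2 := expR (C + 2 / 3 * (4 * B1)).
exists (4 * (1 + c0^-1 ^+ 2 * (Km ^+ 2 * B2))) => N q0 hq0.
have bf i := featG_bounded Go i : bounded_on S (@featG R G N i).
have mt p := featG_mt Gu Go G1 GM GT Gfix p : sint (fun x => expR (2 * lincomb (@featG R G N) p x)) <= _.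
have [p hp np] := Jfun_max bf bK hK mt (lt_le_trans c00 hq0).
have np1 : normsq p <= B1.
  apply: le_trans np _; rewrite ler_pM2l// ler_wpM2l ?mulr_ge0 ?expR_ge0//.
  by rewrite lef_pV2 ?posrE//; exact: lt_le_trans hq0.
have el := euler_lagrange bf bK hp.
pose u := lincomb (@featG R G N) p; exists u; first exact: UC_lincomb.
set l := sint _.
have lc : c0 <= l.
  have h : c0 <= expR (- normsq p) * l.
    by rewrite /l -(JfunE bf bK); exact: le_trans hq0 (hp q0).
  have l0 : 0 < l.
    by have := lt_le_trans c00 h; rewrite pmulr_rgt0// expR_gt0.
  apply: le_trans h _; rewrite ler_piMl ?(ltW l0)//.
  by rewrite -expR0 ler_expR oppr_le0 normsq_ge0.
have l0 : 0 < l by exact: lt_le_trans lc.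
have uu : UC u by exact: UC_lincomb.
pose E y := K y * expR (2 * u y).
have uE : UC E by apply: UCM => //; apply: UC_expR; exact: UCZ.
have bE := UC_bounded uE.
pose w y := l^-1 * E y.
have uw : UC w by exact: UCZ.
have bw := UC_bounded uw.
have uinv A x : A \in G -> u (A *m x) = u x.
  by move=> AG; apply: eq_bigr => i _; rewrite featG_inv.
have winv A x : A \in G -> S x -> w (A *m x) = w x.
  by move=> AG Sx; rewrite /w /E (KG AG Sx) (uinv _ _ AG).
have uL x : S x -> u x = Lpart N w x.
  move=> Sx.
  (* By the Euler-Lagrange equation the coefficients of u are the moments of the density w; summed
     against the features they rebuild the kernel. *)
  have pE i : p i = sint (fun y => featG G i y * w y).
    have := el i; rewrite -/l => /(canRL (mulfK (lt0r_neq0 l0))) ->.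
    rewrite mulrC -sintZ; last by apply: bounded_onM => //; exact: bf.
    by apply: sint_ext => y _; rewrite /w /E; ring.
  transitivity (sint (fun y => \sum_i @featG R G N i x * (featG G i y * w y))).
    rewrite sint_sum; last by move=> i; apply: bounded_onZ; apply: bounded_onM.
    apply: eq_bigr => i _; rewrite sintZ; last exact: bounded_onM.
    by rewrite -pE mulrC.
  have ba n : bounded_on S (fun y => g^-1 * \sum_(A <- G) tau x (A *m y) ^+ n * w y).
    exact: gavg_bounded.
  transitivity (sint (fun y => \sum_(n < N) n.+1%:R^-1 *
      (g^-1 * \sum_(A <- G) tau x (A *m y) ^+ n.+1 * w y))).
    apply: sint_ext => y Sy.
    transitivity (kernG G N x y * w y).
      rewrite -(featG_kernel Gu Go G1 GM GT) mulr_suml.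
      by apply: eq_bigr => i _; rewrite mulrA.
    rewrite /kernG /ell exchange_big mulr_sumr mulr_suml; apply: eq_bigr => n _ /=.
    by rewrite -!mulr_suml -/g; ring.
  rewrite sint_sum; last by move=> n; apply: bounded_onZ.
  apply: eq_bigr => n _; rewrite sintZ; last exact: ba.
  by rewrite gavg_Vop// mulrC.
split; [|exact: lc|exact: uinv|exact: uL].
move=> x Sx; rewrite uL//; apply: Lpart_L2 => //.
(* The square of exp (2 u) is exp (2 u') with u' of coefficients 2 p. Moser-Trudinger for 2 p, with
   |2 p|^2 = 4 |p|^2, therefore bounds w in mean square. *)
have b4 : bounded_on S (fun y => expR (2 * lincomb (@featG R G N) (fun i => 2 * p i) y)).
  exact/exp2_bounded/lincomb_bounded.
have e4 y : expR (2 * u y) ^+ 2 = expR (2 * lincomb (@featG R G N) (fun i => 2 * p i) y).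
  rewrite expr2 -expRD; congr expR; rewrite /u /lincomb -mulrDl.
  by rewrite !mulr_sumr; apply: eq_bigr => i _; ring.
apply: (@le_trans _ _ (sint (fun y => (c0^-1 ^+ 2 * Km ^+ 2) * expR (2 * lincomb (@featG R G N) (fun i => 2 * p i) y)))).
  apply: sint_le; [exact: bounded_onX|exact: bounded_onZ|].
  move=> y Sy; rewrite -e4 /w /E !exprMn mulrA ler_wpM2r ?sqr_ge0//.
  apply: ler_pM; rewrite ?sqr_ge0//.
    by rewrite lerXn2r ?nnegrE ?invr_ge0 ?(ltW l0) ?(ltW c00)// lef_pV2 ?posrE.
  by rewrite -[leLHS]real_normK ?num_real// lerXn2r ?nnegrE ?hK.
rewrite sintZ// -mulrA ler_wpM2l ?sqr_ge0// ler_wpM2l ?sqr_ge0//.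
apply: le_trans (mt _) _; rewrite ler_expR lerD2l ler_pM2l//.
have -> : normsq (fun i => 2 * p i) = 4 * normsq p.
  by rewrite /normsq mulr_sumr; apply: eq_bigr => i _; ring.
by rewrite ler_pM2l.
Qed.

Lemma sint_exp_close (u v : V3 -> R) (Km M d : R) : (forall x, S x -> `|K x| <= Km) ->
  bounded_on S u -> bounded_on S v ->
  (forall x, S x -> u x <= M) -> (forall x, S x -> v x <= M) ->
  (forall x, S x -> `|u x - v x| <= d) ->
  forall x, S x -> `|K x * expR (2 * u x) - K x * expR (2 * v x)| <= Km * (expR (2 * M) * (2 * d)).
Proof.
move=> hK bu bv uM vM uv x Sx; rewrite -mulrBr normrM ler_pM// ?hK//.
have h : `|expR (2 * u x) - expR (2 * v x)| <= expR (2 * M) * `|2 * u x - 2 * v x|.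
  by apply: expR_lip; rewrite ler_pM2l// ?uM ?vM.
apply: le_trans h _; rewrite ler_wpM2l ?expR_ge0// -mulrBr normrM ger0_norm//.
by rewrite ler_pM2l// uv.
Qed.

(** K is positive near the orbit of x0, so mean (K exp (2 f)) > 0 for an invariant f with exp (2 f)
    = eps + psi, psi a bump along the orbit. Replacing f by T = (n + 1) [Vop n f] puts it in the
    span of one single block; the functional then takes the same value for every N containing that
    block. *)
Lemma test_function x0 : S x0 -> 0 < K x0 -> exists2 c0 : R, 0 < c0 &
  exists n0, forall N, (n0 < N)%N -> exists q0, c0 <= Jfun (@featG R G N) K q0.
Proof.
move=> Sx0 K0.
have [Km Km0 hK] := bounded_onP bK.
have K2 : 0 < K x0 / 2 by rewrite divr_gt0.
have [M hM] := Vop_approx uK K2.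
pose psi y := \sum_(A <- G) tau (A *m x0) y ^+ M.
have SA A x : A \in G -> S x -> S (A *m x) by move=> AG; exact: orth_sphere (Go AG).
have psi_ext y : psi y = \sum_(A <- G) (if A \in G then tau (A *m x0) y ^+ M else 0).
  by rewrite /psi big_seq [RHS]big_seq; apply: eq_bigr => A AG; rewrite AG.
have upsi : UC psi.
  rewrite (_ : psi = fun y => \sum_(A <- G) (if A \in G then tau (A *m x0) y ^+ M else 0)); last exact/funext.
  apply: UC_sum => A; case: (boolP (A \in G)) => [AG|_]; last exact: UC_cst.
  by apply: UC_tauX; exact: SA.
have bpsi := UC_bounded upsi.
have psi0 y : S y -> 0 <= psi y.
  by move=> Sy; rewrite /psi big_seq; apply: sumr_ge0 => A AG; rewrite exprn_ge0//; apply: tau_ge0 => //; exact: SA.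
have Kpsi : 0 < sint (fun y => K y * psi y).
  rewrite (_ : sint _ = \sum_(A <- G) (if A \in G then Vop M K (A *m x0) else 0)).
    rewrite (big_rem 1%:M)//= G1 mul1mx.
    have pos A : A \in G -> 0 < Vop M K (A *m x0).
      move=> AG; have := hM M (A *m x0) (leqnn _) (SA _ _ AG Sx0).
      rewrite KG// ler_norml => /andP[h _].
      by rewrite -(@pmulr_rgt0 _ M.+1%:R) ?ltr0n//; lra.
    have p1 := pos _ G1; rewrite mul1mx in p1.
    by apply: ltr_pwDl => //; apply: sumr_ge0 => A _; case: ifP => // /pos/ltW.
  transitivity (sint (fun y => \sum_(A <- G) (if A \in G then tau (A *m x0) y ^+ M * K y else 0))).
    apply: sint_ext => y _; rewrite psi_ext mulr_sumr; apply: eq_bigr => A _.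
    by case: ifP => _; rewrite ?mulr0// mulrC.
  rewrite sint_sum; last first.
    move=> A; case: (boolP (A \in G)) => [AG|_]; last exact: bounded_on_cst.
    by apply: tauXM_bounded => //; exact: SA.
  apply: eq_bigr => A _; case: (boolP (A \in G)) => // _.
  by rewrite -[RHS](sint_cst 0).
(* Small enough for eps times the mean of K to consume at most half of the mean of K psi. *)
pose eps := sint (fun y => K y * psi y) / (2 * Km).
have eps0 : 0 < eps by rewrite divr_gt0// mulr_gt0.
have ueps : UC (fun y => eps + psi y) by apply: UCD => //; exact: UC_cst.
have epsle y : S y -> eps <= eps + psi y by move=> Sy; rewrite lerDl psi0.
pose f y := 1 / 2 * ln (eps + psi y).
have uf : UC f by apply: UCZ; exact: UC_ln ueps eps0 epsle.
have bf := UC_bounded uf.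
have fE y : S y -> expR (2 * f y) = eps + psi y.
  move=> Sy; rewrite /f mulrA mulrA mulr1 mulfV ?mul1r// lnK// posrE.
  exact: lt_le_trans eps0 (epsle _ Sy).
have psiG A y : A \in G -> psi (A *m y) = psi y.
  move=> AG; rewrite /psi.
  rewrite -[LHS](gsum_mull Gu Go GM GT (fun B => tau (B *m x0) (A *m y) ^+ M) AG).
  by apply: eq_bigr => B _; rewrite -mulmxA orth_tau// Go.
have fG A y : A \in G -> f (A *m y) = f y by move=> AG; rewrite /f psiG.
have If : 0 < sint (fun y => K y * expR (2 * f y)).
  have -> : sint (fun y => K y * expR (2 * f y)) = eps * sint K + sint (fun y => K y * psi y).
    rewrite -sintZ// -sintD; [|exact: bounded_onZ|exact: bounded_onM].
    by apply: sint_ext => y Sy; rewrite fE//; ring.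
  have h : `|eps * sint K| <= eps * Km.
    by rewrite normrM ger0_norm ?(ltW eps0)// ler_pM2l//; exact: sint_bound.
  have e2 : eps * Km = sint (fun y => K y * psi y) / 2 by rewrite /eps; field; rewrite gt_eqF.
  by move: h; rewrite e2 ler_norml => /andP[h _]; lra.
have [F F0 hF] := bounded_onP bf.
set I0 := sint _ in If.
(* The first bound keeps T below F + 1; the second keeps the loss in the mean below I0 / 2. *)
pose d := Num.min 1 (I0 / (4 * (Km * expR (2 * (F + 1))))).
have D0 : 0 < 4 * (Km * expR (2 * (F + 1))) by rewrite !mulr_gt0// expR_gt0.
have d0 : 0 < d by rewrite lt_min ltr01 divr_gt0.
have [n1 hn1] := Vop_approx uf d0.
pose n := n1.+1; have nn1 : (n1 <= n)%N by exact: leqnSn.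
pose T x := n.+1%:R * Vop n f x.
have Tf x : S x -> `|T x - f x| <= d by move=> Sx; exact: hn1.
have bT : bounded_on S T.
  exists (F + d) => x Sx; rewrite -(subrK (f x) (T x)) addrC.
  by apply: le_trans (ler_normD _ _) _; rewrite lerD ?hF ?Tf.
have IT : 0 < sint (fun y => K y * expR (2 * T y)).
  have b1 : bounded_on S (fun y => K y * expR (2 * T y)) by apply: bounded_onM => //; exact: exp2_bounded.
  have b2 : bounded_on S (fun y => K y * expR (2 * f y)) by apply: bounded_onM => //; exact: exp2_bounded.
  have d1 : d <= 1 by rewrite ge_min lexx.
  have h : `|sint (fun y => K y * expR (2 * T y)) - I0| <= Km * (expR (2 * (F + 1)) * (2 * d)).
    rewrite -sintB//; apply: sint_bound; apply: sint_exp_close => //.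
      move=> x Sx; have := Tf _ Sx; have := hF _ Sx; rewrite !ler_norml => /andP[_ h1] /andP[_ h2].
      by move: d1 h1 h2; move: (T x) (f x) => a b; lra.
    by move=> x Sx; apply: le_trans (ler_norm _) _; apply: le_trans (hF _ Sx) _; rewrite lerDl.
  have : Km * (expR (2 * (F + 1)) * (2 * d)) <= I0 / 2.
    have : d * (4 * (Km * expR (2 * (F + 1)))) <= I0 by rewrite -ler_pdivlMr// ge_min lexx orbT.
    by move: (expR _) => z; lra.
  by move: h; rewrite ler_norml => /andP[h _] h2; lra.
exists (expR (- (n%:R * n.+1%:R * sint (fun y => T y * f y))) * sint (fun y => K y * expR (2 * T y))).
  by rewrite mulr_gt0// expR_gt0.
exists n1 => N hN; pose o : 'I_N := Ordinal hN.
(* Block n1 carries the kernel tau^n / n averaged over the group, with n = n1 + 1; the factor n (n +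
   1) turns its action on f into T. *)
pose q0 (i : {m : 'I_N & featT m}) : R :=
  if tag i == o then n%:R * n.+1%:R * sint (fun y => featG G i y * f y) else 0.
exists q0.
have bfe i := featG_bounded Go i : bounded_on S (@featG R G N i).
have bff i : bounded_on S (fun y => @featG R G N i y * f y) by exact: bounded_onM.
have lq x : S x -> lincomb (@featG R G N) q0 x = T x.
  move=> Sx; have := @sig_big_dep R 0 +%R 'I_N (@featT N) xpredT (fun=> xpredT)
    (fun m phi => q0 (tagF phi) * featG G (tagF phi) x).
  rewrite /= => h; transitivity (\sum_(m < N) \sum_(phi : featT m)
      q0 (tagF phi) * featG G (tagF phi) x).
    by rewrite h; apply: eq_bigr => -[m phi].
  rewrite (bigD1 o)//= [X in _ + X]big1 ?addr0; last first.
    by move=> m /negPf mo; apply: big1 => phi _; rewrite /q0 /= mo mul0r.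
  transitivity (n%:R * n.+1%:R * \sum_(phi : featT o)
     featG G (tagF phi) x * sint (fun y => featG G (tagF phi) y * f y)).
    rewrite mulr_sumr; apply: eq_bigr => phi _; rewrite /q0 /= eqxx.
    by move: (sint _) (featG _ _ _) => a b; ring.
  have -> : \sum_(phi : featT o) featG G (tagF phi) x * sint (fun y => featG G (tagF phi) y * f y)
     = sint (fun y => n%:R^-1 * (g^-1 * \sum_(A <- G) tau x (A *m y) ^+ n * f y)).
    transitivity (sint (fun y => \sum_(phi : featT o)
        featG G (tagF phi) x * (featG G (tagF phi) y * f y))).
      rewrite sint_sum; last by move=> phi; exact: bounded_onZ.
      by apply: eq_bigr => phi _; rewrite sintZ.
    apply: sint_ext => y _; transitivity ((\sum_(phi : featT o)
        featG G (tagF phi) x * featG G (tagF phi) y) * f y).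
      by rewrite mulr_suml; apply: eq_bigr => phi _; rewrite mulrA.
    by rewrite (featG_block Gu Go G1 GM GT) -mulr_suml -/g /=; ring.
  rewrite sintZ; last exact: gavg_bounded.
  rewrite gavg_Vop//; last by move=> A y AG _; exact: fG.
  rewrite /T; have : n%:R != 0 :> R by rewrite pnatr_eq0.
  by move: (n%:R : R) (n.+1%:R : R) => a b a0; field.
have nq : normsq q0 = n%:R * n.+1%:R * sint (fun y => T y * f y).
  transitivity (n%:R * n.+1%:R * sint (fun y => \sum_i q0 i * (featG G i y * f y))); last first.
    congr (_ * _); apply: sint_ext => y Sy; rewrite -lq// mulr_suml.
    by apply: eq_bigr => i _; rewrite mulrA.
  rewrite sint_sum; last by move=> i; exact: bounded_onZ.
  rewrite mulr_sumr; apply: eq_bigr => i _; rewrite sintZ// /q0.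
  by case: ifP => _; [move: (sint _) => a; ring|rewrite expr0n mul0r mulr0].
have eT : sint (fun y => K y * expR (2 * T y))
    = sint (fun y => K y * expR (2 * lincomb (@featG R G N) q0 y)).
  by apply: sint_ext => y Sy; rewrite lq.
by rewrite (JfunE bfe bK) nq eT; exact: lexx.
Qed.

Lemma LpartB N (f h : V3 -> R) x : S x -> bounded_on S f -> bounded_on S h ->
  Lpart N f x - Lpart N h x = Lpart N (fun y => f y - h y) x.
Proof.
move=> Sx bf bh; rewrite /Lpart -sumrB; apply: eq_bigr => n _; rewrite -mulrBl; congr (_ / _).
rewrite -[- Vop _ _ _]mulN1r -VopZ// -VopD//; last exact: bounded_onZ.
by apply: sint_ext => y _; rewrite mulN1r.
Qed.

Lemma le_mul_eps_eq0 (a D : R) : (forall e, 0 < e -> `|a| <= D * e) -> a = 0.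
Proof.
move=> h; apply/eqP; rewrite -normr_eq0 eq_le normr_ge0 andbT.
apply/ler_addgt0Pr => e e0; rewrite add0r.
have D1 : 0 < `|D| + 1 by rewrite ltr_wpDl.
apply: le_trans (h _ (divr_gt0 e0 D1)) _.
rewrite mulrA ler_pdivrMr// mulrC ler_pM2l//.
by apply: le_trans (ler_norm _) _; rewrite lerDl.
Qed.

Lemma quotient_close (a b l m c d P : R) : 0 < c -> c <= l -> c <= m ->
  `|a - b| <= d -> `|l - m| <= d -> `|b| <= P ->
  `|l^-1 * a - m^-1 * b| <= c^-1 * d + c^-1 * c^-1 * d * P.
Proof.
move=> c0 cl cm ab lm bP; have l0 := lt_le_trans c0 cl; have m0 := lt_le_trans c0 cm.
have -> : l^-1 * a - m^-1 * b = l^-1 * (a - b) + l^-1 * m^-1 * (m - l) * b.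
  by field; rewrite !gt_eqF.
apply: le_trans (ler_normD _ _) _.
have il : `|l^-1| <= c^-1 by rewrite ger0_norm ?invr_ge0 ?(ltW l0)// lef_pV2 ?posrE.
have im : `|m^-1| <= c^-1 by rewrite ger0_norm ?invr_ge0 ?(ltW m0)// lef_pV2 ?posrE.
rewrite !normrM; apply: lerD; first exact: ler_pM.
apply: ler_pM => //; rewrite ?mulr_ge0//.
apply: ler_pM => //; rewrite ?mulr_ge0//; last by rewrite distrC.
exact: ler_pM.
Qed.

Lemma mean_field_solution x0 : S x0 -> 0 < K x0 -> exists v : V3 -> R,
  [/\ bounded_on S v, forall A x, A \in G -> S x -> v (A *m x) = v x,
      sint (fun y => K y * expR (2 * v y)) = 1 &
      exists c, forall x, S x -> v x = c + Lop (fun y => K y * expR (2 * v y)) x].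
Proof.
move=> Sx0 K0; have [Km Km0 hK] := bounded_onP bK.
have [c0 c00 [n0 hn0]] := test_function Sx0 K0.
have [B hB] := truncated_solution hK c00.
pose Nk k := (n0.+1 + k)%N.
have /choice[u hu] : forall k, exists u : V3 -> R, UC u /\
   let l := sint (fun x => K x * expR (2 * u x)) in
   [/\ forall x, S x -> `|u x| <= B, c0 <= l,
     forall A x, A \in G -> u (A *m x) = u x &
     forall x, S x -> u x = Lpart (Nk k) (fun y => l^-1 * (K y * expR (2 * u y))) x].
  move=> k; have [q0 hq0] := hn0 (Nk k) (leq_addr _ _).
  by have [w uw hw] := hB _ _ hq0; exists w.
pose l k := sint (fun x => K x * expR (2 * u k x)).
pose E k y := K y * expR (2 * u k y); pose w k y := (l k)^-1 * E k y.
have uB k x : S x -> `|u k x| <= B by have [_ [h _ _ _]] := hu k; exact: h.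
have lc k : c0 <= l k by have [_ []] := hu k.
have uG k A x : A \in G -> u k (A *m x) = u k x by have [_ [_ _ h _]] := hu k; exact: h.
have uL k x : S x -> u k x = Lpart (Nk k) (w k) x by have [_ [_ _ _ h]] := hu k; exact: h.
have bu k : bounded_on S (u k) by exists B => x; exact: uB.
pose P := Km * expR (2 * B).
have P0 : 0 < P by rewrite mulr_gt0// expR_gt0.
have EP (f : V3 -> R) : (forall x, S x -> `|f x| <= B) ->
    forall x, S x -> `|K x * expR (2 * f x)| <= P.
  move=> fB x Sx; rewrite normrM ler_pM// ?hK// ger0_norm ?expR_ge0//.
  by rewrite ler_expR ler_pM2l//; apply: le_trans (ler_norm _) (fB _ Sx).
have bE k : bounded_on S (E k) by exists P => x; apply: EP => y; exact: uB.
pose W := c0^-1 * P.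
have wW k x : S x -> `|w k x| <= W.
  move=> Sx; have lk := lt_le_trans c00 (lc k).
  rewrite normrM ger0_norm ?invr_ge0 ?(ltW lk)// ler_pM ?invr_ge0 ?(ltW lk)//.
    by rewrite lef_pV2 ?posrE.
  by apply: EP => // y; exact: uB.
have bw k : bounded_on S (w k) by exists W => x; exact: wW.
(* Cutting the sum for u k at m costs at most W / (m + 1), uniformly in k, and the cut sums are
   covered by [equicvg_Lpart]. *)
have eu : equicvg u.
  move=> e e0; have e2 : 0 < e / 2 by rewrite divr_gt0.
  have [m hm] := natr_ge (W / (e / 2)).
  have [h hh] := equicvg_Lpart m wW e2; exists h.
  have hoo : ufilter [set k | (m <= k)%N] by apply: ufilter_oo; exists m.
  apply: filterS (filterI hh hoo) => k [/= h1 h2] x Sx.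
  have := h1 x Sx; have := hm _ (leqnn m); rewrite ler_pdivrMr// mulrC -ler_pdivrMr ?ltr0n// => h3.
  have mN : (m <= Nk k)%N by rewrite /Nk (leq_trans h2)// leq_addl.
  have := Lpart_tail m (Nk k - m) Sx (wW k); rewrite subnKC// -uL// => h4.
  rewrite -(subrK (Lpart m (w k) x) (u k x)) -addrA => h5.
  by apply: le_trans (ler_normD _ _) _; have := le_trans h4 h3; lra.
pose ui x := ulim (u^~ x).
have uc := equicvg_ulim eu uB.
have uiB x : S x -> `|ui x| <= B.
  move=> Sx; apply: (cvgr_to_le (cvg_norm (ulim_cvg (fun k => uB k x Sx)))).
  by apply: filterE => k; exact: uB.
have bui : bounded_on S ui by exists B.
pose Ei y := K y * expR (2 * ui y).
have bEi : bounded_on S Ei by exists P; exact: EP.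
pose li := sint Ei.
have close k (e : R) : (forall x, S x -> `|u k x - ui x| <= e) ->
    (forall x, S x -> `|E k x - Ei x| <= P * 2 * e) /\ `|l k - li| <= P * 2 * e.
  move=> h; have h1 x : S x -> `|E k x - Ei x| <= P * 2 * e.
    move=> Sx; have -> : P * 2 * e = Km * (expR (2 * B) * (2 * e)) by rewrite /P; ring.
    apply: (sint_exp_close hK (bu k) bui) => // y Sy.
      exact: le_trans (ler_norm _) (uB _ _ Sy).
    exact: le_trans (ler_norm _) (uiB _ Sy).
  by split; [exact: h1|rewrite /l /li -sintB; [exact: sint_bound|exact: bE|exact: bEi]].
have P2 : 0 < P * 2 by rewrite mulr_gt0.
have lic : c0 <= li.
  rewrite -subr_ge0; apply/ler_addgt0Pr => e e0.
  have [k /= hk] := filter_ex (uc _ (divr_gt0 e0 P2)).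
  have [_] := close _ _ hk; rewrite [P * 2 * _]mulrC divfK ?gt_eqF// ler_norml => /andP[_ h].
  by have := lc k; lra.
have li0 : 0 < li by exact: lt_le_trans lic.
pose wi y := li^-1 * Ei y.
have bwi : bounded_on S wi by exact: bounded_onZ.
have wiW x : S x -> `|wi x| <= W.
  move=> Sx; rewrite normrM ger0_norm ?invr_ge0 ?(ltW li0)// ler_pM ?invr_ge0 ?(ltW li0)//.
    by rewrite lef_pV2 ?posrE.
  exact: EP.
pose Q := c0^-1 * (P * 2) + c0^-1 * c0^-1 * (P * 2) * P.
have uiL x : S x -> ui x = Lop wi x.
  move=> Sx; apply/eqP; rewrite -subr_eq0; apply/eqP.
  apply: (@le_mul_eps_eq0 _ (2 + Q)) => e e0.
  have [m hm] := natr_ge (W / e).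
  have hoo : ufilter [set k | (m <= k)%N] by apply: ufilter_oo; exists m.
  have [k [/= hk mk]] := filter_ex (filterI (uc _ e0) hoo).
  have [hE hl] := close _ _ hk; have lk0 := lt_le_trans c00 (lc k).
  have ww y : S y -> `|w k y - wi y| <= Q * e.
    move=> Sy; have -> : Q * e = c0^-1 * (P * 2 * e) + c0^-1 * c0^-1 * (P * 2 * e) * P.
      by rewrite /Q; ring.
    by apply: quotient_close; [exact: c00|exact: lc|exact: lic|exact: hE|exact: hl|exact: EP].
  have h1 : `|ui x - u k x| <= e by rewrite distrC; exact: hk.
  have h2 : `|Lpart (Nk k) (w k) x - Lpart (Nk k) wi x| <= Q * e.
    by rewrite LpartB//; exact: Lpart_bound.
  have h3 : `|Lpart (Nk k) wi x - Lop wi x| <= e.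
    rewrite distrC; apply: le_trans (Lop_tail (Nk k) Sx wiW) _.
    rewrite ler_pdivrMr ?ltr0n// mulrC -ler_pdivrMr//.
    by apply: hm; rewrite /Nk (leq_trans mk)// leq_addl.
  rewrite -(uL k x Sx) in h2.
  apply: le_trans (ler_distD (u k x) _ _) _.
  apply: le_trans (lerD h1 (ler_distD (Lpart (Nk k) wi x) _ _)) _.
  apply: le_trans (lerD (lexx e) (lerD h2 h3)) _.
  by rewrite le_eqVlt; apply/orP; left; apply/eqP; ring.
(* Subtracting ln (li) / 2 divides exp (2 ui) by li: the density becomes [wi], of mean 1, and the
   subtracted number becomes the constant c. *)
exists (fun x => ui x - 1 / 2 * ln li).
have wiE y : K y * expR (2 * (ui y - 1 / 2 * ln li)) = wi y.
  have -> : 2 * (ui y - 1 / 2 * ln li) = 2 * ui y - ln li by field.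
  by rewrite expRD expRN lnK ?posrE// mulrA mulrC.
split.
- by apply: bounded_onB => //; exact: bounded_on_cst.
- move=> A x AG Sx; congr (_ - _); congr (ulim _); apply/funext => k.
  exact: uG.
- transitivity (sint wi); first by apply: sint_ext => y _; exact: wiE.
  by rewrite sintZ// mulVf// gt_eqF.
exists (- (1 / 2 * ln li)) => x Sx.
have -> : Lop (fun y => K y * expR (2 * (ui y - 1 / 2 * ln li))) x = ui x.
  by rewrite (uiL _ Sx); apply: Lop_ext => y _; exact: wiE.
exact: addrC.
Qed.

End Existence.

(** * Hoelder classes on the plane *)

Section Derivatives.
Variable R : realType.

(** Replaces the limit of quotients by plain inequalities, in which tails of series can be
    estimated. *)
Lemma is_derive_eps (V : normedModType R) (f : V -> R) (y v : V) (d : R) :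
  is_derive y v f d <-> forall e : R, 0 < e -> exists2 r : R, 0 < r &
    forall h, `|h| < r -> `|f (y + h *: v) - f y - d * h| <= e * `|h|.
Proof.
have quo (h : R) : h != 0 -> `|d - h^-1 *: ((f \o shift y) (h *: v) - f y)|
    = `|f (y + h *: v) - f y - d * h| / `|h|.
  move=> h0; rewrite /= [h *: v + y]addrC -normrV ?unitfE// -normrM distrC; congr `|_|.
  by rewrite -[LHS]/(h^-1 * (f (y + h *: v) - f y) - d); field.
split=> [[cf df] e e0|H].
  have : h^-1 *: ((f \o shift y) (h *: v) - f y) @[h --> 0^'] --> d by rewrite -df; exact: cf.
  move/cvgrPdist_le => /(_ e e0)[r /= r0 hr]; exists r => // h hlt.
  have [->|h0] := eqVneq h 0; first by rewrite scale0r addr0 subrr mulr0 subrr normr0 mulr0.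
  have := hr h; rewrite /= sub0r normrN => /(_ hlt h0).
  by rewrite quo// ler_pdivrMr ?normr_gt0.
have c : h^-1 *: ((f \o shift y) (h *: v) - f y) @[h --> 0^'] --> d.
  apply/cvgrPdist_le => e e0; have [r r0 hr] := H _ e0.
  exists r => //= h; rewrite /= sub0r normrN => hlt h0.
  by rewrite quo// ler_pdivrMr ?normr_gt0// hr.
by split; [apply/cvg_ex; exists d|exact: cvg_lim].
Qed.

Lemma is_derive_ext (V : normedModType R) (f g : V -> R) (y v : V) (d d' : R) :
  is_derive y v f d -> (forall z, f z = g z) -> d = d' -> is_derive y v g d'.
Proof. by move=> h /funext <- <-. Qed.

Lemma is_derive_line (V : normedModType R) (f : V -> R) (y v : V) (t d : R) :
  is_derive (y + t *: v) v f d <-> is_derive t 1 (fun s => f (y + s *: v)) d.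
Proof.
have e h : y + t *: v + h *: v = y + (t + h *: (1 : R)) *: v.
  by rewrite -addrA -scalerDl -[h *: (1 : R)]/(h * 1) mulr1.
split=> /is_derive_eps H; apply/is_derive_eps => c /H[r r0 hr]; exists r => // h /hr.
  by rewrite e.
by rewrite -e.
Qed.

Lemma is_derive_chain (V : normedModType R) (f : V -> R) (g : R -> R) (y v : V) (a d : R) :
  is_derive (f y) 1 g a -> is_derive y v f d -> is_derive y v (fun z => g (f z)) (a * d).
Proof.
move=> hg hf; have y0 : y + (0 : R) *: v = y by rewrite scale0r addr0.
rewrite -y0 in hg hf *.
have h := (is_derive_line f y v 0 d).1 hf.
apply: (is_derive_line (fun z => g (f z)) y v 0 (a * d)).2.
exact: (@is_derive1_comp _ g (fun s => f (y + s *: v)) 0 a d).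
Qed.

Lemma is_derive_mulr (V : normedModType R) (f g : V -> R) (y v : V) (a b : R) :
  is_derive y v f a -> is_derive y v g b ->
  is_derive y v (fun z => f z * g z) (a * g y + f y * b).
Proof.
move=> hf hg; apply: (is_derive_ext (is_deriveM hf hg)) => //.
by rewrite -[LHS]/(f y * b + g y * a); ring.
Qed.

Lemma is_derive_addr (V : normedModType R) (f g : V -> R) (y v : V) (a b : R) :
  is_derive y v f a -> is_derive y v g b ->
  is_derive y v (fun z => f z + g z) (a + b).
Proof. by move=> hf hg; exact: (is_derive_ext (is_deriveD hf hg)). Qed.

Lemma is_derive_constr (V : normedModType R) (c : R) (y v : V) :
  is_derive y v (fun=> c) 0.
Proof.
apply/is_derive_eps => e e0; exists 1 => // h _.
by rewrite subrr mul0r subrr normr0 mulr_ge0// ltW.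
Qed.

Lemma is_derive_sumr (V : normedModType R) (I : Type) (r : seq I) (f : I -> V -> R)
    (d : I -> R) (y v : V) : (forall i, is_derive y v (f i) (d i)) ->
  is_derive y v (fun z => \sum_(i <- r) f i z) (\sum_(i <- r) d i).
Proof.
move=> h; elim: r => [|i r ih].
  rewrite big_nil; apply: (is_derive_ext (is_derive_constr 0 y v)) => // z.
  by rewrite big_nil.
rewrite big_cons; apply: (is_derive_ext (is_derive_addr (h i) ih)) => // z.
by rewrite big_cons.
Qed.

Lemma is_derive_expr (V : normedModType R) (f : V -> R) (n : nat) (y v : V) (d : R) :
  is_derive y v f d -> is_derive y v (fun z => f z ^+ n) (n%:R * f y ^+ n.-1 * d).
Proof.
move=> hf; elim: n => [|n ih].
  by rewrite !mul0r; apply: (is_derive_ext (is_derive_constr 1 y v)) => // z; rewrite expr0.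
apply: (is_derive_ext (is_derive_mulr hf ih)); first by move=> z; rewrite exprS.
case: n ih => [|n] ih; first by rewrite /= !expr0; ring.
rewrite -[n.+2%:R]natr1 /= exprS; ring.
Qed.

Lemma is_derive_continuous (h dh : R -> R) :
  (forall t : R, is_derive t (1 : R) h (dh t)) -> continuous h.
Proof.
move=> H t; apply: differentiable_continuous; apply/derivable1_diffP.
by have [] := H t.
Qed.

Lemma mvt_real (h dh : R -> R) (a : R) : (forall t : R, is_derive t (1 : R) h (dh t)) ->
  exists2 s : R, 0 <= s <= 1 & h a - h 0 = dh (s * a) * a.
Proof.
move=> H; have ch := is_derive_continuous H.
have [a0|a0] := leP 0 a.
  have cw : {within `[0, a], continuous h} by exact: continuous_subspaceT.
  have [c] := MVT_segment a0 (fun x _ => H x) cw.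
  rewrite in_itv /= => /andP[c0 ca]; rewrite subr0 => e.
  have [az|an] := eqVneq a 0.
    by exists 0; rewrite ?lexx ?ler01// e az !mulr0.
  exists (c / a); rewrite ?divfK//; have a1 : 0 < a by rewrite lt_neqAle eq_sym an.
  by rewrite divr_ge0//= ler_pdivrMr// mul1r.
have cw : {within `[a, 0], continuous h} by exact: continuous_subspaceT.
have [c] := MVT_segment (ltW a0) (fun x _ => H x) cw.
rewrite in_itv /= => /andP[ca c0]; rewrite sub0r => e.
have an : a != 0 by rewrite lt_eqF.
exists (c / a); last by rewrite divfK// -opprB e; ring.
by rewrite ler_ndivrMr// mul1r ca andbT ler_ndivlMr// mul0r.
Qed.

Lemma mvt_line (V : normedModType R) (f : V -> R) (df : V -> R) (y v : V) (a : R) :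
  (forall t, is_derive (y + t *: v) v f (df (y + t *: v))) ->
  exists2 s : R, 0 <= s <= 1 & f (y + a *: v) - f y = df (y + (s * a) *: v) * a.
Proof.
move=> H.
have H2 (t : R) : is_derive t (1 : R) (fun s : R => f (y + s *: v)) (df (y + t *: v)).
  exact: (is_derive_line f y v t _).1.
by have [s s01] := mvt_real a H2; rewrite scale0r addr0 => e; exists s.
Qed.

End Derivatives.

(** * Partial derivatives and local Hoelder classes *)

Section Plane.
Variable R : realType.
Local Notation V2 := 'cV[R]_2.
Implicit Types (F f : V2 -> R) (y z : V2) (alpha r : R).

Lemma normV2_le y r : (`|y| <= r) <-> 0 <= r /\ forall i, `|y i 0| <= r.
Proof.
split=> [h|[r0 h]].
  split=> [|i]; first exact: le_trans (normr_ge0 _) h.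
  apply: le_trans h; rewrite -[`|y|]/(mx_norm y) mx_normrE.
  by apply: (le_bigmax _ (fun ij => `|y ij.1 ij.2|) (i, 0)).
rewrite -[`|y|]/(mx_norm y) mx_normrE; apply/bigmax_leP; split=> // -[i j] _ /=.
by rewrite ord1; exact: h.
Qed.

Lemma coord_norm y i : `|y i 0| <= `|y|.
Proof. by have /normV2_le[] := lexx `|y|. Qed.

Definition pderiv F (dF : 'I_2 -> V2 -> R) :=
  forall i y, is_derive y (basisv R i) F (dF i y).

Lemma pderiv_partial F dF : pderiv F dF -> forall i, partial i F = dF i.
Proof. by move=> h i; apply/funext => y; have [_ e] := h i y. Qed.

Lemma basisvE (i j : 'I_2) : basisv R i j 0 = (j == i)%:R.
Proof. by rewrite /basisv mxE eqxx andbT. Qed.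

Lemma ord2_cases (P : 'I_2 -> Prop) : P 0 -> P 1 -> forall i, P i.
Proof.
move=> P0 P1 [[|[|//]] p].
  by rewrite (_ : Ordinal p = 0)//; exact: val_inj.
by rewrite (_ : Ordinal p = 1)//; exact: val_inj.
Qed.

(** The box spanned by y and z rather than the segment: the mean value theorem is applied along two
    coordinate segments and yields two distinct points. *)
Definition between y z (x : V2) := forall i, exists2 s : R, 0 <= s <= 1 &
  x i 0 = y i 0 + s * (z i 0 - y i 0).

Lemma between_norm y z x r : between y z x -> `|y| <= r -> `|z| <= r -> `|x| <= r.
Proof.
move=> b /normV2_le[r0 hy] /normV2_le[_ hz]; apply/normV2_le; split=> // i.
have [s /andP[s0 s1] ->] := b i; have := hy i; have := hz i; rewrite !ler_norml.
move=> /andP[h1 h2] /andP[h3 h4].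
have -> : y i 0 + s * (z i 0 - y i 0) = (1 - s) * y i 0 + s * z i 0 by ring.
have p1 : 0 <= (1 - s) * (y i 0 + r) by rewrite mulr_ge0//; lra.
have p2 : 0 <= s * (z i 0 + r) by rewrite mulr_ge0//; lra.
have p3 : 0 <= (1 - s) * (r - y i 0) by rewrite mulr_ge0//; lra.
have p4 : 0 <= s * (r - z i 0) by rewrite mulr_ge0//; lra.
by apply/andP; split; nra.
Qed.

Lemma between_dist y z x : between y z x -> `|x - y| <= `|z - y|.
Proof.
move=> b; apply/normV2_le; split=> // i; have [s /andP[s0 s1]] := b i.
rewrite !mxE => ->; rewrite addrC addKr normrM ger0_norm//.
have := coord_norm (z - y) i; rewrite !mxE => h; apply: le_trans h.
by rewrite ler_piMl.
Qed.

Lemma mvt_plane F dF y z : pderiv F dF -> exists a b, [/\ between y z a, between y z b &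
  F z - F y = dF 0 a * (z 0 0 - y 0 0) + dF 1 b * (z 1 0 - y 1 0)].
Proof.
move=> h; pose w := y + (z 0 0 - y 0 0) *: basisv R 0.
have ez : z = w + (z 1 0 - y 1 0) *: basisv R 1.
  apply/colP; apply: ord2_cases; rewrite !mxE /=; ring.
have [s s01 e1] := @mvt_line R _ F (dF 0) y (basisv R 0) (z 0 0 - y 0 0) (fun t => h _ _).
have [t t01 e2] := @mvt_line R _ F (dF 1) w (basisv R 1) (z 1 0 - y 1 0) (fun t => h _ _).
rewrite -ez in e2; rewrite -/w in e1.
exists (y + (s * (z 0 0 - y 0 0)) *: basisv R 0), (w + (t * (z 1 0 - y 1 0)) *: basisv R 1).
split; last by rewrite -e1 -e2; ring.
  apply: ord2_cases; first by exists s => //; rewrite !mxE /=; ring.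
  by exists 0; rewrite ?lexx ?ler01// !mxE /=; ring.
apply: ord2_cases; first by exists 1; rewrite ?lexx ?ler01// !mxE /=; ring.
by exists t => //; rewrite !mxE /=; ring.
Qed.

Definition locholder alpha F := forall r : R, exists C : R, forall y z,
  `|y| <= r -> `|z| <= r -> `|F y - F z| <= C * `|y - z| `^ alpha.

Definition locbounded F := forall r : R, exists M : R, forall y, `|y| <= r -> `|F y| <= M.

(** Recursive form of [holder_plane] with the Hoelder bound at top order only; continuity and local
    bounds at lower orders follow from it. The recursion suits inductions with the product and chain
    rules. *)
Fixpoint Hc (k : nat) alpha F : Prop :=
  if k is k'.+1 then
    (forall i y, derivable F y (basisv R i)) /\ forall i, Hc k' alpha (partial i F)
  else locholder alpha F.

Variable alpha : R.
Hypothesis a0 : 0 < alpha.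
Hypothesis a1 : alpha <= 1.

Lemma locholderP F : locholder alpha F -> forall r, exists2 C : R, 0 <= C & forall y z,
  `|y| <= r -> `|z| <= r -> `|F y - F z| <= C * `|y - z| `^ alpha.
Proof.
move=> h r; have [C hC] := h r; exists `|C| => // y z yr zr.
apply: le_trans (hC _ _ yr zr) _; rewrite ler_wpM2r ?powR_ge0//.
exact: ler_norm.
Qed.

Lemma locboundedP F : locbounded F -> forall r, exists2 M : R, 0 <= M &
  forall y, `|y| <= r -> `|F y| <= M.
Proof.
move=> h r; have [M hM] := h r; exists `|M| => // y yr.
exact: le_trans (hM _ yr) (ler_norm _).
Qed.

Lemma locholder_bounded F : locholder alpha F -> locbounded F.
Proof.
move=> h r; have [C C0 hC] := locholderP h r; exists (`|F 0| + C * r `^ alpha) => y yr.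
have r0 : 0 <= r by exact: le_trans (normr_ge0 _) yr.
rewrite -(subrK (F 0) (F y)) addrC; apply: le_trans (ler_normD _ _) _; rewrite lerD2l.
apply: le_trans (hC y 0 yr _) _; first by rewrite normr0.
by rewrite subr0 ler_wpM2l//; apply: ge0_ler_powR; rewrite ?nnegrE ?(ltW a0).
Qed.

(** Distances in the ball of radius r are at most 2 r, so |y - z| <= (2 r)^(1 - alpha) |y -
    z|^alpha. *)
Lemma loclip_holder F : (forall r, exists C : R, forall y z,
    `|y| <= r -> `|z| <= r -> `|F y - F z| <= C * `|y - z|) -> locholder alpha F.
Proof.
move=> h r; have [C hC] := h r; exists (`|C| * (2 * `|r|) `^ (1 - alpha)) => y z yr zr.
apply: le_trans (hC _ _ yr zr) _.
have [->|d0] := eqVneq (`|y - z|) 0; first by rewrite mulr0 !mulr_ge0 ?powR_ge0.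
apply: (@le_trans _ _ (`|C| * `|y - z|)); first by rewrite ler_wpM2r// ler_norm.
rewrite -mulrA ler_wpM2l//.
have {1}-> : `|y - z| = `|y - z| `^ (1 - alpha) * `|y - z| `^ alpha.
  rewrite -powRD ?subrK ?powRr1//; by rewrite d0 implybT.
rewrite ler_wpM2r ?powR_ge0//; apply: ge0_ler_powR; rewrite ?nnegrE ?subr_ge0 ?mulr_ge0//.
apply: le_trans (ler_normB _ _) _; rewrite mulr_natl mulr2n.
by apply: lerD; apply: le_trans (ler_norm r).
Qed.

Lemma pderiv_lip F dF r (M : R) : pderiv F dF -> (forall i y, `|y| <= r -> `|dF i y| <= M) ->
  forall y z, `|y| <= r -> `|z| <= r -> `|F y - F z| <= (M + M) * `|y - z|.
Proof.
move=> h hM y z yr zr; have [a [b [ba bb ->]]] := mvt_plane z y h.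
apply: le_trans (ler_normD _ _) _; rewrite !normrM mulrDl.
have M0 : 0 <= M by exact: le_trans (normr_ge0 _) (hM 0 _ yr).
have c0 := coord_norm (y - z) 0; have c1 := coord_norm (y - z) 1; rewrite !mxE in c0 c1.
apply: lerD; apply: ler_pM => //; apply: hM.
  exact: between_norm ba zr yr.
exact: between_norm bb zr yr.
Qed.

Lemma pderiv_of F : (forall i y, derivable F y (basisv R i)) -> pderiv F (fun i => partial i F).
Proof. by move=> h i y; split; [exact: h|]. Qed.

Lemma Hc_locholder k F : Hc k alpha F -> locholder alpha F.
Proof.
elim: k F => [//|k ih] F [dF hF]; apply: loclip_holder => r.
have [M0 hM0] := locholder_bounded (ih _ (hF 0)) r.
have [M1 hM1] := locholder_bounded (ih _ (hF 1)) r.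
exists (Num.max M0 M1 + Num.max M0 M1); apply: (pderiv_lip (pderiv_of dF)).
apply: ord2_cases => y yr.
  by apply: le_trans (hM0 _ yr) _; rewrite le_max lexx.
by apply: le_trans (hM1 _ yr) _; rewrite le_max lexx orbT.
Qed.

Lemma Hc_bounded k F : Hc k alpha F -> locbounded F.
Proof. by move=> h; apply: locholder_bounded; exact: Hc_locholder h. Qed.

Lemma HcS k F : Hc k.+1 alpha F -> Hc k alpha F.
Proof.
elim: k F => [|k ih] F; first exact: Hc_locholder.
by move=> [dF hF]; split => // i; apply: ih; exact: hF.
Qed.

Lemma Hc_le k l F : (l <= k)%N -> Hc k alpha F -> Hc l alpha F.
Proof.
move=> /subnK <-; elim: (k - l)%N => [//|n ih]; rewrite addSn => /HcS.
exact: ih.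
Qed.

Lemma locholder_continuous F : locholder alpha F -> continuous F.
Proof.
move=> h y; apply/(@cvgrPdist_le _ _ _ (nbhs y) (nbhs_filter y)) => e e0.
have [C C0 hC] := locholderP h (`|y| + 1).
have d0 : 0 < e / (C + 1) by rewrite divr_gt0// ltr_wpDl.
pose d := Num.min 1 ((e / (C + 1)) `^ alpha^-1).
have dp : 0 < d by rewrite lt_min ltr01 powR_gt0.
near=> z; have zd : `|y - z| < d.
  by near: z; apply: (@cvgr_dist_lt _ _ _ (nbhs y) _ id y); [exact: cvg_id|exact: dp].
have z1 : `|z| <= `|y| + 1.
  rewrite -(subrK y z) addrC; apply: le_trans (ler_normD _ _) _; rewrite lerD2l distrC.
  by apply: ltW; apply: lt_le_trans zd _; rewrite ge_min lexx.
apply: le_trans (hC _ _ _ z1) _; first by rewrite lerDl.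
apply: (@le_trans _ _ ((C + 1) * (e / (C + 1)))); last first.
  by rewrite mulrC divfK// gt_eqF// ltr_wpDl.
apply: ler_pM; rewrite ?powR_ge0//; first by rewrite lerDl.
have -> : e / (C + 1) = ((e / (C + 1)) `^ alpha^-1) `^ alpha.
  by rewrite -powRrM mulVf ?gt_eqF// powRr1// ltW.
apply: ge0_ler_powR; rewrite ?nnegrE ?powR_ge0 ?(ltW a0)//.
by apply: ltW; apply: lt_le_trans zd _; rewrite ge_min lexx orbT.
Unshelve. all: by end_near. Qed.

Lemma holder_planeP k F : holder_plane k alpha F <-> Hc k alpha F.
Proof.
split.
  elim: k F => [|k ih] F [dF cF hF] /=; first exact: (hF [::]).
  split=> [i y|i]; first exact: (dF [::] i y).
  have ip s : iter_partial s (partial i F) = iter_partial (rcons s i) F.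
    by rewrite /iter_partial foldr_rcons.
  apply: ih; split=> [s j y sk|s sk|s sk].
  - by rewrite ip; apply: dF; rewrite size_rcons.
  - by rewrite ip; apply: cF; rewrite size_rcons.
  - by rewrite ip; apply: hF; rewrite size_rcons sk.
elim: k F => [|k ih] F hF.
  split=> [//|s|s /size0nil ->]; last exact: hF.
  by rewrite leqn0 => /nilP ->; exact: locholder_continuous.
have [dF pF] := hF.
have ip s i : iter_partial (rcons s i) F = iter_partial s (partial i F).
  by rewrite /iter_partial foldr_rcons.
split.
- case/lastP => [|s i] j y; first by move=> _; exact: dF.
  by rewrite size_rcons ltnS ip => sk; have [h _ _] := ih _ (pF i); exact: h.
- case/lastP => [|s i]; first by move=> _; exact: locholder_continuous (Hc_locholder hF).
  by rewrite size_rcons ltnS ip => sk; have [_ h _] := ih _ (pF i); exact: h.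
- case/lastP => [//|s i]; rewrite size_rcons ip => -[sk].
  by have [_ _ h] := ih _ (pF i); exact: h.
Qed.

Lemma HcSP k F dF : pderiv F dF -> (forall i, Hc k alpha (dF i)) -> Hc k.+1 alpha F.
Proof.
move=> h hd; split=> [i y|i]; first by have [] := h i y.
by rewrite (pderiv_partial h).
Qed.

Lemma HcS_inv k F : Hc k.+1 alpha F ->
  pderiv F (fun i => partial i F) /\ forall i, Hc k alpha (partial i F).
Proof. by move=> [dF hF]; split => //; exact: pderiv_of. Qed.

Lemma Hc_cst k c : Hc k alpha (fun=> c).
Proof.
elim: k c => [|k ih] c.
  by move=> r; exists 0 => y z _ _; rewrite subrr normr0 mul0r.
by apply: (@HcSP _ _ (fun _ _ => 0)) => [i y|i]; [exact: is_derive_constr|exact: ih].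
Qed.

Lemma HcD k F G : Hc k alpha F -> Hc k alpha G -> Hc k alpha (fun y => F y + G y).
Proof.
elim: k F G => [|k ih] F G.
  move=> hF hG r; have [C hC] := hF r; have [D hD] := hG r; exists (C + D) => y z yr zr.
  rewrite opprD addrACA mulrDl; apply: le_trans (ler_normD _ _) _.
  by apply: lerD; [exact: hC|exact: hD].
move=> /HcS_inv[dF hF] /HcS_inv[dG hG].
apply: (@HcSP _ _ (fun i y => partial i F y + partial i G y)) => [i y|i].
  exact: is_derive_addr.
exact: ih.
Qed.

Lemma HcM k F G : Hc k alpha F -> Hc k alpha G -> Hc k alpha (fun y => F y * G y).
Proof.
elim: k F G => [|k ih] F G.
  move=> hF hG r; have [C C0 hC] := locholderP hF r; have [D D0 hD] := locholderP hG r.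
  have [M M0 hM] := locboundedP (locholder_bounded hF) r.
  have [N N0 hN] := locboundedP (locholder_bounded hG) r.
  exists (C * N + M * D) => y z yr zr.
  have -> : F y * G y - F z * G z = (F y - F z) * G y + F z * (G y - G z) by ring.
  apply: le_trans (ler_normD _ _) _; rewrite !normrM mulrDl mulrAC.
  apply: lerD; first by apply: ler_pM => //; [exact: hC|exact: hN].
  by rewrite -mulrA; apply: ler_pM => //; [exact: hM|exact: hD].
move=> hF hG; have [dF pF] := HcS_inv hF; have [dG pG] := HcS_inv hG.
apply: (@HcSP _ _ (fun i y => partial i F y * G y + F y * partial i G y)) => [i y|i].
  exact: is_derive_mulr.
by apply: HcD; apply: ih => //; exact: HcS.
Qed.

Lemma HcZ k c F : Hc k alpha F -> Hc k alpha (fun y => c * F y).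
Proof. by apply: HcM; exact: Hc_cst. Qed.

Lemma HcB k F G : Hc k alpha F -> Hc k alpha G -> Hc k alpha (fun y => F y - G y).
Proof.
move=> hF hG; rewrite (_ : (fun y => _) = fun y => F y + -1 * G y).
  by apply: HcD => //; exact: HcZ.
by apply/funext => y; rewrite mulN1r.
Qed.

Lemma Hc_sum k (I : Type) (s : seq I) (F : I -> V2 -> R) :
  (forall i, Hc k alpha (F i)) -> Hc k alpha (fun y => \sum_(i <- s) F i y).
Proof.
move=> h; elim: s => [|i s ih].
  by rewrite (_ : (fun y => _) = fun=> 0); [exact: Hc_cst|apply/funext => y; rewrite big_nil].
rewrite (_ : (fun y => _) = fun y => F i y + \sum_(i <- s) F i y); first exact: HcD.
by apply/funext => y; rewrite big_cons.
Qed.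

Lemma Hc_expR k F : Hc k alpha F -> Hc k alpha (fun y => expR (F y)).
Proof.
elim: k F => [|k ih] F.
  move=> hF r; have [C C0 hC] := locholderP hF r.
  have [M M0 hM] := locboundedP (locholder_bounded hF) r.
  exists (expR M * C) => y z yr zr.
  apply: le_trans (@expR_lip _ (F y) (F z) M _ _) _.
  - exact: le_trans (ler_norm _) (hM _ yr).
  - exact: le_trans (ler_norm _) (hM _ zr).
  by rewrite -mulrA ler_wpM2l ?expR_ge0// hC.
move=> hF; have [dF pF] := HcS_inv hF.
apply: (@HcSP _ _ (fun i y => expR (F y) * partial i F y)) => [i y|i].
  exact: is_derive_chain.
by apply: HcM => //; apply: ih; exact: HcS.
Qed.

Lemma pderiv_coord (j : 'I_2) : pderiv (fun y => y j 0) (fun i _ => (j == i)%:R).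
Proof.
move=> i y; apply/is_derive_eps => e e0; exists 1 => // h _.
rewrite 2!mxE basisvE (_ : _ - _ = 0); last by ring.
by rewrite normr0 mulr_ge0// ltW.
Qed.

Lemma Hc_coord k (j : 'I_2) : Hc k alpha (fun y => y j 0).
Proof.
case: k => [|k]; last first.
  by apply: (HcSP (@pderiv_coord j)) => i; exact: Hc_cst.
apply: loclip_holder => r; exists 1 => y z _ _; rewrite mul1r.
by have := coord_norm (y - z) j; rewrite !mxE.
Qed.

Definition sqn y : R := y 0 0 ^+ 2 + y 1 0 ^+ 2.

(** In stereographic coordinates the round metric is 4 qf^2 times the flat one. Derivatives of qf
    are polynomials in qf and the coordinates, which makes its regularity an algebraic induction. *)
Definition qf y : R := (1 + sqn y)^-1.

Lemma sqn_ge0 y : 0 <= sqn y.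
Proof. by rewrite addr_ge0 ?sqr_ge0. Qed.

Lemma qf_gt0 y : 0 < qf y.
Proof. by rewrite invr_gt0 ltr_pwDl// sqn_ge0. Qed.

Lemma qf_le1 y : qf y <= 1.
Proof. by rewrite invf_le1 ?lerDl ?sqn_ge0// ltr_pwDl// sqn_ge0. Qed.

Lemma pderiv_qf : pderiv qf (fun i y => -2 * y i 0 * qf y ^+ 2).
Proof.
move=> i y; have s0 := sqn_ge0 y.
have dn : is_derive y (basisv R i) (fun z => 1 + sqn z) (2 * y i 0).
  have e j := is_derive_expr 2 (@pderiv_coord j i y).
  apply: (is_derive_ext (is_derive_addr (is_derive_constr 1 y _) (is_derive_addr (e 0) (e 1)))) => //.
  by move: i e; apply: ord2_cases => e /=; rewrite !expr1; ring.
have nz : 1 + sqn y != 0 by rewrite gt_eqF// ltr_pwDl.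
have dv : is_derive (1 + sqn y) 1 (fun t : R => t^-1) (- (1 + sqn y) ^- 2).
  apply: (is_derive_ext (@is_deriveV R id (1 + sqn y) 1 1 nz (is_derive_id _ _))) => //.
  by rewrite -[LHS]/(- (1 + sqn y) ^- 2 * 1) mulr1.
apply: (is_derive_ext (@is_derive_chain R _ (fun z => 1 + sqn z) (fun t => t^-1) y (basisv R i) _ _ dv dn)) => //.
by rewrite /qf exprVn; ring.
Qed.

Lemma Hc_qf k : Hc k alpha qf.
Proof.
elim: k => [|k ih].
  apply: loclip_holder => r; exists (`|2 * r| + `|2 * r|); apply: (pderiv_lip pderiv_qf) => i y yr.
  rewrite normrM -[leRHS]mulr1; apply: ler_pM => //.
    rewrite !normrM normrN ler_pM2l ?normr_gt0//.
    by apply: le_trans (coord_norm _ _) (le_trans yr (ler_norm _)).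
  by rewrite normrX exprn_ile1// ger0_norm ?qf_le1// ltW// qf_gt0.
apply: (HcSP pderiv_qf) => i.
rewrite (_ : (fun y => _) = fun y => (-2 * y i 0) * (qf y * qf y)).
  by apply: HcM; [apply/HcZ/Hc_coord|exact: HcM].
by apply/funext => y; rewrite expr2.
Qed.

End Plane.

(** * Series of functions *)

Section PowerSums.
Variable R : realType.

Lemma powR_natE (n : nat) (s : R) : n.+1%:R `^ s = expR (s * ln n.+1%:R).
Proof. by rewrite /powR pnatr_eq0. Qed.

Lemma ln_succ_ge (m : nat) : (m.+2%:R)^-1 <= ln m.+2%:R - ln m.+1%:R :> R.
Proof.
have p1 : 0 < m.+1%:R :> R by rewrite ltr0n.
have p2 : 0 < m.+2%:R :> R by rewrite ltr0n.
have := @expR_ge1Dx R (ln m.+1%:R - ln m.+2%:R).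
rewrite expRD expRN !lnK ?posrE//.
have -> : m.+1%:R / m.+2%:R = 1 - m.+2%:R^-1 :> R.
  have -> : m.+1%:R = m.+2%:R - 1 :> R by rewrite -[m.+2%:R]natr1 addrK.
  by rewrite mulrBl divff ?gt_eqF// mul1r.
by move: (m.+2%:R^-1) (ln _) (ln _) => a b c; lra.
Qed.

(** Telescoping against a power: (m + 1)^(- s) - (m + 2)^(- s) >= s (m + 2)^(- 1 - s), because ln (m
    + 2) - ln (m + 1) >= 1 / (m + 2). Passing from m + 2 back to m + 1 costs 2^(1 + s). *)
Lemma sum_tail (s : R) : 0 < s -> exists2 A : R, 0 <= A & forall N k : nat,
  \sum_(m < k) (N + m).+1%:R `^ (- 1 - s) <= A * N.+1%:R `^ (- s).
Proof.
move=> s0; pose c : R := 2 `^ (1 + s) / s.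
have c0 : 0 <= c by rewrite divr_ge0 ?powR_ge0 ?ltW.
exists c => // N k.
have step (m : nat) : m.+1%:R `^ (- 1 - s) <= c * (m.+1%:R `^ (- s) - m.+2%:R `^ (- s)).
  have h1 : s * m.+2%:R `^ (- 1 - s) <= m.+1%:R `^ (- s) - m.+2%:R `^ (- s).
    have -> : m.+1%:R `^ (- s) = m.+2%:R `^ (- s) * expR (s * (ln m.+2%:R - ln m.+1%:R)).
      by rewrite !powR_natE -expRD; congr expR; ring.
    have -> : m.+2%:R `^ (- 1 - s) = m.+2%:R `^ (- s) * m.+2%:R^-1 :> R.
      rewrite addrC powRD; last by rewrite pnatr_eq0 implybT.
      by rewrite powR_inv1.
    have l := ln_succ_ge m.
    have e := expR_ge1Dx (s * (ln m.+2%:R - ln m.+1%:R)).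
    have sl : s * m.+2%:R^-1 <= s * (ln m.+2%:R - ln m.+1%:R) by rewrite ler_pM2l.
    have p0 : 0 <= m.+2%:R `^ (- s) :> R by exact: powR_ge0.
    rewrite mulrCA -[X in _ <= _ - X]mulr1 -mulrBr ler_wpM2l//.
    by move: (expR _) (m.+2%:R^-1) e sl => a b; lra.
  have h2 : m.+1%:R `^ (- 1 - s) <= 2 `^ (1 + s) * m.+2%:R `^ (- 1 - s) :> R.
    have -> : - 1 - s = - (1 + s) by ring.
    have p1 : 0 < m.+1%:R `^ (1 + s) :> R by rewrite powR_gt0.
    have p2 : 0 < m.+2%:R `^ (1 + s) :> R by rewrite powR_gt0.
    rewrite !powRN ler_pdivlMr// mulrC ler_pdivrMr//.
    rewrite -powRM; [|exact: ler0n|exact: ler0n]; apply: ge0_ler_powR; rewrite ?nnegrE.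
    - by rewrite addr_ge0 ?(ltW s0).
    - exact: ler0n.
    - by rewrite -natrM ler0n.
    - by rewrite -natrM ler_nat; lia.
  apply: le_trans h2 _; rewrite /c -mulrA ler_wpM2l ?powR_ge0//.
  by rewrite mulrC ler_pdivlMr// mulrC.
apply: (@le_trans _ _ (c * (N.+1%:R `^ (- s) - (N + k).+1%:R `^ (- s)))); last first.
  by rewrite ler_wpM2l// gerBl powR_ge0.
elim: k => [|k ih]; first by rewrite big_ord0 addn0 subrr mulr0.
rewrite big_ord_recr /= addnS; apply: le_trans (lerD ih (step _)) _.
by rewrite -mulrDr addrA subrK.
Qed.

Lemma sum_grow (s : R) : 0 < s -> s < 1 -> exists2 A : R, 0 <= A & forall N : nat,
  \sum_(m < N) m.+1%:R `^ (s - 1) <= A * N%:R `^ s.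
Proof.
move=> s0 s1; exists (2 / s) => [|N]; first by rewrite divr_ge0// ltW.
elim: N => [|N ih]; first by rewrite big_ord0 mulr_ge0 ?powR_ge0 ?divr_ge0// ltW.
rewrite big_ord_recr /=.
suff h : s / 2 * N.+1%:R `^ (s - 1) <= N.+1%:R `^ s - N%:R `^ s.
  have : N.+1%:R `^ (s - 1) <= 2 / s * (N.+1%:R `^ s - N%:R `^ s).
    have -> : N.+1%:R `^ (s - 1) = 2 / s * (s / 2 * N.+1%:R `^ (s - 1)).
      by move: (_ `^ _) => a; field; rewrite gt_eqF.
    by rewrite ler_wpM2l// divr_ge0// ltW.
  by move: ih; move: (_ `^ (s - 1)) (N.+1%:R `^ s) (N%:R `^ s) (\sum_(_ < _) _) => a b c d; lra.
have -> : N.+1%:R `^ (s - 1) = N.+1%:R `^ s * N.+1%:R^-1 :> R.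
  rewrite powRD; last by rewrite pnatr_eq0 implybT.
  by rewrite powR_inv1.
have p0 : 0 <= N.+1%:R `^ s :> R by exact: powR_ge0.
have i1 : N.+1%:R^-1 <= 1 :> R by rewrite invf_le1 ?ltr0n// ler1n.
have i0 : 0 <= N.+1%:R^-1 :> R by rewrite invr_ge0.
case: N ih p0 i1 i0 => [|N] ih p0 i1 i0.
  rewrite powR0 ?gt_eqF// powR1 invr1 !mulr1 subr0; lra.
have -> : N.+1%:R `^ s = N.+2%:R `^ s * expR (- (s * (ln N.+2%:R - ln N.+1%:R))) :> R.
  by rewrite !powR_natE -expRD; congr expR; ring.
have l := ln_succ_ge N.
have e1 : expR (- (s * (ln N.+2%:R - ln N.+1%:R))) <= expR (- (s / N.+2%:R)) :> R.
  by rewrite ler_expR lerN2 ler_pM2l.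
have sN : 0 <= s / N.+2%:R <= 1 by rewrite mulr_ge0//= ?mulr_ile1// ltW.
have e2 : expR (- (s / N.+2%:R)) <= 1 - s / N.+2%:R / 2 :> R.
  move: (s / N.+2%:R) sN => x /andP[x0 x1].
  have x2 : - x < 1 by lra.
  apply: le_trans (expR_le_inv x2) _; rewrite opprK -[leLHS]div1r ler_pdivrMr ?ltr_pwDl//.
  by nra.
rewrite mulrCA -[X in _ <= X - _]mulr1 -mulrBr ler_wpM2l//.
rewrite mulrAC; move: (le_trans e1 e2).
by move: (expR _) (s / N.+2%:R) => a x; lra.
Qed.

End PowerSums.

(** * Termwise differentiation and Hoelder continuity of sums *)

Section Series.
Variable R : realType.
Local Notation V2 := 'cV[R]_2.
Implicit Types (g : nat -> V2 -> R) (F : V2 -> R) (s : R).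

Definition rate g s := forall r : R, exists2 C : R, 0 <= C & forall m y,
  `|y| <= r -> `|g m y| <= C * m.+1%:R `^ s.

Definition sumto g F := forall r : R, exists T : nat -> R,
  (forall e : R, 0 < e -> exists N0 : nat, forall N, (N0 <= N)%N -> T N <= e) /\
  forall N y, `|y| <= r -> `|F y - \sum_(m < N) g m y| <= T N.

Definition serlim g y : R := ulim (fun N => \sum_(m < N) g m y).

Lemma powRN_small (A s e : R) : 0 < s -> 0 <= A -> 0 < e ->
  exists N0 : nat, forall N, (N0 <= N)%N -> A * N.+1%:R `^ (- s) <= e.
Proof.
move=> s0 A0 e0; have d0 : 0 < (A + 1) / e by rewrite divr_gt0// ltr_wpDl.
have [N0 hN0] := natr_ge (((A + 1) / e) `^ s^-1); exists N0 => N NN.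
have p : 0 < N.+1%:R `^ s :> R by rewrite powR_gt0.
rewrite powRN ler_pdivrMr// mulrC -ler_pdivrMr//.
apply: (@le_trans _ _ ((A + 1) / e)).
  by rewrite ler_pM2r ?invr_gt0// lerDl.
have -> : (A + 1) / e = (((A + 1) / e) `^ s^-1) `^ s.
  by rewrite -powRrM mulVf ?gt_eqF// powRr1// ltW.
by apply: ge0_ler_powR; rewrite ?nnegrE ?powR_ge0 ?(ltW s0)// hN0.
Qed.

Lemma rate_sumN g s (r C : R) : 0 < s -> 0 <= C ->
  (forall m y, `|y| <= r -> `|g m y| <= C * m.+1%:R `^ (- 1 - s)) ->
  exists2 B : R, 0 <= B & forall N k y, `|y| <= r ->
    `|\sum_(m < k) g (N + m)%N y| <= B * N.+1%:R `^ (- s).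
Proof.
move=> s0 C0 h; have [A A0 hA] := sum_tail s0; exists (C * A); first exact: mulr_ge0.
move=> N k y yr; apply: le_trans (ler_norm_sum _ _ _) _.
rewrite -mulrA; apply: le_trans (ler_wpM2l C0 (hA N k)); rewrite mulr_sumr.
by apply: ler_sum => m _; exact: h.
Qed.

Lemma sum_split g N k y :
  \sum_(m < N + k) g m y = \sum_(m < N) g m y + \sum_(m < k) g (N + m)%N y.
Proof. by rewrite big_split_ord. Qed.

Lemma rate_serlim g s (r C : R) : 0 < s -> 0 <= C ->
  (forall m y, `|y| <= r -> `|g m y| <= C * m.+1%:R `^ (- 1 - s)) ->
  exists2 B : R, 0 <= B & forall N y, `|y| <= r ->
    `|serlim g y - \sum_(m < N) g m y| <= B * N.+1%:R `^ (- s).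
Proof.
move=> s0 C0 h; have [B B0 hB] := rate_sumN s0 C0 h; exists B => // N y yr.
have bd k : `|\sum_(m < k) g m y| <= B.
  by have := hB 0 k y yr; rewrite powR1 mulr1.
have c := ulim_cvg bd.
have c2 : `|\sum_(m < k) g m y - \sum_(m < N) g m y| @[k --> ufilter]
    --> `|serlim g y - \sum_(m < N) g m y|.
  by apply: cvg_norm; apply: cvgB => //; exact: cvg_cst.
apply: (cvgr_to_le c2); apply: ufilter_oo; exists N => // k /= Nk.
by rewrite -(subnKC Nk) sum_split addrAC subrr add0r; exact: hB.
Qed.

Lemma rate_sumto g s : 0 < s -> rate g (- 1 - s) -> sumto g (serlim g).
Proof.
move=> s0 h r; have [C C0 hC] := h r; have [B B0 hB] := rate_serlim s0 C0 hC.
by exists (fun N => B * N.+1%:R `^ (- s)); split => // e e0; exact: powRN_small.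
Qed.

Lemma pderiv_sum g (g1 : nat -> 'I_2 -> V2 -> R) N : (forall m, pderiv (g m) (g1 m)) ->
  pderiv (fun y => \sum_(m < N) g m y) (fun i y => \sum_(m < N) g1 m i y).
Proof. by move=> h i y; apply: is_derive_sumr => m; exact: h. Qed.

(** A uniform bound on the tail of F says nothing about its difference quotients. The mean value
    theorem on a finite piece of the tail does, and that piece is taken so long that the rest is
    negligible for the given increment h. *)
Lemma sumto_pderiv g (g1 : nat -> 'I_2 -> V2 -> R) F s : 0 < s -> (forall m, pderiv (g m) (g1 m)) -> sumto g F ->
  (forall i, rate (fun m => g1 m i) (- 1 - s)) ->
  pderiv F (fun i => serlim (fun m => g1 m i)).
Proof.
move=> s0 dg gF hg i y; apply/is_derive_eps => e e0.
pose r := `|y| + 1; have [C C0 hC] := hg i r.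
have [B B0 hB] := rate_serlim s0 C0 hC; have [B' B'0 hB'] := rate_sumN s0 C0 hC.
have e3 : 0 < e / 3 by rewrite divr_gt0.
have [N0 hN0] := powRN_small s0 B0 e3; have [N1 hN1] := powRN_small s0 B'0 e3.
pose N := maxn N0 N1.
have bN : B * N.+1%:R `^ (- s) <= e / 3 by apply: hN0; exact: leq_maxl.
have bN' : B' * N.+1%:R `^ (- s) <= e / 3 by apply: hN1; exact: leq_maxr.
have /is_derive_eps /(_ _ e3)[d d0 hd] := pderiv_sum N dg i y.
exists (Num.min d 1) => [|h]; first by rewrite lt_min d0 ltr01.
rewrite lt_min => /andP[hlt h1].
have yr : `|y| <= r by rewrite lerDl.
have br t : `|t| <= 1 -> `|y + t *: basisv R i| <= r.
  move=> t1; apply: le_trans (ler_normD _ _) _; rewrite lerD2l normrZ.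
  apply: (@le_trans _ _ (`|t| * 1)); last by rewrite mulr1.
  rewrite ler_wpM2l//; apply/normV2_le; split=> // j; rewrite basisvE.
  by case: eqP; rewrite ?normr1 ?normr0.
have yhr : `|y + h *: basisv R i| <= r by apply: br; exact: ltW.
pose S M z := \sum_(m < M) g m z.
have tail : `|(F (y + h *: basisv R i) - S N (y + h *: basisv R i)) - (F y - S N y)| <= e / 3 * `|h|.
  apply/ler_addgt0Pr => c c0.
  have [T [Ts hT]] := gF r.
  have [M hM] := Ts _ (divr_gt0 c0 (ltr0Sn R 1)).
  pose k := M; have TM : T (N + k)%N <= c / 2 by apply: hM; exact: leq_addl.
  have h2 := le_trans (hT (N + k)%N _ yhr) TM; have h3 := le_trans (hT (N + k)%N _ yr) TM.
  have [t t01 ht] := @mvt_line R _ (fun z => \sum_(m < k) g (N + m)%N z)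
     (fun z => \sum_(m < k) g1 (N + m)%N i z) y (basisv R i) h
     (fun t => pderiv_sum k (fun m => dg (N + m)%N) i _).
  have tr : `|y + (t * h) *: basisv R i| <= r.
    apply: br; rewrite normrM mulr_ile1 ?(ltW h1)//; case/andP: t01 => t0 t1.
    by rewrite ger0_norm.
  have h4 : `|\sum_(m < k) g (N + m)%N (y + h *: basisv R i) - \sum_(m < k) g (N + m)%N y|
      <= e / 3 * `|h|.
    rewrite ht normrM ler_wpM2r//.
    by apply: le_trans (hB' N k _ tr) bN'.
  rewrite !sum_split in h2 h3; rewrite -/(S N _) -/(S N _) in h2 h3.
  set a := F _ in h2 *; set b := S N _ in h2 *; set u := \sum_(m < k) _ in h2 h4 *.
  set a' := F _ in h3 *; set b' := S N _ in h3 *; set u' := \sum_(m < k) _ in h3 h4 *.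
  have -> : a - b - (a' - b') = (a - (b + u)) - (a' - (b' + u')) + (u - u') by ring.
  apply: le_trans (ler_normD _ _) _; rewrite addrC; apply: lerD => //.
  apply: le_trans (ler_normB _ _) _; apply: le_trans (lerD h2 h3) _; lra.
have h5 := hd _ hlt; have h6 := le_trans (hB N _ yr) bN.
rewrite -/(S N _) -/(S N _) in h5.
set a := F _ in tail *; set b := S N _ in h5 tail *; set a' := F _ in tail *; set b' := S N y in h5 tail *.
set G := serlim _ _ in h6 *; set g' := \sum_(m < N) _ in h5 h6 *.
have -> : a - a' - G * h = (a - b - (a' - b')) + (b - b' - g' * h) - (G - g') * h by ring.
apply: le_trans (ler_normB _ _) _; apply: le_trans (lerD (ler_normD _ _) (lexx _)) _.
rewrite [X in _ + X]normrM.
have h7 : `|G - g'| * `|h| <= e / 3 * `|h| by rewrite ler_wpM2r.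
apply: le_trans (lerD (lerD tail h5) h7) _.
by rewrite le_eqVlt; apply/orP; left; apply/eqP; field.
Qed.

Variable alpha : R.
Hypothesis a0 : 0 < alpha.
Hypothesis a1 : alpha < 1.

(* Small frequencies are controlled by the derivatives g1, large ones by the
   size of g; the cut is at N ~ |y - z| ^ -2. *)
Lemma serlim_locholder g (g1 : nat -> 'I_2 -> V2 -> R) : (forall m, pderiv (g m) (g1 m)) ->
  rate g (- 1 - alpha / 2) -> (forall i, rate (fun m => g1 m i) (- (1 / 2) - alpha / 2)) ->
  locholder alpha (serlim g).
Proof.
move=> dg hg hg1 r; have s0 : 0 < alpha / 2 by rewrite divr_gt0.
have [C C0 hC] := hg r; have [B B0 hB] := rate_serlim s0 C0 hC.
have [D0 D00 hD0] := hg1 0 r; have [D1 D10 hD1] := hg1 1 r.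
pose D := Num.max D0 D1.
have D0' : 0 <= D by rewrite le_max D00.
pose s' : R := (1 - alpha) / 2.
have s'0 : 0 < s' by rewrite divr_gt0// subr_gt0.
have s'1 : s' < 1 by rewrite /s'; lra.
have [A A0 hA] := sum_grow s'0 s'1.
exists ((D + D) * A + B + B) => y z yr zr.
have [->|yz] := eqVneq y z; first by rewrite !subrr !normr0 powR0 ?gt_eqF// mulr0.
set d := `|y - z|; have d0 : 0 < d by rewrite normr_gt0 subr_eq0.
have ed2 : d ^- 2 = d `^ (-2) by rewrite powRN powR_mulrn// ltW.
have x0 : 0 <= d ^- 2 by rewrite invr_ge0 sqr_ge0.
have /andP[n1 n2] := truncn_itv x0; set N := Num.truncn _ in n1 n2.
have h1 : B * N.+1%:R `^ (- (alpha / 2)) <= B * d `^ alpha.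
  rewrite ler_wpM2l// powRN -[leRHS]invrK lef_pV2 ?posrE ?invr_gt0 ?powR_gt0 ?ltr0n//.
  have -> : (d `^ alpha)^-1 = (d ^- 2) `^ (alpha / 2).
    by rewrite -powRN ed2 -powRrM; congr (_ `^ _); field.
  by apply: ge0_ler_powR; rewrite ?nnegrE ?(ltW s0)// ltW.
have h2 : `|\sum_(m < N) g m y - \sum_(m < N) g m z| <= (D + D) * A * d `^ alpha.
  have step (m : nat) : `|g m y - g m z| <= (D + D) * m.+1%:R `^ (s' - 1) * d.
    have e : s' - 1 = - (1 / 2) - alpha / 2 by rewrite /s'; field.
    rewrite e.
    apply: le_trans (@pderiv_lip R (g m) (g1 m) r (D * m.+1%:R `^ (- (1 / 2) - alpha / 2)) (dg m) _ y z yr zr) _.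
      apply: ord2_cases => x xr.
        apply: le_trans (hD0 m x xr) _; rewrite ler_wpM2r ?powR_ge0// le_max lexx//.
      by apply: le_trans (hD1 m x xr) _; rewrite ler_wpM2r ?powR_ge0// le_max lexx orbT.
    by rewrite -mulrDl.
  rewrite -sumrB; apply: le_trans (ler_norm_sum _ _ _) _.
  apply: (@le_trans _ _ (\sum_(m < N) (D + D) * m.+1%:R `^ (s' - 1) * d)); first by apply: ler_sum => m _; exact: step.
  rewrite -mulr_suml -mulr_sumr -!mulrA ler_wpM2l ?addr_ge0//.
  apply: (@le_trans _ _ (A * N%:R `^ s' * d)); first by rewrite ler_wpM2r ?(ltW d0)// hA.
  rewrite -mulrA ler_wpM2l//.
  have -> : d `^ alpha = (d ^- 2) `^ s' * d.
    rewrite ed2 -powRrM -[X in _ * X](powRr1 (ltW d0)) -powRD.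
      by congr (_ `^ _); rewrite /s'; field.
    by rewrite (gt_eqF d0) implybT.
  rewrite ler_wpM2r ?(ltW d0)//; apply: ge0_ler_powR; rewrite ?nnegrE ?(ltW s'0)//.
have h3 := le_trans (hB N y yr) h1; have h4 := le_trans (hB N z zr) h1.
set u := serlim g y in h3 *; set v := serlim g z in h4 *.
set a := \sum_(m < N) _ in h3 h2; set b := \sum_(m < N) _ in h4 h2.
have -> : u - v = (a - b) + (u - a) - (v - b) by ring.
apply: le_trans (ler_normB _ _) _; apply: le_trans (lerD (ler_normD _ _) (lexx _)) _.
apply: le_trans (lerD (lerD h2 h3) h4) _.
by rewrite le_eqVlt; apply/orP; left; apply/eqP; ring.
Qed.

End Series.

(** * Charts *)

Section ChartGeometry.
Variable R : realType.
Local Notation V2 := 'cV[R]_2.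
Local Notation V3 := 'cV[R]_3.
Local Notation S := (@sphere R).
Implicit Types (b : bool) (y z : V2).

Definition csgn b : R := (-1) ^+ b.

Lemma csgnK b : csgn b * csgn b = 1.
Proof. by rewrite /csgn -expr2 sqrr_sign. Qed.

Lemma ord3_cases (P : 'I_3 -> Prop) : P 0 -> P 1 -> P (2%:R) -> forall i, P i.
Proof.
move=> P0 P1 P2 [[|[|[|//]]] p].
- by rewrite (_ : Ordinal p = 0)//; exact: val_inj.
- by rewrite (_ : Ordinal p = 1)//; exact: val_inj.
- by rewrite (_ : Ordinal p = 2%:R)//; exact: val_inj.
Qed.

Lemma cV3P (x x' : V3) : x 0 0 = x' 0 0 -> x 1 0 = x' 1 0 ->
  x (2%:R) 0 = x' (2%:R) 0 -> x = x'.
Proof.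
move=> e0 e1 e2; apply/matrixP => i j; rewrite (ord1 j); move: i.
by apply: ord3_cases.
Qed.

Lemma chartE b y : chart b y
  = mkv3 (2 * y 0 0 * qf y) (2 * y 1 0 * qf y) (csgn b * (sqn y - 1) * qf y).
Proof.
rewrite /chart /inv_stereo.
set w := y 0 0 *: _ + _.
have w0 : w 0 0 = y 0 0 by rewrite !mxE /=; ring.
have w1 : w 1 0 = y 1 0 by rewrite !mxE /=; ring.
have w2 : w (2%:R) 0 = 0 by rewrite !mxE /=; ring.
have -> : dotv w w = sqn y by rewrite dotvE w0 w1 w2 /sqn; ring.
have -> : (sqn y + 1)^-1 = qf y by rewrite addrC.
have e j : (qf y *: (2 *: w + (sqn y - 1) *: ((-1) ^+ b *: basisv R 2))) j 0
    = qf y * (2 * w j 0 + (sqn y - 1) * (csgn b * (j == 2%:R)%:R)).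
  by move: w {w0 w1 w2} => w; rewrite !mxE eqxx andbT.
by apply: cV3P; rewrite !mkv3E e ?w0 ?w1 ?w2 /=; ring.
Qed.

Lemma qfK y : (1 + sqn y) * qf y = 1.
Proof. by rewrite divff// gt_eqF// ltr_pwDl// sqn_ge0. Qed.

Lemma sqn_qf y : sqn y * qf y = 1 - qf y.
Proof. by have := qfK y; rewrite mulrDl mul1r => <-; rewrite addrC addKr. Qed.

Lemma chart2E b y : chart b y (2%:R) 0 = csgn b * (1 - 2 * qf y).
Proof. by rewrite chartE mkv3E -mulrA mulrBl sqn_qf; congr (_ * _); ring. Qed.

Lemma chart_sphere b y : S (chart b y).
Proof.
rewrite /sphere /= dotvE !chart2E chartE !mkv3E.
have -> : csgn b * (1 - 2 * qf y) * (csgn b * (1 - 2 * qf y))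
    = (csgn b * csgn b) * (1 - 2 * qf y) ^+ 2 by ring.
rewrite csgnK; have := sqn_qf y; rewrite /sqn; move: (qf y) => q h.
transitivity (4 * ((y 0 0 ^+ 2 + y 1 0 ^+ 2) * q) * q + (1 - 2 * q) ^+ 2); first by ring.
by rewrite h; ring.
Qed.

(** The chordal distance in stereographic coordinates: the bridge between Hoelder bounds in a chart
    and powers of 1 - tau. *)
Lemma chart_tau b y z :
  1 - tau (chart b y) (chart b z) = sqn (y - z) * qf y * qf z.
Proof.
rewrite /tau dotvE !chart2E !chartE !mkv3E.
have -> : csgn b * (1 - 2 * qf y) * (csgn b * (1 - 2 * qf z))
    = (csgn b * csgn b) * ((1 - 2 * qf y) * (1 - 2 * qf z)) by ring.
rewrite csgnK; have := sqn_qf y; have := sqn_qf z; rewrite /sqn !mxE.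
move: (qf y) (qf z) => p q hq hp.
transitivity (((y 0 0 ^+ 2 + y 1 0 ^+ 2) * p) * q + ((z 0 0 ^+ 2 + z 1 0 ^+ 2) * q) * p
  - 2 * (y 0 0 * z 0 0 + y 1 0 * z 1 0) * p * q); last by ring.
by rewrite hp hq; field.
Qed.

Definition proj b (x : V3) : V2 :=
  \col_i (x (inord i) 0 / (1 - csgn b * x (2%:R) 0)).

Lemma projE b (x : V3) : (proj b x 0 0 = x 0 0 / (1 - csgn b * x (2%:R) 0)) *
  (proj b x 1 0 = x 1 0 / (1 - csgn b * x (2%:R) 0)).
Proof.
by split; rewrite mxE; congr (x _ _ / _); apply: val_inj; rewrite /= inordK.
Qed.

Lemma chart_proj b (x : V3) : S x -> csgn b * x (2%:R) 0 != 1 -> chart b (proj b x) = x.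
Proof.
move=> Sx n1; set s := csgn b; have ss : s * s = 1 by exact: csgnK.
set d := 1 - s * x (2%:R) 0; have d0 : d != 0 by rewrite subr_eq0 eq_sym.
have e1 : x 0 0 ^+ 2 + x 1 0 ^+ 2 = 1 - x (2%:R) 0 ^+ 2.
  by move: Sx; rewrite /sphere /= dotvE => <-; ring.
have sx : (s * x (2%:R) 0) ^+ 2 = x (2%:R) 0 ^+ 2 by rewrite exprMn expr2 ss mul1r.
have d2 : 1 - x (2%:R) 0 ^+ 2 = d * (2 - d) by rewrite -sx /d; ring.
have sq : 1 + sqn (proj b x) = 2 / d.
  rewrite /sqn !projE -/s -/d.
  have -> : 1 + ((x 0 0 / d) ^+ 2 + (x 1 0 / d) ^+ 2) = 1 + (x 0 0 ^+ 2 + x 1 0 ^+ 2) / d ^+ 2.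
    by field.
  by rewrite e1 d2; field.
have qe : qf (proj b x) = d / 2 by rewrite /qf sq invf_div.
apply: cV3P; rewrite ?chart2E ?chartE ?mkv3E ?projE qe -/s -/d.
- by field.
- by field.
- have -> : s * (1 - 2 * (d / 2)) = s * (1 - d) by field.
  by rewrite /d opprB addrC subrK mulrA ss mul1r.
Qed.

Lemma proj_chart b y : proj b (chart b y) = y.
Proof.
have q0 : qf y != 0 by rewrite gt_eqF// qf_gt0.
apply/matrixP => i j; rewrite (ord1 j); move: i.
have e : 1 - csgn b * chart b y (2%:R) 0 = 2 * qf y by rewrite chart2E mulrA csgnK; ring.
by apply: ord2_cases; rewrite projE e chartE !mkv3E; field.
Qed.

Lemma chart_cover b (x : V3) (c : R) : 0 < c -> S x -> csgn b * x (2%:R) 0 <= 1 - c ->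
  exists2 y, chart b y = x & `|y| <= c^-1.
Proof.
move=> c0 Sx h; exists (proj b x).
  by apply: chart_proj => //; rewrite lt_eqF//; apply: le_lt_trans h _; rewrite gtrBl.
apply/normV2_le; split; first by rewrite invr_ge0 ltW.
have d0 : 0 < 1 - csgn b * x (2%:R) 0 by move: h c0; lra.
have main j : `|x j 0 / (1 - csgn b * x (2%:R) 0)| <= c^-1.
  rewrite normrM [X in _ * X]gtr0_norm ?invr_gt0//.
  rewrite -[leRHS]mul1r; apply: ler_pM; rewrite ?invr_ge0 ?(ltW d0)//.
    exact: sphere_coord.
  by rewrite lef_pV2 ?posrE//; move: h; lra.
by apply: ord2_cases; rewrite projE; exact: main.
Qed.

Lemma chart_total (x : V3) : S x -> exists b, csgn b * x (2%:R) 0 <= 1 - 1 / 2.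
Proof.
move=> Sx; have [h|h] := leP (x (2%:R) 0) 0.
  by exists false; rewrite /csgn expr0; lra.
by exists true; rewrite /csgn expr1; lra.
Qed.

Lemma chart_surj (x : V3) : S x -> exists b y, chart b y = x /\ `|y| <= 2.
Proof.
move=> Sx; have [b hb] := chart_total Sx.
have c0 : 0 < 1 / 2 :> R by lra.
have [y <- hy] := chart_cover c0 Sx hb; exists b, y; split => //.
by move: hy; rewrite invf_div divr1.
Qed.

Lemma sqn_le y (r : R) : `|y| <= r -> sqn y <= 2 * r ^+ 2.
Proof.
move=> /normV2_le[r0 h]; have h0 := h 0; have h1 := h 1.
rewrite /sqn -(real_normK (num_real (y 0 0))) -(real_normK (num_real (y 1 0))).
have e i : `|y i 0| <= r -> `|y i 0| ^+ 2 <= r ^+ 2 by move=> ?; rewrite lerXn2r ?nnegrE.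
by have := e _ h0; have := e _ h1; lra.
Qed.

Lemma norm_sqn y : `|y| ^+ 2 <= sqn y.
Proof.
have e i : `|y i 0| <= Num.sqrt (sqn y).
  rewrite -sqrtr_sqr ler_wsqrtr// /sqn; move: i.
  by apply: ord2_cases; rewrite ?lerDl ?lerDr sqr_ge0.
have h : `|y| <= Num.sqrt (sqn y) by apply/normV2_le; split => //; exact: sqrtr_ge0.
by rewrite -[leRHS]sqr_sqrtr ?sqn_ge0// lerXn2r ?nnegrE ?sqrtr_ge0.
Qed.

End ChartGeometry.

(** * Hoelder continuity on the sphere and in the charts *)

Section SphereHolder.
Variable R : realType.
Local Notation V2 := 'cV[R]_2.
Local Notation V3 := 'cV[R]_3.
Local Notation S := (@sphere R).
Variable alpha : R.
Hypothesis a0 : 0 < alpha.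
Hypothesis a1 : alpha <= 1.
Implicit Types (f : V3 -> R) (b : bool).

(** The exponent is alpha / 2 since 1 - tau is a quarter of the squared chordal distance. *)
Definition sholder f := exists2 C : R, 0 <= C & forall x y, S x -> S y ->
  `|f x - f y| <= C * (1 - tau x y) `^ (alpha / 2).

Let h0 : 0 < alpha / 2. Proof. by rewrite divr_gt0. Qed.

Lemma sqr_powR_half (d : R) : 0 <= d -> (d ^+ 2) `^ (alpha / 2) = d `^ alpha.
Proof.
move=> d0; rewrite -powR_mulrn// -powRrM; congr (_ `^ _).
by rewrite mulrC divfK.
Qed.

Lemma chart_dist_bound b (y z : V2) (r : R) : 0 <= r -> `|y| <= r -> `|z| <= r ->
  `|y - z| <= (1 + 2 * r ^+ 2) * Num.sqrt (1 - tau (chart b y) (chart b z)).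
Proof.
move=> r0 yr zr; have c0 : 0 <= 1 + 2 * r ^+ 2 by rewrite addr_ge0// mulr_ge0// sqr_ge0.
rewrite -[X in _ <= X * _](ger0_norm c0) -sqrtr_sqr.
rewrite -sqrtrM ?sqr_ge0// -[leLHS]normr_id -sqrtr_sqr ler_wsqrtr//.
apply: le_trans (norm_sqn _) _; rewrite chart_tau.
have hq (w : V2) : `|w| <= r -> 1 <= (1 + 2 * r ^+ 2) * qf w.
  move=> wr; rewrite -[leLHS](qfK w); apply: ler_wpM2r; first exact: ltW (qf_gt0 _).
  by rewrite lerD2l; exact: sqn_le.
have h : 1 <= ((1 + 2 * r ^+ 2) * qf y) * ((1 + 2 * r ^+ 2) * qf z).
  by rewrite -[leLHS]mulr1; apply: ler_pM => //; exact: hq.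
have := ler_wpM2l (sqn_ge0 (y - z)) h; rewrite mulr1 => /le_trans; apply.
by rewrite le_eqVlt; apply/orP; left; apply/eqP; ring.
Qed.

Lemma charts_bounded f : (forall b, locbounded (f \o @chart R b)) -> bounded_on S f.
Proof.
move=> h; have [M hM] := h false 2; have [N hN] := h true 2.
exists (Num.max M N) => x Sx; have [b [y [<- y2]]] := chart_surj Sx.
by rewrite le_max; case: b; rewrite ?(hM _ y2) ?(hN _ y2) ?orbT.
Qed.

(** Either both points lie in the ball of radius 4 of one chart, or their heights differ by at least
    1 / 4; then 64 (1 - tau) >= 1 and the sup bound suffices. The constant 33 is 1 + 2 r^2 at r =
    4. *)
Lemma locholder_sholder f : (forall b, locholder alpha (f \o @chart R b)) -> sholder f.
Proof.
move=> h; have [M M0 hM] := bounded_onP (charts_bounded (fun b => locholder_bounded a0 (h b))).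
have [C0 C00 hC0] := locholderP (h false) 4; have [C1 C10 hC1] := locholderP (h true) 4.
pose C := C0 + C1; have C0' : 0 <= C by rewrite addr_ge0.
have hC b y z : `|y| <= 4 -> `|z| <= 4 ->
    `|f (chart b y) - f (chart b z)| <= C * `|y - z| `^ alpha.
  move=> y4 z4; case: b.
    apply: le_trans (hC1 _ _ y4 z4) _; rewrite ler_wpM2r ?powR_ge0// lerDr//.
  apply: le_trans (hC0 _ _ y4 z4) _; rewrite ler_wpM2r ?powR_ge0// lerDl//.
pose D := C * 33 `^ alpha; pose E := 2 * M * 64 `^ (alpha / 2).
have D0 : 0 <= D by rewrite mulr_ge0 ?powR_ge0.
have E0 : 0 <= E by rewrite !mulr_ge0 ?powR_ge0 ?(ltW M0).
exists (D + E) => [|x x' Sx Sx']; first exact: addr_ge0.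
have t0 : 0 <= 1 - tau x x' by rewrite subr_ge0 tau_le1.
have [b hb] := chart_total Sx; have [hb'|hb'] := leP (csgn R b * x' (2%:R) 0) (1 - 1 / 4).
  have c4 : 0 < 1 / 4 :> R by lra.
  have hb2 : csgn R b * x (2%:R) 0 <= 1 - 1 / 4 by move: hb; lra.
  have [y ey] := chart_cover c4 Sx hb2; have [z ez] := chart_cover c4 Sx' hb'.
  rewrite invf_div divr1 => z4 y4; rewrite -ey -ez in t0 *.
  apply: le_trans (hC b y z y4 z4) _.
  apply: (@le_trans _ _ (D * (1 - tau (chart b y) (chart b z)) `^ (alpha / 2))); last first.
    by rewrite ler_wpM2r ?powR_ge0// lerDl.
  rewrite /D -mulrA ler_wpM2l// -[X in X `^ (alpha / 2)]sqr_sqrtr//.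
  rewrite sqr_powR_half ?sqrtr_ge0// -powRM ?sqrtr_ge0//.
  have p4 : 0 <= 4 :> R by [].
  have := chart_dist_bound b p4 y4 z4; rewrite (_ : 1 + 2 * 4 ^+ 2 = 33 :> R); last by lra.
  by move=> hd; apply: ge0_ler_powR; rewrite ?nnegrE ?mulr_ge0 ?sqrtr_ge0 ?(ltW a0).
apply: (@le_trans _ _ (E * (1 - tau x x') `^ (alpha / 2))); last first.
  by rewrite ler_wpM2r ?powR_ge0// lerDr.
have t1 : 1 <= 64 * (1 - tau x x').
  rewrite tauE// dotvE !mxE.
  have hd : 1 / 4 <= csgn R b * (x' (2%:R) 0 - x (2%:R) 0) by rewrite mulrBr; move: hb hb'; lra.
  have hs : (1 / 4) ^+ 2 <= (x (2%:R) 0 - x' (2%:R) 0) ^+ 2.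
    rewrite (_ : (x (2%:R) 0 - x' (2%:R) 0) ^+ 2 = (csgn R b * (x' (2%:R) 0 - x (2%:R) 0)) ^+ 2).
      by rewrite lerXn2r ?nnegrE// ?(le_trans _ hd)//; lra.
    by rewrite exprMn [csgn R b ^+ 2]expr2 csgnK mul1r; ring.
  have := sqr_ge0 (x 0 0 - x' 0 0); have := sqr_ge0 (x 1 0 - x' 1 0); move: hs.
  by rewrite !expr2; lra.
apply: (@le_trans _ _ (2 * M)).
  apply: le_trans (ler_normB _ _) _; have := hM _ Sx; have := hM _ Sx'; lra.
rewrite /E -mulrA ler_peMr ?mulr_ge0 ?(ltW M0)//.
rewrite -powRM// -[leLHS](congr1 (fun F => F (alpha / 2)) (powR1 R)).
by apply: ge0_ler_powR; rewrite ?nnegrE ?(ltW h0)// mulr_ge0.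
Qed.

Lemma sholder_UC f : sholder f -> UC f.
Proof.
move=> [C C0 h] e e0.
have c1 : 0 < C + 1 by rewrite ltr_wpDl.
pose e1 := e / (C + 1); have e10 : 0 < e1 by rewrite divr_gt0.
pose d := e1 `^ (alpha / 2)^-1; have d0 : 0 < d by rewrite powR_gt0.
exists (C / d) => [|x y Sx Sy]; first by rewrite divr_ge0// ltW.
apply: le_trans (h _ _ Sx Sy) _.
have /andP[t0 t1] := tau_unit Sx Sy.
have u0 : 0 <= 1 - tau x y by rewrite subr_ge0.
have u1 : 1 - tau x y <= 1 by rewrite gerBl.
move: (1 - tau x y) u0 u1 => u u0 u1.
have [ud|/ltW du] := leP u d.
  apply: (@le_trans _ _ (C * e1)).
    rewrite ler_wpM2l// (_ : e1 = d `^ (alpha / 2)); last first.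
      by rewrite -powRrM mulVf ?gt_eqF// powRr1// ltW.
    by apply: ge0_ler_powR; rewrite ?nnegrE ?(ltW h0)// ltW.
  apply: (@le_trans _ _ e); last by rewrite lerDl !mulr_ge0 ?invr_ge0// ltW.
  rewrite /e1 mulrCA ger_pMr// ler_pdivrMr// mul1r lerDl//.
apply: (@le_trans _ _ (C * 1)).
  rewrite ler_wpM2l// -[leRHS](congr1 (fun F => F (alpha / 2)) (powR1 R)).
  by apply: ge0_ler_powR; rewrite ?nnegrE ?(ltW h0).
apply: (@le_trans _ _ (C / d * u)); last by rewrite lerDr ltW.
by rewrite -mulrA ler_wpM2l// mulrC ler_pdivlMr// mul1r.
Qed.

Lemma Hc_chart k b (j : 'I_3) : Hc k alpha (fun y : V2 => chart b y j 0).
Proof.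
move: j; apply: ord3_cases.
- rewrite (_ : (fun y => _) = fun y : V2 => 2 * y 0 0 * qf y); last first.
    by apply/funext => y; rewrite chartE mkv3E.
  by apply: HcM => //; [apply: HcZ => //; exact: Hc_coord|exact: Hc_qf].
- rewrite (_ : (fun y => _) = fun y : V2 => 2 * y 1 0 * qf y); last first.
    by apply/funext => y; rewrite chartE mkv3E.
  by apply: HcM => //; [apply: HcZ => //; exact: Hc_coord|exact: Hc_qf].
- rewrite (_ : (fun y => _) = fun y : V2 => csgn R b * (1 - 2 * qf y)); last first.
    by apply/funext => y; rewrite chart2E.
  by apply: HcZ => //; apply: HcB => //; [exact: Hc_cst|apply: HcZ => //; exact: Hc_qf].
Qed.

End SphereHolder.

(** * Hoelder regularity of L *)

Section SeparableKernels.
Variable R : realType.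
Local Notation V2 := 'cV[R]_2.
Local Notation V3 := 'cV[R]_3.
Local Notation S := (@sphere R).
Implicit Types (k : V2 -> V3 -> R) (dk : 'I_2 -> V2 -> V3 -> R).

(* A kernel that is a finite sum of products a(y) c(z), with its derivative in
   y; the finite sum makes differentiation commute with [sint]. *)
Definition sepker k dk := exists (I : finType) (a : I -> V2 -> R)
  (da : I -> 'I_2 -> V2 -> R) (c : I -> V3 -> R),
  [/\ forall t, pderiv (a t) (da t), forall t, bounded_on S (c t),
      forall y z, k y z = \sum_t a t y * c t z &
      forall i y z, dk i y z = \sum_t da t i y * c t z].

Lemma sepker_ext k dk k' dk' : sepker k dk -> (forall y z, k y z = k' y z) ->
  (forall i y z, dk i y z = dk' i y z) -> sepker k' dk'.
Proof.
move=> [I [a [da [c [ha hc hk hdk]]]]] e1 e2; exists I, a, da, c; split => //.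
  by move=> y z; rewrite -e1.
by move=> i y z; rewrite -e2.
Qed.

Lemma sepker_cst (r : R) : sepker (fun _ _ => r) (fun _ _ _ => 0).
Proof.
exists unit, (fun _ _ => r), (fun _ _ _ => 0), (fun _ _ => 1); split.
- by move=> _ i y; exact: is_derive_constr.
- by move=> _; exact: bounded_on_cst.
- by move=> y z; rewrite (big_pred1 tt) ?mulr1//; case.
- by move=> i y z; rewrite big1// => ? _; rewrite mul0r.
Qed.

Lemma sepkerD k dk k' dk' : sepker k dk -> sepker k' dk' ->
  sepker (fun y z => k y z + k' y z) (fun i y z => dk i y z + dk' i y z).
Proof.
move=> [I [a [da [c [ha hc hk hdk]]]]] [I' [a' [da' [c' [ha' hc' hk' hdk']]]]].
exists (I + I')%type, (fun t => match t with inl i => a i | inr j => a' j end),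
  (fun t => match t with inl i => da i | inr j => da' j end),
  (fun t => match t with inl i => c i | inr j => c' j end); split.
- by case.
- by case.
- by move=> y z; rewrite big_sumType /= hk hk'.
- by move=> i y z; rewrite big_sumType /= hdk hdk'.
Qed.

Lemma sepkerM k dk k' dk' : sepker k dk -> sepker k' dk' ->
  sepker (fun y z => k y z * k' y z) (fun i y z => dk i y z * k' y z + k y z * dk' i y z).
Proof.
move=> [I [a [da [c [ha hc hk hdk]]]]] [I' [a' [da' [c' [ha' hc' hk' hdk']]]]].
exists (I * I')%type, (fun t y => a t.1 y * a' t.2 y),
  (fun t i y => da t.1 i y * a' t.2 y + a t.1 y * da' t.2 i y),
  (fun t z => c t.1 z * c' t.2 z); split.
- by move=> t i y; apply: is_derive_mulr; [exact: ha|exact: ha'].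
- by move=> t; apply: bounded_onM; [exact: hc|exact: hc'].
- move=> y z; rewrite hk hk' big_distrlr pair_big /=.
  by apply: eq_bigr => t _; ring.
- move=> i y z; rewrite hk hk' hdk hdk' !big_distrlr !pair_big /= -big_split /=.
  by apply: eq_bigr => t _; ring.
Qed.

Lemma sepkerZ (r : R) k dk : sepker k dk ->
  sepker (fun y z => r * k y z) (fun i y z => r * dk i y z).
Proof.
move=> h; apply: (sepker_ext (sepkerM (sepker_cst r) h)) => // i y z.
by rewrite mul0r add0r.
Qed.

Lemma sepkerX k dk n : sepker k dk ->
  sepker (fun y z => k y z ^+ n) (fun i y z => n%:R * (k y z ^+ n.-1 * dk i y z)).
Proof.
move=> h; elim: n => [|n ih].
  apply: (sepker_ext (sepker_cst 1)) => [y z|i y z]; first by rewrite expr0.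
  by rewrite mul0r.
apply: (sepker_ext (sepkerM h ih)) => [y z|i y z]; first by rewrite exprS.
rewrite /= -[n.+1%:R]natr1; case: n {ih} => [|n] /=; first by rewrite !expr0; ring.
by move: (n.+1%:R : R) => a; rewrite exprS; ring.
Qed.

Lemma sepker_dbounded k dk i y : sepker k dk -> bounded_on S (dk i y).
Proof.
move=> [I [a [da [c [ha hc hk hdk]]]]]; rewrite (_ : dk i y = fun z => \sum_t da t i y * c t z).
  by apply: bounded_on_sum => t; apply: bounded_onZ; exact: hc.
by apply/funext => z; rewrite hdk.
Qed.

Lemma sepker_sint k dk (h : V3 -> R) : sepker k dk -> bounded_on S h ->
  pderiv (fun y => sint (fun z => k y z * h z)) (fun i y => sint (fun z => dk i y z * h z)).
Proof.
move=> [I [a [da [c [ha hc hk hdk]]]]] bh.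
have bch t : bounded_on S (fun z => c t z * h z) by apply: bounded_onM => //; exact: hc.
have e (u : I -> R) (kk : V3 -> R) : (forall z, kk z = \sum_t u t * c t z) ->
    sint (fun z => kk z * h z) = \sum_t u t * sint (fun z => c t z * h z).
  move=> ek; transitivity (sint (fun z => \sum_t u t * (c t z * h z))).
    apply: sint_ext => z _; rewrite ek mulr_suml; apply: eq_bigr => t _; ring.
  rewrite sint_sum; last by move=> t; exact: bounded_onZ.
  by apply: eq_bigr => t _; rewrite sintZ.
move=> i y; rewrite (e (fun t => da t i y)); last by move=> z; rewrite hdk.
rewrite (_ : (fun y => _) = fun y => \sum_t a t y * sint (fun z => c t z * h z)); last first.
  by apply/funext => y'; apply: e => z; rewrite hk.
apply: is_derive_sumr => t.
apply: is_derive_ext (is_derive_mulr (ha t i y) (is_derive_constr (sint (fun z => c t z * h z)) _ _)) _ _.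
  by [].
by rewrite mulr0 addr0.
Qed.

Lemma sepker_sint_cst k dk (r : R) : sepker k dk -> (forall y, sint (k y) = r) ->
  forall i y, sint (dk i y) = 0.
Proof.
move=> hk kr i y.
have e (f : V3 -> R) : sint (fun z => f z * 1) = sint f by apply: sint_ext => z _; rewrite mulr1.
have := sepker_sint hk (bounded_on_cst S 1) i y.
rewrite (_ : (fun y => _) = fun=> r) => [[_ d1]|].
  by rewrite e in d1; rewrite -d1; have [_ ->] := is_derive_constr r y (basisv R i).
by apply/funext => y'; rewrite e.
Qed.

End SeparableKernels.

Section TauKernels.
Variable R : realType.
Local Notation V2 := 'cV[R]_2.
Local Notation V3 := 'cV[R]_3.
Local Notation S := (@sphere R).
Variable b : bool.
Implicit Types (y : V2) (z : V3) (s : seq 'I_2).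

Definition Xp s (j : 'I_3) : V2 -> R := iter_partial s (fun y => chart b y j 0).

Lemma Hc_Xp alpha k s j : 0 < alpha -> alpha <= 1 -> Hc k alpha (Xp s j).
Proof.
move=> a0 a1; elim: s k => [|i s ih] k; first exact: Hc_chart.
by have [_ h] := ih k.+1; exact: h.
Qed.

Lemma pderiv_Xp s j : pderiv (Xp s j) (fun i => Xp (i :: s) j).
Proof.
by have [dX _] := @Hc_Xp 1 1 s j ltr01 (lexx _); exact: pderiv_of.
Qed.

(** For nonempty s, the iterated partial derivative of tau (chart y, z) along s; for s empty, tau -
    1 / 2. Removing that constant makes it linear in z. *)
Definition lin s y z : R := \sum_(j < 3) Xp s j y * (2^-1 * z j 0).

Lemma linE s y z : lin s y z = \sum_(j < 3) Xp s j y * (2^-1 * z j 0).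
Proof. by []. Qed.

Definition Tk y z : R := tau (chart b y) z.

Lemma TkE y z : Tk y z = 2^-1 + lin [::] y z.
Proof.
rewrite /Tk /tau mulrDl mul1r; congr (_ + _); rewrite /dotv mulr_suml.
by apply: eq_bigr => j _; rewrite mulrAC mulrA.
Qed.

Lemma sepker_lin s : sepker (lin s) (fun i => lin (i :: s)).
Proof.
exists 'I_3, (Xp s), (fun j i => Xp (i :: s) j), (fun j z => 2^-1 * z j 0); split => //.
  by move=> j; exact: pderiv_Xp.
by move=> j; apply: bounded_onZ; exists 1 => z Sz; exact: sphere_coord.
Qed.

Lemma sepker_Tk : sepker Tk (fun i => lin [:: i]).
Proof.
apply: (sepker_ext (sepkerD (sepker_cst 2^-1) (sepker_lin [::]))) => [y z|i y z].
  by rewrite TkE.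
by rewrite add0r.
Qed.

Lemma pderiv_lin s z : pderiv (lin s ^~ z) (fun i => lin (i :: s) ^~ z).
Proof.
move=> i y; apply: is_derive_sumr => j.
apply: is_derive_ext (is_derive_mulr (pderiv_Xp s j i y) (is_derive_constr (2^-1 * z j 0) _ _)) _ _.
  by [].
by rewrite mulr0 addr0.
Qed.

Lemma lin_bound s (r : R) : exists2 M : R, 0 <= M & forall y z, `|y| <= r -> S z ->
  `|lin s y z| <= M.
Proof.
have h (j : 'I_3) : exists M : R, forall y, `|y| <= r -> `|Xp s j y| <= M.
  exact: (Hc_bounded ltr01 (lexx _) (@Hc_Xp 1 0 s j ltr01 (lexx _))).
pose M (j : 'I_3) : R := `|projT1 (cid (h j))|.
exists (\sum_(j < 3) M j) => [|y z yr Sz]; first by apply: sumr_ge0 => j _; exact: normr_ge0.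
apply: le_trans (ler_norm_sum _ _ _) _; apply: ler_sum => j _; rewrite normrM.
rewrite -[leRHS]mulr1; apply: ler_pM => //.
  by rewrite /M; case: cid => M0 /= hM; apply: le_trans (hM _ yr) (ler_norm _).
rewrite normrM gtr0_norm ?invr_gt0// mulr_ile1 ?invr_ge0//; last exact: sphere_coord.
by rewrite invf_le1// ler1n.
Qed.

Definition zc (i : 'I_2) z : R := if i == 0 then z 0 0 else z 1 0.

Definition pz y z : R := y 0 0 * z 0 0 + y 1 0 * z 1 0.

Definition wz z : R := csgn R b * z (2%:R) 0.

Lemma lin0E y z : lin [::] y z = qf y * (pz y z - wz z) + wz z / 2.
Proof.
have -> : lin [::] y z = 2^-1 * dotv (chart b y) z.
  by rewrite /dotv mulr_sumr; apply: eq_bigr => j _; rewrite mulrCA.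
rewrite dotvE chart2E chartE !mkv3E /pz /wz; by field.
Qed.

Lemma pderiv_pz z : pderiv (pz ^~ z) (fun i _ => zc i z).
Proof.
move=> i y.
have d0 := is_derive_mulr (@pderiv_coord R 0 i y) (is_derive_constr (z 0 0) y (basisv R i)).
have d1 := is_derive_mulr (@pderiv_coord R 1 i y) (is_derive_constr (z 1 0) y (basisv R i)).
apply: (is_derive_ext (is_derive_addr d0 d1)) => //; rewrite /zc; move: i {d0 d1}.
by apply: ord2_cases => /=; rewrite ?eqxx /=; ring.
Qed.

Definition lin1f (i : 'I_2) y z : R := qf y * zc i z - 2 * y i 0 * (qf y ^+ 2 * (pz y z - wz z)).

Lemma lin1E i y z : lin [:: i] y z = lin1f i y z.
Proof.
have d1 := pderiv_lin [::] z i y.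
have d2 : is_derive y (basisv R i) (lin [::] ^~ z) (lin1f i y z).
  have dp := is_derive_addr (pderiv_pz z i y) (is_derive_constr (- wz z) y (basisv R i)).
  have dq := is_derive_mulr (pderiv_qf i y) dp.
  apply: (is_derive_ext (is_derive_addr dq (is_derive_constr (wz z / 2) y (basisv R i)))).
    by move=> y'; rewrite lin0E.
  by rewrite /lin1f; ring.
by have [_ <-] := d1; have [_ <-] := d2.
Qed.

Lemma lin2_diag i y z : lin [:: i; i] y z =
  - 4 * y i 0 * zc i z * qf y ^+ 2 - 2 * qf y ^+ 2 * (pz y z - wz z)
  + 8 * y i 0 ^+ 2 * qf y ^+ 3 * (pz y z - wz z).
Proof.
have d1 := pderiv_lin [:: i] z i y.
have dp := is_derive_addr (pderiv_pz z i y) (is_derive_constr (- wz z) y (basisv R i)).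
have dq2 := is_derive_expr 2 (pderiv_qf i y).
have dc := is_derive_mulr (is_derive_constr (-2) y (basisv R i)) (@pderiv_coord R i i y).
have dA := is_derive_mulr dc (is_derive_mulr dq2 dp).
have dB := is_derive_mulr (pderiv_qf i y) (is_derive_constr (zc i z) y (basisv R i)).
have d2 : is_derive y (basisv R i) (lin [:: i] ^~ z) (- 4 * y i 0 * zc i z * qf y ^+ 2
    - 2 * qf y ^+ 2 * (pz y z - wz z) + 8 * y i 0 ^+ 2 * qf y ^+ 3 * (pz y z - wz z)).
  apply: (is_derive_ext (is_derive_addr dB dA)).
    by move=> y'; rewrite lin1E /lin1f; ring.
  by rewrite eqxx /=; ring.
by have [_ <-] := d1; have [_ <-] := d2.
Qed.

(** The round gradient of tau (., z) has squared length tau (1 - tau); a conformal chart multiplies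
    this by 4 qf^2. *)
Lemma gradT y z : S z ->
  lin [:: 0] y z ^+ 2 + lin [:: 1] y z ^+ 2 = 4 * qf y ^+ 2 * (Tk y z * (1 - Tk y z)).
Proof.
move=> Sz; rewrite TkE lin0E !lin1E /lin1f /zc !eqxx /=.
have e1 : wz z ^+ 2 = 1 - z 0 0 ^+ 2 - z 1 0 ^+ 2.
  rewrite /wz exprMn [csgn R b ^+ 2]expr2 csgnK mul1r -(Sz : dotv z z = 1) dotvE; ring.
have e2 := sqn_qf y; rewrite /sqn in e2; rewrite /pz.
move: (wz z) (qf y) (y 0 0) (y 1 0) (z 0 0) (z 1 0) e1 e2 => w q y0 y1 z0 z1 e1 e2.
have e3 : z0 ^+ 2 + z1 ^+ 2 = 1 - w ^+ 2 by rewrite e1; ring.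
set p := y0 * z0 + y1 * z1.
transitivity (q ^+ 2 * (z0 ^+ 2 + z1 ^+ 2) - 4 * q ^+ 3 * p * (p - w)
  + 4 * ((y0 ^+ 2 + y1 ^+ 2) * q) * q ^+ 3 * (p - w) ^+ 2); first by rewrite /p; ring.
by rewrite e2 e3; field.
Qed.

(** tau (., z) - 1 / 2 is a spherical harmonic of degree 1, of eigenvalue -2. *)
Lemma lapT y z : lin [:: 0; 0] y z + lin [:: 1; 1] y z = - 4 * qf y ^+ 2 * (2 * Tk y z - 1).
Proof.
rewrite TkE lin0E !lin2_diag /zc !eqxx /=.
have e2 := sqn_qf y; rewrite /sqn in e2.
transitivity (- 4 * qf y ^+ 2 * pz y z - 4 * qf y ^+ 2 * (pz y z - wz z)
  + 8 * ((y 0 0 ^+ 2 + y 1 0 ^+ 2) * qf y) * qf y ^+ 2 * (pz y z - wz z)).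
  by rewrite /pz; ring.
by rewrite e2; field.
Qed.

Lemma Tk_unit y z : S z -> 0 <= Tk y z <= 1.
Proof. by move=> Sz; apply: tau_unit => //; exact: chart_sphere. Qed.

(** tau is maximal at z, so each first derivative carries half a power of 1 - tau. This pays for
    half of the factor m that differentiating tau^m produces. *)
Lemma lin1_bound i y z : S z -> `|lin [:: i] y z| <= 2 * (1 - Tk y z) `^ (1 / 2).
Proof.
move=> Sz; have /andP[t0 t1] := Tk_unit y Sz; have g := gradT y Sz.
have u0 : 0 <= 1 - Tk y z by rewrite subr_ge0.
have h : lin [:: i] y z ^+ 2 <= 4 * (1 - Tk y z).
  apply: (@le_trans _ _ (lin [:: 0] y z ^+ 2 + lin [:: 1] y z ^+ 2)).
    by move: i; apply: ord2_cases; [rewrite lerDl|rewrite lerDr]; exact: sqr_ge0.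
  rewrite g -mulrA ler_wpM2l// mulrA ler_piMl//.
  by rewrite mulr_ile1 ?sqr_ge0// expr_le1 ?qf_le1// ltW// qf_gt0.
move: (lin _ _ _) (1 - Tk y z) u0 h => a u u0 h.
rewrite -sqrtr_sqr (_ : 2 * _ = Num.sqrt (4 * u)); first exact: ler_wsqrtr.
rewrite sqrtrM// div1r powR12_sqrt//; congr (_ * _).
have -> : 4 = 2 ^+ 2 :> R by rewrite -natrX.
by rewrite sqrtr_sqr gtr0_norm.
Qed.

(** K1, K2 and K3 are the derivatives of tau^n of orders 1, 2 and 3. Wherever a truncated
    predecessor spoils an exponent, the numerical factor in front is 0. *)
Definition K1 n i y z : R := n%:R * (Tk y z ^+ n.-1 * lin [:: i] y z).

Definition K2 n k i y z : R := n%:R * (n.-1%:R * (Tk y z ^+ n.-2 * lin [:: k] y z) * lin [:: i] y z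
  + Tk y z ^+ n.-1 * lin [:: k; i] y z).

Definition K3 n l k i y z : R := n%:R *
  (n.-1%:R * (n.-2%:R * (Tk y z ^+ n.-2.-1 * lin [:: l] y z) * lin [:: k] y z
              + Tk y z ^+ n.-2 * lin [:: l; k] y z) * lin [:: i] y z
   + n.-1%:R * (Tk y z ^+ n.-2 * lin [:: k] y z) * lin [:: l; i] y z
   + (n.-1%:R * (Tk y z ^+ n.-2 * lin [:: l] y z) * lin [:: k; i] y z
      + Tk y z ^+ n.-1 * lin [:: l; k; i] y z)).

Lemma sepker_K0 n : sepker (fun y z => Tk y z ^+ n) (fun i => K1 n i).
Proof. exact: sepkerX sepker_Tk. Qed.

Lemma sepker_K1 n i : sepker (K1 n i) (fun k => K2 n k i).
Proof. exact: sepkerZ (sepkerM (sepkerX n.-1 sepker_Tk) (sepker_lin [:: i])). Qed.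

Lemma sepker_K2 n k i : sepker (K2 n k i) (fun l => K3 n l k i).
Proof.
apply: sepkerZ; apply: sepkerD; last first.
  exact: (sepkerM (sepkerX n.-1 sepker_Tk) (sepker_lin [:: k; i])).
apply: sepker_ext (sepkerM (sepkerZ n.-1%:R (sepkerM (sepkerX n.-2 sepker_Tk) (sepker_lin [:: k])))
  (sepker_lin [:: i])) _ _ => // l y z.
Qed.

Lemma sint_K1 n i y : sint (K1 n i y) = 0.
Proof.
apply: (sepker_sint_cst (sepker_K0 n) (r := n.+1%:R^-1)) => y'.
by apply: sint_tauX; exact: chart_sphere.
Qed.

Lemma sint_K2 n k i y : sint (K2 n k i y) = 0.
Proof. by apply: (sepker_sint_cst (sepker_K1 n i) (r := 0)) => y'; exact: sint_K1. Qed.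

Lemma sint_K3 n l k i y : sint (K3 n l k i y) = 0.
Proof. by apply: (sepker_sint_cst (sepker_K2 n k i) (r := 0)) => y'; exact: sint_K2. Qed.

End TauKernels.

(** * A weight that dominates all the differentiated kernels *)

Section Weights.
Variable R : realType.
Local Notation V3 := 'cV[R]_3.
Local Notation S := (@sphere R).

Lemma powR_le_1D4 (u be : R) : 0 <= u -> 0 <= be <= 4 -> u `^ be <= 1 + u ^+ 4.
Proof.
move=> u0 /andP[b0 b4]; have u4 : 0 <= u ^+ 4 by exact: exprn_ge0.
have [u1|/ltW u1] := leP u 1.
  apply: (@le_trans _ _ 1); last by rewrite lerDl.
  rewrite -[leRHS](congr1 (fun F => F be) (powR1 R)).
  by apply: ge0_ler_powR; rewrite ?nnegrE.
apply: (@le_trans _ _ (u ^+ 4)); last by rewrite lerDr.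
by rewrite -powR_mulrn//; apply: ler_powR.
Qed.

(** It dominates tau^j ((m + 1) (1 - tau))^be for all j >= m - 2 and 0 <= be <= 4, yet its mean is
    still of order 1 / (m + 1). The exponent m - 2 is the lowest power of tau in the third
    derivatives of tau^(m+1). *)
Definition wt (x : V3) (m : nat) (z : V3) : R :=
  tau x z ^+ (m - 2) * (1 + (m.+1%:R * (1 - tau x z)) ^+ 4).

Lemma wt_bounded x m : S x -> bounded_on S (wt x m).
Proof.
move=> Sx; apply: bounded_onM; first exact: tauX_bounded.
apply: bounded_onD; first exact: bounded_on_cst.
apply: bounded_onX; apply: bounded_onZ; apply: bounded_onB; first exact: bounded_on_cst.
exact: tau_bounded.
Qed.

(** The 3 compares m + 1 with (m - 2) + 1 under truncated subtraction; 24 = 4! and the fifth power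
    come from the fourth moment of 1 - tau. *)
Definition wtC : R := 3 + 24 * 3 ^+ 5.

Lemma wtC_ge0 : 0 <= wtC.
Proof. by rewrite addr_ge0// mulr_ge0// exprn_ge0. Qed.

Lemma sint_wt x m : S x -> sint (wt x m) <= wtC / m.+1%:R.
Proof.
move=> Sx; set N : R := m.+1%:R; have N0 : 0 < N by rewrite ltr0n.
set n := (m - 2)%N; set P : R := n.+1%:R; have P0 : 0 < P by rewrite ltr0n.
have NP : N <= 3 * P by rewrite /N /P -natrM ler_nat /n; lia.
have bt k := @tau_beta_bounded R x n k Sx.
have -> : sint (wt x m) = sint (fun z => tau x z ^+ n * (1 - tau x z) ^+ 0
    + N ^+ 4 * (tau x z ^+ n * (1 - tau x z) ^+ 4)).
  by apply: sint_ext => z _; rewrite /wt -/n -/N expr0 exprMn; ring.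
rewrite sintD; [|exact: bt|by apply: bounded_onZ; exact: bt].
rewrite sintZ; last exact: bt.
have h0 := @sint_tau_beta R x n 0 Sx; have h4 := @sint_tau_beta R x n 4 Sx.
rewrite -/P in h0 h4; move: (sint _) (sint _) h0 h4 => B A h0 h4.
have i3 : P^-1 <= 3 / N by rewrite ler_pdivlMr// mulrC ler_pdivrMr.
have N4 : 0 <= N ^+ 4 by rewrite exprn_ge0// ltW.
have P5 : N ^+ 4 * (4`!%:R / P ^+ 5) <= 24 * 3 ^+ 5 / N.
  have -> : 4`!%:R = 24 :> R by [].
  have e : (P ^+ 5)^-1 <= (3 / N) ^+ 5.
    by rewrite -exprVn lerXn2r ?nnegrE ?divr_ge0 ?invr_ge0 ?(ltW N0) ?(ltW P0).
  apply: (@le_trans _ _ (N ^+ 4 * (24 * (3 / N) ^+ 5))).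
    by rewrite ler_wpM2l// ler_wpM2l.
  by rewrite le_eqVlt; apply/orP; left; apply/eqP; field; rewrite gt_eqF.
have h4' := le_trans (ler_wpM2l N4 h4) P5.
have h0' : A <= 3 / N.
  by apply: le_trans h0 _; rewrite fact0 expr1 mul1r.
by rewrite /wtC mulrDl; exact: lerD.
Qed.

Lemma sint_weight x m (g : V3 -> R) (A : R) : S x -> 0 <= A ->
  (forall z, S z -> `|g z| <= A * wt x m z) -> `|sint g| <= A * wtC / m.+1%:R.
Proof.
move=> Sx A0 h; have bw := bounded_onZ A (@wt_bounded x m Sx).
have bg : bounded_on S g by exact: bounded_on_le bw h.
apply: le_trans (sint_norm bg) _.
apply: le_trans (sint_le (bounded_on_norm bg) bw h) _.
rewrite sintZ; last exact: wt_bounded.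
by rewrite -mulrA ler_wpM2l// sint_wt.
Qed.

Lemma wt_powR x m (be : R) z : S x -> S z -> 0 <= be <= 4 ->
  tau x z ^+ (m - 2) * (1 - tau x z) `^ be <= m.+1%:R `^ (- be) * wt x m z.
Proof.
move=> Sx Sz hb; have /andP[t0 t1] := tau_unit Sx Sz.
have u0 : 0 <= 1 - tau x z by rewrite subr_ge0.
have N0 : 0 < m.+1%:R :> R by rewrite ltr0n.
rewrite /wt mulrCA ler_wpM2l ?exprn_ge0//.
have Nu : 0 <= m.+1%:R * (1 - tau x z) by rewrite mulr_ge0 ?(ltW N0).
have := powR_le_1D4 Nu hb; rewrite powRM ?(ltW N0)//.
move=> h; rewrite powRN [leRHS]mulrC ler_pdivlMr ?powR_gt0//.
by rewrite mulrC.
Qed.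

End Weights.

#[local] Opaque lin.

(** * Two derivatives of L and its Laplacian *)

Section LopRegularity.
Variable R : realType.
Local Notation V2 := 'cV[R]_2.
Local Notation V3 := 'cV[R]_3.
Local Notation S := (@sphere R).
Variable b : bool.
Implicit Types (y : V2) (z : V3) (h : V3 -> R).

Definition L0 h (m : nat) y : R := Vop m.+1 h (chart b y) / m.+1%:R.
Definition L1 h (m : nat) i y : R := sint (fun z => K1 b m.+1 i y z * h z) / m.+1%:R.
Definition L2 h (m : nat) k i y : R := sint (fun z => K2 b m.+1 k i y z * h z) / m.+1%:R.
Definition L3 h (m : nat) l k i y : R := sint (fun z => K3 b m.+1 l k i y z * h z) / m.+1%:R.

Lemma pderiv_divr (F : V2 -> R) (dF : 'I_2 -> V2 -> R) (c : R) : pderiv F dF ->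
  pderiv (fun y => F y / c) (fun i y => dF i y / c).
Proof.
move=> hF i y.
apply: (is_derive_ext (is_derive_mulr (hF i y) (is_derive_constr c^-1 y (basisv R i)))) => //.
by rewrite mulr0 addr0.
Qed.

Lemma pderiv_L0 h m : bounded_on S h -> pderiv (L0 h m) (L1 h m).
Proof. by move=> bh; exact: (pderiv_divr m.+1%:R (sepker_sint (sepker_K0 R b m.+1) bh)). Qed.

Lemma pderiv_L1 h m i : bounded_on S h -> pderiv (L1 h m i) (fun k => L2 h m k i).
Proof. by move=> bh; exact: (pderiv_divr m.+1%:R (sepker_sint (sepker_K1 R b m.+1 i) bh)). Qed.

Lemma pderiv_L2 h m k i : bounded_on S h -> pderiv (L2 h m k i) (fun l => L3 h m l k i).
Proof. by move=> bh; exact: (pderiv_divr m.+1%:R (sepker_sint (sepker_K2 R b m.+1 k i) bh)). Qed.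

Lemma L2E h m k i y : L2 h m k i y = sint (fun z => K2 b m.+1 k i y z * h z) / m.+1%:R.
Proof. by []. Qed.

#[local] Opaque L1 L2 L3.

Lemma Lop_sumto h : bounded_on S h -> sumto (L0 h) (Lop h \o @chart R b).
Proof.
move=> bh; have [M M0 hM] := bounded_onP bh; move=> r; exists (fun N => M / N.+1%:R); split.
  move=> e e0; have [N0 hN0] := natr_ge (M / e); exists N0 => N NN.
  by rewrite ler_pdivrMr ?ltr0n// mulrC -ler_pdivrMr// hN0.
by move=> N y _; exact: Lop_tail (chart_sphere b y) hM.
Qed.

Lemma powR_natD (m : nat) (s t : R) : m.+1%:R `^ s * m.+1%:R `^ t = m.+1%:R `^ (s + t).
Proof. by rewrite powRD// pnatr_eq0 implybT. Qed.

Lemma powR_natV (m : nat) (s : R) : m.+1%:R `^ s / m.+1%:R = m.+1%:R `^ (- 1 + s).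
Proof. by rewrite -powR_natD powR_inv1 ?ler0n// mulrC. Qed.

Lemma powR_natS (m : nat) (s : R) : m.+1%:R * m.+1%:R `^ s = m.+1%:R `^ (1 + s).
Proof. by rewrite -powR_natD powRr1. Qed.

Lemma leq_subn2 (m : nat) : (m - 2 <= m.-1)%N /\ (m - 2 <= m.-1.-1)%N.
Proof. by split; lia. Qed.

Lemma weight_bound h y m (A de : R) (k : V3 -> R) : 0 <= A ->
  (forall z, S z -> `|k z * h z| <= A * m.+1%:R `^ de * wt (chart b y) m z * m.+1%:R) ->
  `|sint (fun z => k z * h z) / m.+1%:R| <= A * wtC R * m.+1%:R `^ (- 1 + de).
Proof.
move=> A0 hk; have N0 : 0 < m.+1%:R :> R by rewrite ltr0n.
have B0 : 0 <= A * m.+1%:R `^ de * m.+1%:R by rewrite !mulr_ge0 ?powR_ge0 ?(ltW N0).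
have := @sint_weight R (chart b y) m (fun z => k z * h z) _ (chart_sphere b y) B0 _.
move=> H; rewrite normrM [X in _ * X]gtr0_norm ?invr_gt0// ler_pdivrMr//.
apply: le_trans (H _) _ => [z Sz|]; first by apply: le_trans (hk z Sz) _; rewrite mulrAC.
rewrite -powR_natV le_eqVlt; apply/orP; left; apply/eqP.
by move: (m.+1%:R : R) (_ `^ de) (wtC R) N0 => N p w N0; field; rewrite gt_eqF.
Qed.

Lemma Tk_wt y m j (be : R) z : S z -> (m - 2 <= j)%N -> 0 <= be <= 4 ->
  Tk b y z ^+ j * (1 - Tk b y z) `^ be <= m.+1%:R `^ (- be) * wt (chart b y) m z.
Proof.
move=> Sz mj hb; apply: le_trans (wt_powR m (chart_sphere b y) Sz hb).
have /andP[t0 t1] := Tk_unit b y Sz.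
by rewrite ler_wpM2r ?powR_ge0//; apply: ler_wiXn2l.
Qed.

Lemma normM_le (a a' A A' : R) : `|a| <= A -> `|a'| <= A' -> `|a * a'| <= A * A'.
Proof. by move=> h h'; rewrite normrM; apply: ler_pM. Qed.

Lemma normD_le (a a' A A' : R) : `|a| <= A -> `|a'| <= A' -> `|a + a'| <= A + A'.
Proof. by move=> h h'; apply: le_trans (ler_normD _ _) _; apply: lerD. Qed.

Lemma norm_natr (n : nat) : `|n%:R| <= n%:R :> R.
Proof. by rewrite normr_nat. Qed.

Lemma norm_TkX y z j : S z -> `|Tk b y z ^+ j| <= Tk b y z ^+ j.
Proof.
by move=> Sz; have /andP[t0 _] := Tk_unit b y Sz; rewrite ger0_norm// exprn_ge0.
Qed.

Lemma powR_addp (v s t : R) : 0 < s -> 0 < t -> v `^ s * v `^ t = v `^ (s + t).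
Proof. by move=> s0 t0; rewrite powRD// gt_eqF// addr_gt0. Qed.

Lemma wt_ge0 y m z : S z -> 0 <= wt (chart b y) m z.
Proof.
move=> Sz; have /andP[t0 t1] := Tk_unit b y Sz.
by rewrite mulr_ge0 ?exprn_ge0// addr_ge0// exprn_ge0// mulr_ge0 ?ler0n// subr_ge0.
Qed.

(** The factor m + 1 cancels the denominator, the gradient gives (m + 1)^(- 1 / 2) and the mean of
    the weight another 1 / (m + 1). *)
Lemma rate_L1 h i : bounded_on S h -> rate (fun m => L1 h m i) (- 1 - 1 / 2).
Proof.
move=> bh r; have [H H0 hH] := bounded_onP bh; exists (2 * H * wtC R) => [|m y _].
  by rewrite !mulr_ge0 ?wtC_ge0 ?(ltW H0).
apply: (weight_bound (y := y)) => [|z Sz]; first by rewrite mulr_ge0 ?(ltW H0).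
have be : 0 <= (1 / 2 : R) <= 4 by lra.
have w := @Tk_wt y m m (1 / 2) z Sz (leq_subr 2 m) be.
apply: le_trans (normM_le (normM_le (norm_natr m.+1) (normM_le (norm_TkX y m Sz)
  (lin1_bound b i y Sz))) (hH z Sz)) _.
have c0 : 0 <= m.+1%:R * 2 * H :> R by rewrite !mulr_ge0 ?ler0n ?(ltW H0).
have := ler_wpM2l c0 w; move: (_ `^ (1 / 2)) (_ `^ (- (1 / 2))) (Tk b y z ^+ m) (wt _ _ _).
move: (m.+1%:R : R) => N v p T W; congr (_ <= _); ring.
Qed.

Variable alpha : R.
Hypothesis a0 : 0 < alpha.
Hypothesis a1 : alpha < 1.

(** The worst term is (m + 1) m tau^(m-1) (1 - tau)^(1 + alpha / 2): two half powers from gradients,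
    alpha / 2 from h (z) - h (x). Without that subtraction the rate would be - 1, just not
    summable. *)
Lemma rate_L2 h k i : sholder alpha h -> rate (fun m => L2 h m k i) (- 1 - alpha / 2).
Proof.
move=> hh r; have bh := UC_bounded (sholder_UC a0 hh); have [C C0 hC] := hh.
have [M M0 hM] := lin_bound b [:: k; i] r.
exists (C * (4 + M) * wtC R) => [|m y yr]; first by rewrite !mulr_ge0 ?wtC_ge0 ?addr_ge0.
set x := chart b y; have Sx : S x by exact: chart_sphere.
have -> : L2 h m k i y = sint (fun z => K2 b m.+1 k i y z * (h z - h x)) / m.+1%:R.
  have bK := sepker_dbounded k y (sepker_K1 R b m.+1 i).
  congr (_ / _).
  transitivity (sint (fun z => K2 b m.+1 k i y z * h z - h x * K2 b m.+1 k i y z)); last first.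
    by apply: sint_ext => z _; ring.
  rewrite sintB; [|exact: bounded_onM|exact: bounded_onZ].
  by rewrite sintZ// sint_K2 mulr0 subr0.
apply: (weight_bound (y := y)) => [|z Sz]; first by rewrite mulr_ge0 ?addr_ge0.
have hd : `|h z - h x| <= C * (1 - Tk b y z) `^ (alpha / 2).
  by rewrite distrC; exact: hC.
have l0 j := lin1_bound b j y Sz.
apply: le_trans (normM_le (normM_le (norm_natr m.+1) (normD_le
  (normM_le (normM_le (norm_natr m) (normM_le (norm_TkX y m.-1 Sz) (l0 k))) (l0 i))
  (normM_le (norm_TkX y m Sz) (hM y z yr Sz)))) hd) _.
have be1 : 0 <= (1 + alpha / 2 : R) <= 4 by move: a0 a1; lra.
have be0 : 0 <= (alpha / 2 : R) <= 4 by move: a0 a1; lra.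
have [m1 m2] := leq_subn2 m.
have w1 := @Tk_wt y m m.-1 (1 + alpha / 2) z Sz m1 be1.
have w0 := @Tk_wt y m m (alpha / 2) z Sz (leq_subr 2 m) be0.
have e1 : (1 - Tk b y z) `^ (1 + alpha / 2)
    = (1 - Tk b y z) `^ (1 / 2) * (1 - Tk b y z) `^ (1 / 2) * (1 - Tk b y z) `^ (alpha / 2).
  by rewrite !powR_addp ?addr_gt0 ?divr_gt0//; congr (_ `^ _); field.
have e2 : m.+1%:R `^ (- (alpha / 2)) = m.+1%:R * m.+1%:R `^ (- (1 + alpha / 2)) :> R.
  by rewrite powR_natS; congr (_ `^ _); ring.
rewrite e1 in w1; rewrite e2 in w0 *.
have mN : m%:R <= m.+1%:R :> R by rewrite ler_nat.
have T0 j : 0 <= Tk b y z ^+ j by rewrite exprn_ge0//; case/andP: (Tk_unit b y Sz).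
move: (T0 m.-1) (powR_ge0 (1 - Tk b y z) (1 / 2)) (powR_ge0 (1 - Tk b y z) (alpha / 2)) w1 w0.
move: (_ `^ (1 / 2)) (_ `^ (alpha / 2)) (_ `^ (- (1 + _))) (Tk b y z ^+ m) (Tk b y z ^+ m.-1) (wt _ _ _).
move: (m%:R : R) (m.+1%:R : R) (ler0n R m) (ler0n R m.+1) mN => n N n0 N0 nN s w p T T1 W T10 s0 w00 w1 w0.
have c1 : 0 <= N * C * M by rewrite !mulr_ge0.
have c2 : 0 <= N * C * 4 * N by rewrite !mulr_ge0.
apply: (@le_trans _ _ (N * C * 4 * N * (T1 * (s * s * w)) + N * C * M * (T * w))).
  rewrite (_ : N * _ * _ = N * C * 4 * (T1 * (s * s * w)) * n + N * C * M * (T * w)); last by ring.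
  by rewrite lerD2r [leRHS]mulrAC ler_wpM2l// !mulr_ge0.
apply: le_trans (lerD (ler_wpM2l c2 w1) (ler_wpM2l c1 w0)) _.
by rewrite le_eqVlt; apply/orP; left; apply/eqP; ring.
Qed.

(** A further derivative loses (m + 1)^(1 / 2), so this series need not converge; it serves only for
    the low frequencies in [serlim_locholder]. *)
Lemma rate_L3 h l k i : sholder alpha h -> rate (fun m => L3 h m l k i) (- (1 / 2) - alpha / 2).
Proof.
move=> hh r; have bh := UC_bounded (sholder_UC a0 hh); have [C C0 hC] := hh.
have [M1 M10 hM1] := lin_bound b [:: l; k] r; have [M2 M20 hM2] := lin_bound b [:: l; i] r.
have [M3 M30 hM3] := lin_bound b [:: k; i] r; have [M4 M40 hM4] := lin_bound b [:: l; k; i] r.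
pose M := M1 + M2 + M3; have M0 : 0 <= M by rewrite !addr_ge0.
exists (C * (8 + 2 * M + M4) * wtC R) => [|m y yr].
  by rewrite !mulr_ge0 ?wtC_ge0// !addr_ge0// mulr_ge0.
set x := chart b y; have Sx : S x by exact: chart_sphere.
have -> : L3 h m l k i y = sint (fun z => K3 b m.+1 l k i y z * (h z - h x)) / m.+1%:R.
  have bK := sepker_dbounded l y (sepker_K2 R b m.+1 k i).
  congr (_ / _).
  transitivity (sint (fun z => K3 b m.+1 l k i y z * h z - h x * K3 b m.+1 l k i y z)); last first.
    by apply: sint_ext => z _; ring.
  rewrite sintB; [|exact: bounded_onM|exact: bounded_onZ].
  by rewrite sintZ// sint_K3 mulr0 subr0.
rewrite (_ : - (1 / 2) - alpha / 2 = - 1 + (1 / 2 - alpha / 2)); last by field.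
apply: (weight_bound (y := y)) => [|z Sz]; first by rewrite mulr_ge0// !addr_ge0// mulr_ge0.
have hd : `|h z - h x| <= C * (1 - Tk b y z) `^ (alpha / 2).
  by rewrite distrC; exact: hC.
have l0 j := lin1_bound b j y Sz.
apply: le_trans (normM_le (normM_le (norm_natr m.+1) (normD_le (normD_le
  (normM_le (normM_le (norm_natr m) (normD_le
    (normM_le (normM_le (norm_natr m.-1) (normM_le (norm_TkX y m.-1.-1 Sz) (l0 l))) (l0 k))
    (normM_le (norm_TkX y m.-1 Sz) (hM1 y z yr Sz)))) (l0 i))
  (normM_le (normM_le (norm_natr m) (normM_le (norm_TkX y m.-1 Sz) (l0 k))) (hM2 y z yr Sz)))
  (normD_le (normM_le (normM_le (norm_natr m) (normM_le (norm_TkX y m.-1 Sz) (l0 l))) (hM3 y z yr Sz))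
  (normM_le (norm_TkX y m Sz) (hM4 y z yr Sz))))) hd) _.
have be3 : 0 <= (3 / 2 + alpha / 2 : R) <= 4 by move: a0 a1; lra.
have be1 : 0 <= (1 / 2 + alpha / 2 : R) <= 4 by move: a0 a1; lra.
have be0 : 0 <= (alpha / 2 : R) <= 4 by move: a0 a1; lra.
have [m1 m2] := leq_subn2 m.
have w3 := @Tk_wt y m m.-1.-1 (3 / 2 + alpha / 2) z Sz m2 be3.
have w1 := @Tk_wt y m m.-1 (1 / 2 + alpha / 2) z Sz m1 be1.
have w0 := @Tk_wt y m m (alpha / 2) z Sz (leq_subr 2 m) be0.
have e1 : (1 - Tk b y z) `^ (1 / 2 + alpha / 2)
    = (1 - Tk b y z) `^ (1 / 2) * (1 - Tk b y z) `^ (alpha / 2).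
  by rewrite !powR_addp ?divr_gt0.
have e3 : (1 - Tk b y z) `^ (3 / 2 + alpha / 2) = (1 - Tk b y z) `^ (1 / 2)
    * (1 - Tk b y z) `^ (1 / 2) * (1 - Tk b y z) `^ (1 / 2) * (1 - Tk b y z) `^ (alpha / 2).
  by rewrite !powR_addp ?addr_gt0 ?divr_gt0//; congr (_ `^ _); field.
have f1 : m.+1%:R `^ (1 / 2 - alpha / 2) = m.+1%:R * m.+1%:R `^ (- (1 / 2 + alpha / 2)) :> R.
  by rewrite powR_natS; congr (_ `^ _); field.
have f3 : m.+1%:R `^ (- (1 / 2 + alpha / 2)) = m.+1%:R * m.+1%:R `^ (- (3 / 2 + alpha / 2)) :> R.
  by rewrite powR_natS; congr (_ `^ _); field.
have f0 : m.+1%:R `^ (- (alpha / 2)) <= m.+1%:R `^ (1 / 2 - alpha / 2) :> R.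
  by apply: ler_powR; rewrite ?ler1n//; lra.
have W0 := @wt_ge0 y m z Sz.
have {}w0 := le_trans w0 (ler_wpM2r W0 f0).
rewrite e1 in w1; rewrite e3 in w3; rewrite f1 f3 in w0 *; rewrite f3 in w1.
have mN : m%:R <= m.+1%:R :> R by rewrite ler_nat.
have mN1 : m.-1%:R <= m.+1%:R :> R by rewrite ler_nat (leq_trans (leq_pred m)).
have T0 j : 0 <= Tk b y z ^+ j by rewrite exprn_ge0//; case/andP: (Tk_unit b y Sz).
move: (T0 m.-1) (T0 m.-1.-1) (powR_ge0 (1 - Tk b y z) (1 / 2)) (powR_ge0 (1 - Tk b y z) (alpha / 2)) w3 w1 w0.
move: (_ `^ (1 / 2)) (_ `^ (alpha / 2)) (_ `^ (- (3 / 2 + _))) (Tk b y z ^+ m) (Tk b y z ^+ m.-1)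
  (Tk b y z ^+ m.-1.-1) (wt _ _ _) W0.
move: (m%:R : R) (m.-1%:R : R) (m.+1%:R : R) (ler0n R m) (ler0n R m.-1) (ler0n R m.+1) mN mN1.
move=> n n1 N n0 n10 N0 nN n1N s w p T T1 T2 W W0 T10 T20 s0 w00 w3 w1 w0.
have c0 : 0 <= N * C * M4 by rewrite !mulr_ge0.
have c1 : 0 <= N * C * 2 * M * N by rewrite !mulr_ge0.
have c3 : 0 <= N * C * 8 * (N * N) by rewrite !mulr_ge0.
apply: (@le_trans _ _ (N * C * 8 * (N * N) * (T2 * (s * s * s * w))
  + N * C * 2 * M * N * (T1 * (s * w)) + N * C * M4 * (T * w))).
  rewrite (_ : N * _ * _ = N * C * 8 * (T2 * (s * s * s * w)) * (n * n1)
    + N * C * 2 * M * (T1 * (s * w)) * n + N * C * M4 * (T * w)); last by rewrite /M; ring.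
  rewrite lerD2r; apply: lerD; rewrite [leRHS]mulrAC ler_wpM2l//; do ?by rewrite !mulr_ge0.
  exact: ler_pM.
apply: le_trans (lerD (lerD (ler_wpM2l c3 w3) (ler_wpM2l c1 w1)) (ler_wpM2l c0 w0)) _.
by rewrite le_eqVlt; apply/orP; left; apply/eqP; ring.
Qed.

Lemma half_gt0 : 0 < (1 / 2 : R). Proof. by rewrite divr_gt0. Qed.

Let ha0 : 0 < alpha / 2. Proof. by rewrite divr_gt0. Qed.

Lemma pderiv_Lop h : bounded_on S h ->
  pderiv (Lop h \o @chart R b) (fun i => serlim (fun m => L1 h m i)).
Proof.
move=> bh; apply: (sumto_pderiv half_gt0 (fun m => pderiv_L0 m bh) (Lop_sumto bh)) => i.
exact: rate_L1.
Qed.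

Lemma rate_locbounded (g : nat -> V2 -> R) s : 0 < s -> rate g (- 1 - s) -> locbounded (serlim g).
Proof.
move=> s0 hg r; have [C C0 hC] := hg r; have [B B0 hB] := rate_serlim s0 C0 hC.
by exists B => y yr; have := hB 0 y yr; rewrite big_ord0 subr0 powR1 mulr1.
Qed.

(** The gradient series converges absolutely for densities that are merely bounded, so L h is
    locally Lipschitz; the bootstrap starts here. *)
Lemma Lop_locholder h : bounded_on S h -> locholder alpha (Lop h \o @chart R b).
Proof.
move=> bh; apply: (loclip_holder (ltW a1)) => r.
have [M0 hM0] := rate_locbounded half_gt0 (rate_L1 0 bh) r.
have [M1 hM1] := rate_locbounded half_gt0 (rate_L1 1 bh) r.
exists (Num.max M0 M1 + Num.max M0 M1); apply: (pderiv_lip (pderiv_Lop bh)).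
apply: ord2_cases => y yr; rewrite le_max.
  by rewrite (hM0 y yr).
by rewrite (hM1 y yr) orbT.
Qed.

Lemma pderiv_L1_series h i : sholder alpha h ->
  pderiv (serlim (fun m => L1 h m i)) (fun k => serlim (fun m => L2 h m k i)).
Proof.
move=> hh; have bh := UC_bounded (sholder_UC a0 hh).
apply: (sumto_pderiv ha0 (fun m => pderiv_L1 m i bh)).
  exact: rate_sumto half_gt0 (rate_L1 i bh).
by move=> k; exact: rate_L2.
Qed.

Lemma Lop_Hc2 h : sholder alpha h -> Hc 2 alpha (Lop h \o @chart R b).
Proof.
move=> hh; have bh := UC_bounded (sholder_UC a0 hh).
apply: (HcSP (pderiv_Lop bh)) => i; apply: (HcSP (pderiv_L1_series i hh)) => k.
apply: (serlim_locholder a0 a1 (fun m => pderiv_L2 m k i bh)); first exact: rate_L2.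
by move=> l; exact: rate_L3.
Qed.

(** With n = m + 1, [gradT] and [lapT] reduce the Laplacian of tau^n to 4 qf^2 n (n tau^(n-1) - (n +
    1) tau^n), a difference of consecutive terms. *)
Lemma lapK h m y : bounded_on S h -> L2 h m 0 0 y + L2 h m 1 1 y
  = 4 * qf y ^+ 2 * (m.+1%:R * Vop m h (chart b y) - m.+2%:R * Vop m.+1 h (chart b y)).
Proof.
move=> bh; have Sx := chart_sphere b y.
have bK i := sepker_dbounded i y (sepker_K1 R b m.+1 i).
have N0 : m.+1%:R != 0 :> R by rewrite pnatr_eq0.
rewrite !L2E -mulrDl; apply/eqP; rewrite -subr_eq0; apply/eqP.
rewrite -sintD; try by apply: bounded_onM.
rewrite /Vop -!sintZ; try exact: tauXM_bounded.
rewrite -sintB; try by apply: bounded_onZ; exact: tauXM_bounded.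
rewrite -sintZ; last first.
  by apply: bounded_onB; apply: bounded_onZ; exact: tauXM_bounded.
apply/eqP; rewrite subr_eq0 mulrC -sintZ; last first.
  by apply: bounded_onD; apply: bounded_onM.
apply/eqP; apply: sint_ext => z Sz.
have g := gradT b y Sz; have l := lapT b y z.
have e : K2 b m.+1 0 0 y z * h z + K2 b m.+1 1 1 y z * h z = m.+1%:R *
  (m%:R * Tk b y z ^+ m.-1 * (lin b [:: 0] y z ^+ 2 + lin b [:: 1] y z ^+ 2)
   + Tk b y z ^+ m * (lin b [:: 0; 0] y z + lin b [:: 1; 1] y z)) * h z.
  rewrite /K2 -/(m.+1.-1) -/(m.+1.-2) /=.
  move: (lin b [:: 0] y z) (lin b [:: 1] y z) (lin b [:: 0; 0] y z) (lin b [:: 1; 1] y z).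
  by move: (Tk b y z ^+ m) (Tk b y z ^+ m.-1) (h z) (m.+1%:R : R) (m%:R : R) => *; ring.
rewrite e g l -mulrA mulKf// -[tau _ _]/(Tk b y z) [_ ^+ m.+1]exprS -[m.+2%:R]natr1 -[m.+1%:R]natr1.
have e2 : m%:R * Tk b y z ^+ m.-1 * (4 * qf y ^+ 2 * (Tk b y z * (1 - Tk b y z)))
    = m%:R * Tk b y z ^+ m * (4 * qf y ^+ 2 * (1 - Tk b y z)).
  case: m {bK N0 e} => [|m]; first by rewrite !mul0r.
  by rewrite /= [_ ^+ m.+1]exprS; move: (m.+1%:R : R) => n; ring.
by rewrite e2; move: (m%:R : R) => n; ring.
Qed.

Lemma serlim_add_eq (g0 g1 : nat -> V2 -> R) (s l : R) y : 0 < s ->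
  rate g0 (- 1 - s) -> rate g1 (- 1 - s) ->
  (forall e : R, 0 < e -> exists N0 : nat, forall N, (N0 <= N)%N ->
     `|\sum_(m < N) (g0 m y + g1 m y) - l| <= e) ->
  serlim g0 y + serlim g1 y = l.
Proof.
move=> s0 r0 r1 hl.
have [T0 [t0 hT0]] := rate_sumto s0 r0 `|y|; have [T1 [t1 hT1]] := rate_sumto s0 r1 `|y|.
apply/eqP; rewrite -subr_eq0 -normr_le0; apply/ler_addgt0Pr => e e0; rewrite add0r.
have e3 : 0 < e / 3 by rewrite divr_gt0.
have [N0 hN0] := t0 _ e3; have [N1 hN1] := t1 _ e3; have [N2 hN2] := hl _ e3.
have [N [l0 l1 l2]] : exists N, [/\ (N0 <= N)%N, (N1 <= N)%N & (N2 <= N)%N].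
  by exists (maxn N0 (maxn N1 N2)); split; lia.
have h0 := le_trans (hT0 N y (lexx _)) (hN0 N l0).
have h1 := le_trans (hT1 N y (lexx _)) (hN1 N l1).
have := hN2 N l2; rewrite big_split /=.
move: (serlim g0 y) (serlim g1 y) (\sum_(m < N) g0 m y) (\sum_(m < N) g1 m y) h0 h1.
move=> A B a c h0 h1 h2; have -> : A + B - l = A - a + (B - c) + (a + c - l) by ring.
apply: le_trans (normD_le (normD_le h0 h1) h2) _.
by rewrite le_eqVlt; apply/orP; left; apply/eqP; field.
Qed.

(** The telescoped sum leaves its first term, the mean of h, minus (N + 1) [Vop N h], which tends to
    h. *)
Lemma Lop_laplacian h y : sholder alpha h ->
  partial 0 (partial 0 (Lop h \o @chart R b)) y + partial 1 (partial 1 (Lop h \o @chart R b)) y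
  = 4 * qf y ^+ 2 * (sint h - h (chart b y)).
Proof.
move=> hh; have uh := sholder_UC a0 hh; have bh := UC_bounded uh.
have E i : partial i (partial i (Lop h \o @chart R b)) = serlim (fun m => L2 h m i i).
  by rewrite (pderiv_partial (pderiv_Lop bh) i) (pderiv_partial (pderiv_L1_series i hh) i).
rewrite !E; apply: (serlim_add_eq ha0 (rate_L2 0 0 hh) (rate_L2 1 1 hh)) => e e00.
have e0 (h0 : V3 -> R) : Vop 0 h0 (chart b y) = sint h0.
  by apply: sint_ext => z _; rewrite expr0 mul1r.
have tele N : \sum_(m < N) (L2 h m 0 0 y + L2 h m 1 1 y)
    = 4 * qf y ^+ 2 * (sint h - N.+1%:R * Vop N h (chart b y)).
  under eq_bigr do rewrite lapK//.
  rewrite -mulr_sumr; congr (_ * _); elim: N => [|N ih].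
    by rewrite big_ord0 e0 mul1r subrr.
  by rewrite big_ord_recr /= ih addrA subrK.
have q0 : 0 <= 4 * qf y ^+ 2 by rewrite mulr_ge0// sqr_ge0.
have c0 : 0 < e / (4 * qf y ^+ 2 + 1) by rewrite divr_gt0// ltr_wpDl.
have [N2 hN2] := Vop_approx uh c0; exists N2 => N NN; rewrite tele.
have h2 := hN2 N _ NN (chart_sphere b y).
rewrite (_ : _ - _ = - (4 * qf y ^+ 2 * (N.+1%:R * Vop N h (chart b y) - h (chart b y)))).
  rewrite normrN normrM ger0_norm//; apply: le_trans (ler_wpM2l q0 h2) _.
  by rewrite mulrCA ger_pMr// ler_pdivrMr ?ltr_wpDl// mul1r lerDl.
by move: (sint h) (Vop _ _ _) (N.+1%:R : R) => u v n; ring.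
Qed.

End LopRegularity.

(** * Rotations *)

Section Rotations.
Variable R : realType.
Local Notation V2 := 'cV[R]_2.
Local Notation V3 := 'cV[R]_3.
Local Notation S := (@sphere R).
Implicit Types (u x z : V3) (s t : R).

Definition crow u (i : 'I_3) : V3 :=
  if i == 0 then mkv3 0 (- u (2%:R) 0) (u 1 0)
  else if i == 1 then mkv3 (u (2%:R) 0) 0 (- u 0 0) else mkv3 (- u 1 0) (u 0 0) 0.

Definition crossm u : 'M[R]_3 := \matrix_(i, j) crow u i j 0.

Lemma crossmE u x : crossm u *m x = mkv3 (u 1 0 * x (2%:R) 0 - u (2%:R) 0 * x 1 0)
  (u (2%:R) 0 * x 0 0 - u 0 0 * x (2%:R) 0) (u 0 0 * x 1 0 - u 1 0 * x 0 0).
Proof.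
have e i : (crossm u *m x) i 0 = dotv (crow u i) x.
  by rewrite mxE; apply: eq_bigr => j _; rewrite mxE.
by apply: cV3P; rewrite e dotvE /crow /= !mkv3E; ring.
Qed.

Lemma crossm_tr u : (crossm u)^T = - crossm u.
Proof.
apply/matrixP => i j; rewrite !mxE; move: i j; apply: ord3_cases; apply: ord3_cases;
  by rewrite /crow /= !mkv3E ?oppr0 ?opprK.
Qed.

Lemma mulmx_ext (A B : 'M[R]_3) : (forall x, A *m x = B *m x) -> A = B.
Proof.
move=> h; apply/matrixP => i j.
by have := congr1 (fun v : V3 => v i 0) (h (delta_mx j 0)); rewrite -!colE !mxE.
Qed.

Lemma crossm3 u : S u -> crossm u *m (crossm u *m crossm u) = - crossm u.
Proof.
move=> Su; apply: mulmx_ext => x; rewrite mulNmx -!mulmxA.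
have n : u 0 0 ^+ 2 = 1 - u 1 0 ^+ 2 - u (2%:R) 0 ^+ 2.
  by rewrite -(Su : dotv u u = 1) dotvE; ring.
have e : - (crossm u *m x) = - (dotv u u) *: (crossm u *m x).
  by rewrite (Su : dotv u u = 1) scaleN1r.
by rewrite e; apply: cV3P; rewrite [RHS]mxE !crossmE !mkv3E dotvE; ring.
Qed.

(** Rodrigues' formula; for a unit axis the group law reduces to J^3 = - J. *)
Definition rot u t : 'M[R]_3 :=
  1%:M + sin t *: crossm u + (1 - cos t) *: (crossm u *m crossm u).

Lemma rotE u t x i : (rot u t *m x) i 0
  = x i 0 + sin t * (crossm u *m x) i 0 + (1 - cos t) * (crossm u *m (crossm u *m x)) i 0.
Proof. by rewrite !mulmxDl mul1mx -!scalemxAl -mulmxA !mxE. Qed.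

Lemma rot0 u : rot u 0 = 1%:M.
Proof. by rewrite /rot sin0 cos0 subrr !scale0r !addr0. Qed.

Lemma rotD u s t : S u -> rot u s *m rot u t = rot u (s + t).
Proof.
move=> Su; set J := crossm u; have J3 : J *m (J *m J) = - J by exact: crossm3.
have J4 : (J *m J) *m (J *m J) = - (J *m J) by rewrite -mulmxA J3 mulmxN.
rewrite /rot -/J sinD cosD !mulmxDl !mulmxDr !mul1mx !mulmx1.
rewrite -!scalemxAl -!scalemxAr -mulmxA J3 J4.
apply/matrixP => i j; rewrite !mxE; ring.
Qed.

Lemma rot_tr u t : (rot u t)^T = rot u (- t).
Proof.
rewrite /rot sinN cosN !linearD /= trmx1 !linearZ /= trmx_mul crossm_tr mulNmx mulmxN opprK.
by rewrite scalerN scaleNr.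
Qed.

Lemma rot_orth u t : S u -> (rot u t)^T *m rot u t = 1%:M.
Proof. by move=> Su; rewrite rot_tr rotD// addNr rot0. Qed.

Lemma rot_tau u t x : S u -> S x -> 1 - tau x (rot u t *m x) <= `|t|.
Proof.
move=> Su Sx.
have -> : 1 - tau x (rot u t *m x) = (1 - cos t) * (dotv (crossm u *m x) (crossm u *m x) / 2).
  have e : dotv x (rot u t *m x) = dotv x x - (1 - cos t) * dotv (crossm u *m x) (crossm u *m x).
    by rewrite !dotvE !rotE !crossmE !mkv3E; ring.
  by rewrite /tau e (Sx : dotv x x = 1); field.
have J1 : dotv (crossm u *m x) (crossm u *m x) <= 1.
  have e : dotv (crossm u *m x) (crossm u *m x) = dotv u u * dotv x x - dotv u x ^+ 2.
    by rewrite !dotvE !crossmE !mkv3E; ring.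
  by rewrite e (Sx : dotv x x = 1) (Su : dotv u u = 1) mulr1 gerBl sqr_ge0.
have c0 : 0 <= 1 - cos t by rewrite subr_ge0 cos_le1.
have ct : 1 - cos t <= `|t|.
  have d (s : R) : is_derive s (1 : R) (@cos R) (- sin s) by exact: is_derive_cos.
  have [s _] := mvt_real t d; rewrite cos0 => e.
  have -> : 1 - cos t = sin (s * t) * t by rewrite -opprB e mulNr opprK.
  apply: le_trans (ler_norm _) _; rewrite normrM ler_piMl// ler_norml sin_le1 andbT.
  exact: sin_geN1.
apply: le_trans ct; rewrite ler_piMr// ler_pdivrMr// mul1r; apply: le_trans J1 _.
by rewrite ler1n.
Qed.

Lemma is_derive_rot u x i : is_derive (0 : R) (1 : R) (fun t => (rot u t *m x) i 0) ((crossm u *m x) i 0).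
Proof.
have ds : is_derive (0 : R) (1 : R) (@sin R) 1 by rewrite -[X in is_derive _ _ _ X](@cos0 R); exact: is_derive_sin.
have dc : is_derive (0 : R) (1 : R) (@cos R) 0 by rewrite -[X in is_derive _ _ _ X](@oppr0 R) -[X in - X](@sin0 R); exact: is_derive_cos.
have cst c := is_derive_constr (V := R) c 0 (1 : R).
have d1 := is_derive_mulr ds (cst ((crossm u *m x) i 0)).
have d2 := is_derive_mulr (is_derive_addr (cst 1) (is_derive_mulr (cst (-1)) dc)) (cst ((crossm u *m (crossm u *m x)) i 0)).
apply: (is_derive_ext (is_derive_addr (is_derive_addr (cst (x i 0)) d1) d2)).
  by move=> t; rewrite rotE; ring.
by rewrite sin0 cos0; ring.
Qed.

End Rotations.

Section ChainRule.
Variable R : realType.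
Local Notation V2 := 'cV[R]_2.

Lemma is_derive_near (V : normedModType R) (f g : V -> R) (y v : V) (d r : R) : 0 < r ->
  (forall h : R, `|h| < r -> f (y + h *: v) = g (y + h *: v)) ->
  is_derive y v f d -> is_derive y v g d.
Proof.
move=> r0 fg /is_derive_eps hf; apply/is_derive_eps => e e0; have [r' r'0 hr] := hf e e0.
exists (Num.min r r') => [|h]; first by rewrite lt_min r0 r'0.
rewrite lt_min => /andP[h1 h2]; have y0 : g y = f y.
  by have := fg 0; rewrite scale0r addr0 normr0 => ->.
by rewrite -fg// y0; exact: hr.
Qed.

Lemma is_derive_linbound (w : R -> R) (c : R) : is_derive (0 : R) (1 : R) w c ->
  exists2 r : R, 0 < r & forall h, `|h| < r -> `|w h - w 0| <= (`|c| + 1) * `|h|.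
Proof.
move=> /is_derive_eps /(_ 1 ltr01)[r r0 hr]; exists r => // h hh; have := hr h hh.
rewrite add0r [h *: _]mulr1 mul1r => h1.
rewrite -(subrK (c * h) (w h - w 0)) addrC; apply: le_trans (ler_normD _ _) _.
by rewrite mulrDl mul1r normrM lerD2l.
Qed.

Lemma locholder_eps (alpha : R) (G : V2 -> R) y : 0 < alpha -> locholder alpha G ->
  forall e : R, 0 < e -> exists2 d : R, 0 < d & forall z, `|z - y| <= d -> `|G z - G y| <= e.
Proof.
move=> a0 hG e e0; have [C C0 hC] := locholderP hG (`|y| + 1).
have c1 : 0 < C + 1 by rewrite ltr_wpDl.
pose e1 := e / (C + 1); have e10 : 0 < e1 by rewrite divr_gt0.
pose d := e1 `^ alpha^-1; have d0 : 0 < d by rewrite powR_gt0.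
exists (Num.min d 1) => [|z]; first by rewrite lt_min d0 ltr01.
rewrite le_min => /andP[zd z1].
have yr : `|y| <= `|y| + 1 by rewrite lerDl.
have zr : `|z| <= `|y| + 1.
  by rewrite -(subrK y z) addrC; apply: le_trans (ler_normD _ _) _; rewrite lerD2l.
apply: le_trans (hC _ _ zr yr) _; apply: (@le_trans _ _ (C * e1)).
  rewrite ler_wpM2l// (_ : e1 = d `^ alpha); last first.
    by rewrite -powRrM mulVf ?gt_eqF// powRr1// ltW.
  by apply: ge0_ler_powR; rewrite ?nnegrE ?(ltW a0) ?(ltW d0).
by rewrite /e1 mulrCA ger_pMr// ler_pdivrMr// mul1r lerDl.
Qed.

(** Partial derivatives alone give no chain rule; their local Hoelder continuity allows the mean
    value points a and b to be replaced by the base point. *)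
Lemma chain_plane (alpha : R) (F : V2 -> R) dF (w : R -> V2) (c : 'I_2 -> R) : 0 < alpha ->
  pderiv F dF -> (forall i, locholder alpha (dF i)) ->
  (forall i, is_derive (0 : R) (1 : R) (fun t => w t i 0) (c i)) ->
  is_derive (0 : R) (1 : R) (fun t => F (w t)) (dF 0 (w 0) * c 0 + dF 1 (w 0) * c 1).
Proof.
move=> a0 hF hd hw; apply/is_derive_eps => e e0.
pose M : R := `|c 0| + 1 + (`|c 1| + 1).
pose A := dF 0 (w 0); pose B := dF 1 (w 0); pose D := `|A| + `|B|.
have M0 : 0 < M by rewrite addr_gt0 ?ltr_wpDl.
have D0 : 0 <= D by rewrite addr_ge0.
have [r0 r00 h0] := is_derive_linbound (hw 0); have [r1 r10 h1] := is_derive_linbound (hw 1).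
have e1 : 0 < e / 2 / M by rewrite !divr_gt0.
have [d0 d00 hd0] := locholder_eps (w 0) a0 (hd 0) e1.
have [d1 d10 hd1] := locholder_eps (w 0) a0 (hd 1) e1.
have e2 : 0 < e / 2 / (D + 1) by rewrite !divr_gt0// ltr_wpDl.
have /is_derive_eps /(_ _ e2)[r2 r20 h2] := hw 0; have /is_derive_eps /(_ _ e2)[r3 r30 h3] := hw 1.
pose d := Num.min d0 d1; have dp : 0 < d by rewrite lt_min d00 d10.
exists (Num.min (d / M) (Num.min (Num.min r0 r1) (Num.min r2 r3))) => [|h].
  by rewrite !lt_min r00 r10 r20 r30 divr_gt0.
rewrite !lt_min => /andP[hM /andP[/andP[hr0 hr1] /andP[hr2 hr3]]].
rewrite add0r [h *: _]mulr1.
have k0 := h0 h hr0; have k1 := h1 h hr1.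
have k2 := h2 h hr2; have k3 := h3 h hr3; rewrite !add0r [h *: _]mulr1 in k2 k3.
have n0 : 0 <= `|h| by [].
have wd : `|w h - w 0| <= d.
  apply: (@le_trans _ _ (M * `|h|)); last by rewrite mulrC -ler_pdivlMr// ltW.
  apply/normV2_le; split; first by rewrite mulr_ge0 ?(ltW M0).
  apply: ord2_cases; rewrite !mxE.
    by apply: le_trans k0 _; rewrite ler_wpM2r// /M lerDl addr_ge0.
  by apply: le_trans k1 _; rewrite ler_wpM2r// /M lerDr addr_ge0.
have [a [b [ba bb ->]]] := mvt_plane (w 0) (w h) hF.
have ha := le_trans (between_dist ba) wd; have hb := le_trans (between_dist bb) wd.
have fa : `|dF 0 a - dF 0 (w 0)| <= e / 2 / M.
  by apply: hd0; apply: le_trans ha _; rewrite ge_min lexx.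
have fb : `|dF 1 b - dF 1 (w 0)| <= e / 2 / M.
  by apply: hd1; apply: le_trans hb _; rewrite ge_min lexx orbT.
set A0 := dF 0 a in fa *; set B0 := dF 1 b in fb *.
rewrite -/A -/B in fa fb *.
set u := w h 0 0 - w 0 0 0 in k0 k2 *; set v := w h 1 0 - w 0 1 0 in k1 k3 *.
have -> : A0 * u + B0 * v - (A * c 0 + B * c 1) * h
  = (A0 - A) * u + (B0 - B) * v + (A * (u - c 0 * h) + B * (v - c 1 * h)) by ring.
have N (n : R) : `|n| <= `|n| by [].
apply: le_trans (normD_le (normD_le (normM_le fa k0) (normM_le fb k1))
  (normD_le (normM_le (N A) k2) (normM_le (N B) k3))) _.
have -> : e / 2 / M * ((`|c 0| + 1) * `|h|) + e / 2 / M * ((`|c 1| + 1) * `|h|) = e / 2 * `|h|.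
  by rewrite -mulrDr -mulrDl -/M mulrA divfK// gt_eqF.
have -> : `|A| * (e / 2 / (D + 1) * `|h|) + `|B| * (e / 2 / (D + 1) * `|h|)
    = (D / (D + 1)) * (e / 2 * `|h|).
  by rewrite -mulrDl -/D; field; rewrite gt_eqF// ltr_wpDl.
have q : D / (D + 1) <= 1 by rewrite ler_pdivrMr ?mul1r ?lerDl// ltr_wpDl.
have p : 0 <= e / 2 * `|h| by rewrite mulr_ge0// divr_ge0// ltW.
have := ler_wpM2r p q; rewrite mul1r => H; apply: le_trans (lerD (lexx _) H) _.
by rewrite le_eqVlt; apply/orP; left; apply/eqP; field.
Qed.

End ChainRule.

(** * Derivatives along rotations, which commute with L *)

Section RotationDerivative.
Variable R : realType.
Local Notation V2 := 'cV[R]_2.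
Local Notation V3 := 'cV[R]_3.
Local Notation S := (@sphere R).
Variable alpha : R.
Hypothesis a0 : 0 < alpha.
Hypothesis a1 : alpha < 1.
Implicit Types (b : bool) (u x z : V3) (y : V2) (f h : V3 -> R).

Let a1' : alpha <= 1 := ltW a1.

Definition emb (i : 'I_2) : 'I_3 := if i == 0 then 0 else 1.

(* The components in the chart b of the vector field x |-> crossm u *m x. *)
Definition xi u b (i : 'I_2) y : R := (1 + sqn y) / 2 *
  ((crossm u *m chart b y) (emb i) 0 + csgn R b * y i 0 * (crossm u *m chart b y) (2%:R) 0).

Lemma Hc_xi k u b i : Hc k alpha (xi u b i).
Proof.
have hJ j : Hc k alpha (fun y => (crossm u *m chart b y) j 0).
  rewrite (_ : (fun y => _) = fun y => \sum_k crossm u j k * chart b y k 0).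
    by apply: Hc_sum => l; apply: HcZ => //; exact: Hc_chart.
  by apply/funext => y; rewrite mxE.
have hc j : Hc k alpha (fun y : V2 => y j 0 ^+ 2).
  rewrite (_ : (fun y => _) = fun y : V2 => y j 0 * y j 0).
    by apply: HcM => //; exact: Hc_coord.
  by apply/funext => y; rewrite expr2.
apply: HcM => //.
  rewrite (_ : (fun y => _) = fun y : V2 => 2^-1 * (1 + sqn y)).
    by apply: HcZ => //; apply: HcD; [exact: Hc_cst|apply: HcD].
  by apply/funext => y; rewrite mulrC.
apply: HcD; first exact: hJ.
apply: HcM => //; apply: HcZ => //; exact: Hc_coord.
Qed.

Lemma sum3 (F : 'I_3 -> R) : \sum_a F a = F 0 + F 1 + F (2%:R).
Proof.
rewrite !big_ord_recl big_ord0 addr0 addrA.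
by congr (F _ + F _ + F _); apply: val_inj.
Qed.

Lemma basis3 (a j : 'I_3) : basisv R a j 0 = (j == a)%:R.
Proof. by rewrite /basisv mxE eqxx andbT. Qed.

Lemma cross_frame x (i j : 'I_3) : \sum_a (crossm (basisv R a) *m x) i 0 * (crossm (basisv R a) *m x) j 0
  = (i == j)%:R * dotv x x - x i 0 * x j 0.
Proof.
rewrite sum3 !crossmE dotvE !basis3; move: i j.
by apply: ord3_cases; apply: ord3_cases; rewrite !mkv3E /=; ring.
Qed.

Lemma basis_sphere (a : 'I_3) : S (basisv R a).
Proof.
rewrite /sphere /= dotvE !basis3; move: a.
by apply: ord3_cases => /=; ring.
Qed.

(** The rotation fields of the three axes form a tight frame of each tangent plane: their squares
    sum to |x|^2 - x x^T. In the chart this is the inverse of the round metric. *)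
Lemma xi_frame b i j y :
  \sum_(a < 3) xi (basisv R a) b i y * xi (basisv R a) b j y = (i == j)%:R * ((1 + sqn y) / 2) ^+ 2.
Proof.
set x := chart b y; set k := (1 + sqn y) / 2.
have e : \sum_(a < 3) xi (basisv R a) b i y * xi (basisv R a) b j y = k ^+ 2 *
  (\sum_a (crossm (basisv R a) *m x) (emb i) 0 * (crossm (basisv R a) *m x) (emb j) 0
   + csgn R b * y j 0 * (\sum_a (crossm (basisv R a) *m x) (emb i) 0 * (crossm (basisv R a) *m x) (2%:R) 0)
   + csgn R b * y i 0 * (\sum_a (crossm (basisv R a) *m x) (emb j) 0 * (crossm (basisv R a) *m x) (2%:R) 0)
   + (csgn R b * csgn R b) * (y i 0 * y j 0) *
     (\sum_a (crossm (basisv R a) *m x) (2%:R) 0 * (crossm (basisv R a) *m x) (2%:R) 0)).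
  by rewrite !sum3 /xi -/x -/k; ring.
have xe l : x (emb l) 0 = 2 * y l 0 * qf y.
  by move: l; apply: ord2_cases; rewrite /x chartE mkv3E.
have n2 l : (emb l == 2%:R) = false by move: l; apply: ord2_cases.
have ne : (emb i == emb j) = (i == j) by move: i j {e}; apply: ord2_cases; apply: ord2_cases.
rewrite e !cross_frame !n2 eqxx ne (chart_sphere b y : dotv x x = 1) !xe {2}/x.
rewrite !chart2E csgnK.
have c2 : csgn R b * (1 - 2 * qf y) * (csgn R b * (1 - 2 * qf y)) = (1 - 2 * qf y) ^+ 2.
  by rewrite mulrACA csgnK mul1r expr2.
rewrite c2; move: ((i == j)%:R : R) => d /=.
transitivity (k ^+ 2 * (d - 4 * y i 0 * y j 0 * qf y ^+ 2
  - (csgn R b * csgn R b) * 4 * (y i 0 * y j 0) * qf y * (1 - 2 * qf y)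
  + y i 0 * y j 0 * (1 - (1 - 2 * qf y) ^+ 2))); first by ring.
by rewrite csgnK; ring.
Qed.

Lemma is_derive_proj u b y i : is_derive (0 : R) (1 : R)
  (fun t => proj b (rot u t *m chart b y) i 0) (xi u b i y).
Proof.
set x := chart b y.
pose den t := 1 - csgn R b * (rot u t *m x) (2%:R) 0.
have den0 : den 0 = 2 * qf y.
  by rewrite /den rot0 mul1mx /x chart2E mulrA csgnK; ring.
have q0 : qf y != 0 by rewrite gt_eqF// qf_gt0.
have nz : den 0 != 0 by rewrite den0 mulf_neq0// pnatr_eq0.
have cst c := is_derive_constr (V := R) c 0 (1 : R).
have dd : is_derive (0 : R) (1 : R) den (- csgn R b * (crossm u *m x) (2%:R) 0).
  apply: (is_derive_ext (is_derive_addr (cst 1) (is_derive_mulr (cst (- csgn R b)) (is_derive_rot u x (2%:R))))).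
    by move=> t; rewrite /den mulNr.
  by rewrite mul0r !add0r.
have dv : is_derive (den 0) 1 (fun t : R => t^-1) (- (den 0) ^- 2).
  apply: (is_derive_ext (@is_deriveV R id (den 0) 1 1 nz (is_derive_id _ _))) => //.
  by rewrite -[LHS]/(- (den 0) ^- 2 * 1) mulr1.
have di := @is_derive_chain R _ den (fun t => t^-1) 0 1 _ _ dv dd.
have dm := is_derive_mulr (is_derive_rot u x (emb i)) di.
have e (t : R) : (rot u t *m x) (emb i) 0 * (den t)^-1 = proj b (rot u t *m x) i 0.
  by move: i {dm}; apply: ord2_cases; rewrite projE.
apply: (is_derive_ext dm e); rewrite rot0 mul1mx den0 /xi -/x.
have xe : x (emb i) 0 = 2 * y i 0 * qf y.
  by move: i {dm e}; apply: ord2_cases; rewrite /x chartE mkv3E.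
have -> : 1 + sqn y = (qf y)^-1 by rewrite /qf invrK.
by rewrite xe; field.
Qed.

Lemma is_derive_rot_chart u b y f : S u -> Hc 1 alpha (f \o @chart R b) ->
  is_derive (0 : R) (1 : R) (fun t => f (rot u t *m chart b y))
    (xi u b 0 y * partial 0 (f \o @chart R b) y + xi u b 1 y * partial 1 (f \o @chart R b) y).
Proof.
move=> Su /HcS_inv[pF hF]; set x := chart b y.
have H := chain_plane a0 pF hF (fun i => is_derive_proj u b y i).
have w0 : proj b (rot u 0 *m x) = y by rewrite rot0 mul1mx proj_chart.
have [r r0 hr] := is_derive_linbound (is_derive_rot u x (2%:R)).
pose c : R := `|(crossm u *m x) (2%:R) 0| + 1; have c0 : 0 < c by rewrite ltr_wpDl.
have q0 := qf_gt0 y.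
(* The quantity 1 - csgn x_2, which vanishes at the pole of the chart, is 2 qf y at time 0 and
   changes by less than qf y for such t; hence [chart_proj] applies. *)
have rr : 0 < Num.min r (qf y / c) by rewrite lt_min r0 divr_gt0.
pose g t := f (chart b (proj b (rot u t *m x))).
apply: (@is_derive_near R _ g _ _ _ _ _ rr); last first.
  apply: (is_derive_ext H (fun _ => erefl)).
  by rewrite w0; congr (_ + _); exact: mulrC.
move=> t; rewrite lt_min => /andP[tr tq]; rewrite add0r [t *: _]mulr1 /g chart_proj//.
  by apply: orth_sphere; [exact: rot_orth|exact: chart_sphere].
have := le_lt_trans (hr t tr) (_ : _ < qf y); rewrite -/c mulrC -ltr_pdivlMr// => /(_ tq).
rewrite rot0 mul1mx {2}/x chart2E => ht; rewrite lt_eqF//.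
have : csgn R b * ((rot u t *m x) (2%:R) 0 - csgn R b * (1 - 2 * qf y)) < qf y.
  apply: le_lt_trans (ler_norm _) _; rewrite normrM.
  by rewrite /csgn normrX normrN1 expr1n mul1r.
by rewrite mulrBr [csgn R b * (csgn R b * _)]mulrA csgnK; move: q0; lra.
Qed.

Definition Xd u f x : R := 'D_1 (fun t : R => f (rot u t *m x)) 0.

Lemma Xd_chart u b y f : S u -> Hc 1 alpha (f \o @chart R b) -> Xd u f (chart b y)
  = xi u b 0 y * partial 0 (f \o @chart R b) y + xi u b 1 y * partial 1 (f \o @chart R b) y.
Proof. by move=> Su hf; have [_ <-] := is_derive_rot_chart y Su hf. Qed.

Lemma is_derive_Xd u x f t : S u -> S x -> (forall b, Hc 1 alpha (f \o @chart R b)) ->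
  is_derive (t : R) (1 : R) (fun s => f (rot u s *m x)) (Xd u f (rot u t *m x)).
Proof.
move=> Su Sx hf.
have Sr : S (rot u t *m x) by apply: orth_sphere => //; exact: rot_orth.
have [b [y [ey _]]] := chart_surj Sr.
have := is_derive_rot_chart y Su (hf b); rewrite -(Xd_chart y Su (hf b)) ey.
move=> /is_derive_eps h; apply/is_derive_eps => e e0; have [r r0 hr] := h e e0.
exists r => // k kr; have := hr k kr.
by rewrite add0r [k *: _]mulr1 rot0 mul1mx mulmxA rotD// [k + t]addrC.
Qed.

Lemma Hc_Xd k u f : S u -> (forall b, Hc k.+1 alpha (f \o @chart R b)) ->
  forall b, Hc k alpha (Xd u f \o @chart R b).
Proof.
move=> Su hf b; have h1 : Hc 1 alpha (f \o @chart R b) by apply: (@Hc_le _ _ a0 a1' k.+1).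
rewrite (_ : _ \o _ = fun y => xi u b 0 y * partial 0 (f \o @chart R b) y
  + xi u b 1 y * partial 1 (f \o @chart R b) y); last first.
  by apply/funext => y; rewrite -Xd_chart.
have [_ h] := HcS_inv (hf b).
by apply: HcD; apply: HcM => //; exact: Hc_xi.
Qed.

(** Uniformity in x is the point, since L is controlled in sup norm; it comes from the uniform
    continuity of the derivative. *)
Lemma rot_increment u f (e : R) : S u -> (forall b, Hc 1 alpha (f \o @chart R b)) -> 0 < e ->
  exists2 r : R, 0 < r & forall t x, `|t| < r -> S x ->
    `|f (rot u t *m x) - f x - t * Xd u f x| <= e * `|t|.
Proof.
move=> Su hf e0; have uX : UC (Xd u f).
  by apply: (sholder_UC a0); apply: locholder_sholder => //; exact: (@Hc_Xd 0 u f Su hf).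
have e2 : 0 < e / 2 by rewrite divr_gt0.
have [C C0 hC] := uX _ e2; have c1 : 0 < C + 1 by rewrite ltr_wpDl.
exists (e / 2 / (C + 1)) => [|t x tr Sx]; first by rewrite divr_gt0.
have [s s01] := mvt_real t (fun s => is_derive_Xd s Su Sx hf).
rewrite rot0 mul1mx => ->.
set z := rot u (s * t) *m x.
have Sz : S z by apply: orth_sphere => //; exact: rot_orth.
rewrite (_ : _ - _ = (Xd u f z - Xd u f x) * t); last by ring.
rewrite normrM ler_wpM2r// distrC; apply: le_trans (hC _ _ Sx Sz) _.
have st : 1 - tau x z <= `|t|.
  apply: le_trans (rot_tau (s * t) Su Sx) _; rewrite normrM ler_piMl//.
  by case/andP: s01 => ? ?; rewrite ger0_norm.
have : C * (1 - tau x z) <= e / 2.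
  apply: (@le_trans _ _ (C * (e / 2 / (C + 1)))).
    by rewrite ler_wpM2l//; apply: le_trans st (ltW tr).
  by rewrite mulrCA ger_pMr// ler_pdivrMr// mul1r lerDl.
by move: (C * _) => k; lra.
Qed.

(** L commutes with rotations, so a difference quotient of L h is L of that of h, and these converge
    uniformly. *)
Lemma Xd_Lop u h x : S u -> S x -> (forall b, Hc 1 alpha (h \o @chart R b)) ->
  Xd u (Lop h) x = Lop (Xd u h) x.
Proof.
move=> Su Sx hh.
have uh : UC h.
  by apply: (sholder_UC a0); apply: locholder_sholder => // b; exact: Hc_locholder (hh b).
have uX : UC (Xd u h).
  by apply: (sholder_UC a0); apply: locholder_sholder => //; exact: (@Hc_Xd 0 u h Su hh).
suff [_ e] : is_derive (0 : R) (1 : R) (fun t => Lop h (rot u t *m x)) (Lop (Xd u h) x) by exact: e.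
apply/is_derive_eps => e e0; have [r r0 hr] := rot_increment Su hh e0.
exists r => // t tr; rewrite add0r [t *: _]mulr1 rot0 mul1mx Lop_orth//; last exact: rot_orth.
have b1 : bounded_on S (fun z => h (rot u t *m z)).
  by apply: bounded_on_orth; [exact: rot_orth|exact: UC_bounded].
have bh := UC_bounded uh; have bX := UC_bounded uX.
have -> : Lop (fun z => h (rot u t *m z)) x - Lop h x - Lop (Xd u h) x * t
    = Lop (fun z => (h (rot u t *m z) + -1 * h z) + (- t) * Xd u h z) x.
  rewrite !LopD ?LopZ//; try exact: bounded_onZ; last by apply: bounded_onD => //; exact: bounded_onZ.
  by rewrite mulN1r mulNr [t * _]mulrC.
apply: Lop_bound => // z Sz; apply: le_trans (hr t z tr Sz).
by rewrite mulN1r mulNr.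
Qed.

(** Inverts [xi_frame]. Coordinate derivatives do not commute with L, but they are combinations with
    regular coefficients of rotation derivatives, which do. *)
Lemma partial_of_Xd b i y f : Hc 1 alpha (f \o @chart R b) ->
  partial i (f \o @chart R b) y
  = 4 * qf y ^+ 2 * \sum_a xi (basisv R a) b i y * Xd (basisv R a) f (chart b y).
Proof.
move=> hf.
have [P [-> E]] : exists P : 'I_2 -> R, partial i (f \o @chart R b) y = P i /\ forall a,
    Xd (basisv R a) f (chart b y) = xi (basisv R a) b 0 y * P 0 + xi (basisv R a) b 1 y * P 1.
  exists (fun j => partial j (f \o @chart R b) y); split => // a.
  exact: (Xd_chart y (basis_sphere a) hf).
have -> : \sum_a xi (basisv R a) b i y * Xd (basisv R a) f (chart b y)
  = (\sum_a xi (basisv R a) b i y * xi (basisv R a) b 0 y) * P 0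
    + (\sum_a xi (basisv R a) b i y * xi (basisv R a) b 1 y) * P 1.
  rewrite !mulr_suml -big_split; apply: eq_bigr => a _; rewrite E /=.
  by rewrite mulrDr !mulrA.
rewrite !xi_frame.
have q0 : qf y != 0 by rewrite gt_eqF// qf_gt0.
have -> : 1 + sqn y = (qf y)^-1 by rewrite /qf invrK.
move: (qf y) q0 => q q0 {E hf}.
by move: i; apply: ord2_cases => /=; field.
Qed.

Lemma Lop_Hc k h : (forall b, Hc k alpha (h \o @chart R b)) ->
  forall b, Hc k.+2 alpha (Lop h \o @chart R b).
Proof.
elim: k h => [|k ih] h hh b; first by apply: Lop_Hc2 => //; exact: locholder_sholder.
have h1 b' : Hc 1 alpha (h \o @chart R b') by apply: (@Hc_le _ _ a0 a1' k.+1).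
have L2' b' : Hc 2 alpha (Lop h \o @chart R b').
  apply: Lop_Hc2 => //; apply: locholder_sholder => // b''; exact: Hc_locholder (h1 b'').
have L1' b' : Hc 1 alpha (Lop h \o @chart R b') by apply: (@Hc_le _ _ a0 a1' 2).
have [pL _] := HcS_inv (L1' b).
apply: (HcSP pL) => i.
rewrite (_ : partial i _ = fun y => 4 * (qf y * qf y) *
    \sum_a xi (basisv R a) b i y * (Lop (Xd (basisv R a) h) \o @chart R b) y).
  apply: HcM => //; first by apply: HcZ => //; apply: HcM => //; exact: Hc_qf.
  apply: Hc_sum => a; apply: HcM => //; first exact: Hc_xi.
  by apply: ih; apply: Hc_Xd => //; exact: basis_sphere.
apply/funext => y; rewrite partial_of_Xd// expr2; congr (_ * _); apply: eq_bigr => a _.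
by rewrite Xd_Lop//; [exact: basis_sphere|exact: chart_sphere].
Qed.

End RotationDerivative.

(** * Curvature of conformal metrics *)

Section ConformalPlane.
Variable R : realType.
Local Notation V2 := 'cV[R]_2.
Implicit Types y : V2.
Variables (phi : V2 -> R) (lam : 'I_2 -> V2 -> R) (llam : 'I_2 -> 'I_2 -> V2 -> R).
Hypothesis phi0 : forall y, 0 < phi y.
(* lam is the gradient of (ln phi) / 2. *)
Hypothesis dphi : pderiv phi (fun i y => 2 * phi y * lam i y).
Hypothesis dlam : forall i, pderiv (lam i) (fun k => llam k i).

Lemma christoffel_conformal (k i j : 'I_2) y :
  christoffel (fun z => (phi z)%:M : 'M[R]_2) k i j y
  = (k == j)%:R * lam i y + (k == i)%:R * lam j y - (i == j)%:R * lam k y.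
Proof.
have dG (l p q : 'I_2) : partial l (fun z => ((phi z)%:M : 'M[R]_2) p q) y
    = (p == q)%:R * (2 * phi y * lam l y).
  have h : is_derive y (basisv R l) (fun z => ((phi z)%:M : 'M[R]_2) p q)
      ((p == q)%:R * (2 * phi y * lam l y)).
    apply: (is_derive_ext (is_derive_mulr (is_derive_constr (p == q)%:R y (basisv R l)) (dphi l y))).
      by move=> z; rewrite mxE mulr_natl.
    by rewrite mul0r add0r.
  by have [_ <-] := h.
have p0 : phi y != 0 by rewrite gt_eqF.
rewrite /christoffel invmx_scalar (bigD1 k)//= big1 ?addr0 => [|l lk]; last first.
  by rewrite mxE eq_sym (negbTE lk) mulr0n mul0r.
rewrite mxE eqxx mulr1n !dG ![k == _]eq_sym.
move: ((j == k)%:R : R) ((i == k)%:R : R) ((i == j)%:R : R) (lam i y) (lam j y) (lam k y).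
by move=> *; field.
Qed.

(** The classical K = - Laplacian (ln phi) / (2 phi); in dimension two the terms quadratic in [lam]
    cancel. *)
Lemma gauss_conformal y : gauss_curvature_plane (fun z => (phi z)%:M) y
  = - (llam 0 0 y + llam 1 1 y) / phi y.
Proof.
have p0 : phi y != 0 by rewrite gt_eqF.
have C k i j : christoffel (fun z => (phi z)%:M : 'M[R]_2) k i j = fun y =>
    (k == j)%:R * lam i y + (k == i)%:R * lam j y - (i == j)%:R * lam k y.
  by apply/funext => z; exact: christoffel_conformal.
have d011 : partial 0 (christoffel (fun z => (phi z)%:M : 'M[R]_2) 0 1 1) y = - llam 0 0 y.
  have h : is_derive y (basisv R 0) (christoffel (fun z => (phi z)%:M : 'M[R]_2) 0 1 1) (- llam 0 0 y).
    apply: (is_derive_ext (is_derive_mulr (is_derive_constr (-1) y (basisv R 0)) (dlam 0 0 y))).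
      by move=> z; rewrite C /=; ring.
    by ring.
  by have [_ <-] := h.
have d101 : partial 1 (christoffel (fun z => (phi z)%:M : 'M[R]_2) 0 0 1) y = llam 1 1 y.
  have h : is_derive y (basisv R 1) (christoffel (fun z => (phi z)%:M : 'M[R]_2) 0 0 1) (llam 1 1 y).
    apply: (is_derive_ext (dlam 1 1 y)) => // z; rewrite C /=; ring.
  by have [_ <-] := h.
rewrite /gauss_curvature_plane (bigD1 0)//= big1 ?addr0 => [|l l0]; last first.
  by rewrite [X in _ * X]mxE (negbTE l0) mulr0n mulr0.
rewrite det_scalar mxE eqxx mulr1n /riemann d011 d101 !big_ord_recl big_ord0 addr0.
rewrite !christoffel_conformal (_ : lift ord0 ord0 = 1); last exact: val_inj.
rewrite /= ?eqxx /=.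
move: (lam _ _) (lam _ _) (llam _ _ _) (llam _ _ _) (phi y) p0 => *; by field.
Qed.

End ConformalPlane.

Section ConformalSphere.
Variable R : realType.
Local Notation V2 := 'cV[R]_2.
Local Notation V3 := 'cV[R]_3.
Local Notation S := (@sphere R).

Lemma derive_chart b i (y : V2) :
  'D_(basisv R i) (@chart R b) y = \col_j Xp b [:: i] j y.
Proof.
have d : derivable (@chart R b) y (basisv R i).
  by apply/derivable_mxP => j k; rewrite (ord1 k); have [] := pderiv_Xp b [::] j i y.
by rewrite derive_mx//; apply/matrixP => j k; rewrite !mxE (ord1 k).
Qed.

Lemma dotv_derive_chart b i (y : V2) (z : V3) :
  dotv ('D_(basisv R i) (@chart R b) y) z = 2 * lin1f b i y z.
Proof.
rewrite derive_chart -lin1E linE mulr_sumr; apply: eq_bigr => j _.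
by rewrite mxE; field.
Qed.

Lemma derive_chart_frame b i j (y : V2) :
  dotv ('D_(basisv R i) (@chart R b) y) ('D_(basisv R j) (@chart R b) y)
  = (i == j)%:R * (4 * qf y ^+ 2).
Proof.
have c k : ('D_(basisv R j) (@chart R b) y) k 0 = 2 * lin1f b j y (basisv R k).
  by rewrite -dotv_derive_chart dotvE !basis3; move: k; apply: ord3_cases => /=; ring.
set D := 'D_(basisv R j) _ y in c *; have e := sqn_qf y; rewrite /sqn in e.
have W : wz b D = 4 * qf y ^+ 2 * y j 0.
  rewrite /wz c /lin1f /zc /pz /wz !basis3 /= mulr1.
  transitivity (csgn R b * csgn R b * (4 * qf y ^+ 2 * y j 0)); last by rewrite csgnK mul1r.
  by case: ifP => _; ring.
have Z k : zc k D = 2 * (qf y * (k == j)%:R - 2 * qf y ^+ 2 * y k 0 * y j 0).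
  have -> : zc k D = D (emb k) 0 by move: k; apply: ord2_cases.
  rewrite c /lin1f /zc /pz /wz !basis3 {W c D}; move: k j.
  by apply: ord2_cases; apply: ord2_cases; rewrite /emb /=; ring.
have P : pz y D = - 2 * qf y * y j 0 + 4 * qf y ^+ 2 * y j 0.
  rewrite /pz -[D 0 0]/(zc 0 D) -[D 1 0]/(zc 1 D) !Z.
  transitivity (2 * (qf y * (y 0 0 * (0 == j)%:R + y 1 0 * (1 == j)%:R)
    - 2 * ((y 0 0 ^+ 2 + y 1 0 ^+ 2) * qf y) * qf y * y j 0)); first by ring.
  rewrite e (_ : y 0 0 * _ + _ = y j 0); first by ring.
  by move: j {c D W Z}; apply: ord2_cases => /=; ring.
by rewrite dotv_derive_chart /lin1f W P Z; ring.
Qed.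

Lemma metric_coef_conformal (g : V3 -> R) b :
  metric_coef (fun x v w => g x * dotv v w) b
  = fun y => (g (chart b y) * (4 * qf y ^+ 2))%:M.
Proof.
apply/funext => y; apply/matrixP => i j; rewrite !mxE derive_chart_frame.
by rewrite -mulr_natl; ring.
Qed.

End ConformalSphere.

(** * The theorem *)

Section Breaking.
Variable R : realType.
Local Notation V3 := 'cV[R]_3.
Local Notation S := (@sphere R).
Implicit Types (p x y : V3) (A : 'M[R]_3).

Lemma dotvDl x y z : dotv (x + y) z = dotv x z + dotv y z :> R.
Proof. by rewrite /dotv -big_split; apply: eq_bigr => i _; rewrite mxE mulrDl. Qed.

Lemma dotvZl (c : R) x z : dotv (c *: x) z = c * dotv x z.
Proof. by rewrite /dotv mulr_sumr; apply: eq_bigr => i _; rewrite mxE mulrA. Qed.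

Lemma dotv_eq0 x : dotv x x = 0 -> x = 0.
Proof.
rewrite dotvE -!expr2 => h.
have h0 := sqr_ge0 (x 0 0); have h1 := sqr_ge0 (x 1 0); have h2 := sqr_ge0 (x (2%:R) 0).
have z i : x i 0 ^+ 2 = 0 -> x i 0 = 0 by move/eqP; rewrite sqrf_eq0 => /eqP.
by apply: cV3P; rewrite mxE; apply: z; lra.
Qed.

Lemma dilation_commute A p (t : R) x : A^T *m A = 1%:M -> A *m p = p ->
  A *m dilation p t x = dilation p t (A *m x).
Proof.
move=> AA Ap; have inj : (A *m x == p) = (x == p).
  apply/eqP/eqP => [h|->//]; have : A^T *m (A *m x) = A^T *m (A *m p) by rewrite h Ap.
  by rewrite !mulmxA AA !mul1mx.
rewrite /dilation inj; case: ifP => // _.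
have d : dotv (A *m x) p = dotv x p by rewrite -{1}Ap orth_dotvM.
have st : stereo p (A *m x) = A *m stereo p x.
  by rewrite /stereo d -{3}Ap scalemxAr -mulmxBr scalemxAr.
rewrite st scalemxAr /inv_stereo orth_dotvM// -!scalemxAr mulmxDr -!scalemxAr Ap.
by [].
Qed.

Lemma orthogonal_exists p : S p -> exists2 x, S x & dotv x p = 0.
Proof.
move=> Sp; pose s := p 0 0 ^+ 2 + p 1 0 ^+ 2.
have [s0|s0] := eqVneq s 0.
  exists (mkv3 1 0 0); first by rewrite /sphere /= dotvE !mkv3E; ring.
  have h0 := sqr_ge0 (p 0 0); have h1 := sqr_ge0 (p 1 0).
  have : p 0 0 ^+ 2 = 0 by move: s0; rewrite /s; lra.
  by move/eqP; rewrite sqrf_eq0 dotvE !mkv3E => /eqP ->; ring.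
have sp : 0 < s by rewrite lt_neqAle eq_sym s0 addr_ge0 ?sqr_ge0.
exists ((Num.sqrt s)^-1 *: mkv3 (- p 1 0) (p 0 0) 0); last first.
  by rewrite dotvZl dotvE !mkv3E; ring.
rewrite /sphere /= dotvZl dotvC dotvZl mulrA -invfM -expr2 sqr_sqrtr ?(ltW sp)//.
rewrite dotvE !mkv3E (_ : _ + _ = s); last by rewrite /s; ring.
by rewrite mulVf.
Qed.

(** A point orthogonal to p is moved to height (4 - 1) / (4 + 1) along p. *)
Lemma dilation_nontrivial p : S p -> ~ (forall x, S x -> dilation p 2 x = x).
Proof.
move=> Sp h; have [x Sx xp] := orthogonal_exists Sp.
have := congr1 (fun z => dotv z p) (h x Sx); rewrite /= xp /dilation.
case: eqP => [e|_]; first by rewrite (Sp : dotv p p = 1) => /eqP; rewrite oner_eq0.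
rewrite /stereo xp scale0r !subr0 invr1 scale1r /inv_stereo.
have -> : dotv (2 *: x) (2 *: x) = 4 by rewrite dotvZl dotvC dotvZl (Sx : dotv x x = 1); ring.
rewrite dotvZl dotvDl !dotvZl xp (Sp : dotv p p = 1) !mulr0 add0r mulr1.
by move=> /eqP; rewrite mulf_eq0 invr_eq0 => /orP[] /eqP; lra.
Qed.

(** A nonzero fixed vector would be the axis of a dilation commuting with all of Gamma; any factor
    other than 1 would do in place of 2. *)
Lemma breaking_no_fixed (Gamma : set 'M[R]_3) (v : V3) : (forall A, Gamma A -> A^T *m A = 1%:M) ->
  breaks_conformal_action Gamma -> (forall A, Gamma A -> A *m v = v) -> v = 0.
Proof.
move=> GO hb fv; apply: contrapT => v0.
have n0 : 0 < dotv v v.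
  by rewrite lt_neqAle dotv_ge0 andbT eq_sym; apply/eqP => /dotv_eq0.
pose p := (Num.sqrt (dotv v v))^-1 *: v.
have Sp : S p.
  by rewrite /sphere /= dotvZl dotvC dotvZl mulrA -invfM -expr2 sqr_sqrtr ?(ltW n0)// mulVf// gt_eqF.
have [||A GA []] := hb (dilation p 2).
- by exists p, 2; split.
- exact: dilation_nontrivial.
move=> x _; apply: dilation_commute; first exact: GO.
by rewrite -scalemxAr fv.
Qed.

End Breaking.

(** * Regularity of solutions of the mean field equation *)

Section Bootstrap.
Variable R : realType.
Local Notation V2 := 'cV[R]_2.
Local Notation V3 := 'cV[R]_3.
Local Notation S := (@sphere R).
Variable alpha : R.
Hypothesis a0 : 0 < alpha.
Hypothesis a1 : alpha < 1.
Variables (K v : V3 -> R) (c : R) (k : nat).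
Hypothesis hK : forall b, Hc k alpha (K \o @chart R b).
Hypothesis bv : bounded_on S v.
Let w := fun y => K y * expR (2 * v y).
Hypothesis hv : forall x, S x -> v x = c + Lop w x.

Lemma v_chart b : v \o @chart R b = fun y => c + (Lop w \o @chart R b) y.
Proof. by apply/funext => y; rewrite /= hv//; exact: chart_sphere. Qed.

(** L gains two orders on a density as regular as v; climbing by one order at a time already reaches
    the regularity k of K. *)
Lemma mean_field_Hc l b : (l <= k)%N -> Hc l alpha (v \o @chart R b).
Proof.
have a1' := ltW a1; elim: l b => [|l ih] b lk.
  rewrite v_chart; apply: HcD; first exact: Hc_cst.
  apply: (Lop_locholder b a1); apply: bounded_onM.
    by apply: charts_bounded => b'; exact: Hc_bounded (hK b').
  by apply: bounded_on_expR; exact: bounded_onZ.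
rewrite v_chart; apply: HcD; first exact: Hc_cst.
have lk' := ltnW lk.
apply: (Hc_le a0 a1' (leqnSn l.+1)); apply: Lop_Hc => // b'.
apply: HcM => //; first exact: Hc_le lk' (hK b').
by apply: Hc_expR => //; apply: HcZ => //; exact: ih.
Qed.

Lemma density_Hc b : Hc k alpha (w \o @chart R b).
Proof.
have a1' := ltW a1; apply: (HcM a0 a1' (hK b)); apply: (Hc_expR a0 a1').
by apply: (HcZ a0 a1' 2); exact: mean_field_Hc.
Qed.

Lemma solution_Hc b : Hc k.+2 alpha (v \o @chart R b).
Proof.
rewrite v_chart; apply: HcD; first exact: Hc_cst.
by apply: Lop_Hc => // b'; exact: density_Hc.
Qed.

Lemma solution_laplacian b y : sint w = 1 ->
  partial 0 (partial 0 (v \o @chart R b)) y + partial 1 (partial 1 (v \o @chart R b)) y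
  = 4 * qf y ^+ 2 * (1 - w (chart b y)).
Proof.
move=> w1; have sw : sholder alpha w.
  by apply: locholder_sholder => // b'; exact: Hc_locholder (ltW a1) _ _ (density_Hc b').
have [pL _] := HcS_inv (Lop_Hc a0 a1 density_Hc b).
have e i : partial i (v \o @chart R b) = partial i (Lop w \o @chart R b).
  apply/funext => z; rewrite v_chart.
  have [_ h] := is_derive_addr (is_derive_constr c z (basisv R i)) (pL i z).
  by rewrite /partial h add0r.
by rewrite !e (Lop_laplacian b a0 a1 y sw) w1.
Qed.

End Bootstrap.

Section Assembly.
Variable R : realType.
Local Notation V2 := 'cV[R]_2.
Local Notation V3 := 'cV[R]_3.
Local Notation S := (@sphere R).
Variable alpha : R.
Hypothesis a0 : 0 < alpha.
Hypothesis a1 : alpha < 1.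
Variables (K v : V3 -> R) (c : R) (k : nat).
Hypothesis hK : forall b, Hc k alpha (K \o @chart R b).
Hypothesis bv : bounded_on S v.
Hypothesis hv : forall x, S x -> v x = c + Lop (fun y => K y * expR (2 * v y)) x.
Hypothesis w1 : sint (fun y => K y * expR (2 * v y)) = 1.

Definition cmetric : tensor2 R := fun x p r => expR (2 * v x) * dotv p r.

Lemma cmetric_riemannian : riemannian_metric k.+2 alpha cmetric.
Proof.
have a1' := ltW a1; split.
- by move=> x p r _ _ _; rewrite /cmetric dotvC.
- by move=> x t p q r _ _ _ _; rewrite /cmetric dotvDl dotvZl; ring.
- move=> x p _ _ p0; rewrite mulr_gt0 ?expR_gt0// lt_neqAle dotv_ge0 andbT eq_sym.
  by apply/eqP => /dotv_eq0 e; rewrite e eqxx in p0.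
move=> b i j; apply/holder_planeP => //.
rewrite /cmetric metric_coef_conformal.
rewrite (_ : (fun y => _) = fun y => (i == j)%:R * (expR (2 * (v \o @chart R b) y) * (4 * (qf y * qf y)))).
  apply: HcZ => //; apply: HcM => //.
    by apply: Hc_expR => //; apply: HcZ => //; exact: (solution_Hc a0 a1 hK bv hv).
  by apply: HcZ => //; apply: HcM => //; exact: Hc_qf.
by apply/funext => y; rewrite mxE [RHS]mulr_natl expr2.
Qed.

Lemma cmetric_curvature : is_gauss_curvature cmetric K.
Proof.
have a1' := ltW a1; move=> b y; rewrite /cmetric metric_coef_conformal.
set U := v \o @chart R b.
have hU : Hc 2 alpha U.
  by apply: (Hc_le a0 a1' (_ : 2 <= k.+2)%N) => //; exact: (solution_Hc a0 a1 hK bv hv).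
have [pU hU1] := HcS_inv hU.
have pU1 i := (HcS_inv (hU1 i)).1.
pose phi (z : V2) := expR (2 * U z) * (4 * qf z ^+ 2).
(* The gradient of (ln phi) / 2 = U + ln (2 qf). *)
pose lam i (z : V2) := partial i U z + -2 * (z i 0 * qf z).
pose llam l i (z : V2) := partial l (partial i U) z
  + -2 * ((i == l)%:R * qf z + z i 0 * (-2 * z l 0 * qf z ^+ 2)).
have phi0 z : 0 < phi z by rewrite mulr_gt0 ?expR_gt0// mulr_gt0// exprn_gt0// qf_gt0.
have dphi : pderiv phi (fun i z => 2 * phi z * lam i z).
  move=> i z; have cst d := is_derive_constr d z (basisv R i).
  have d1 := is_derive_mulr (cst 2) (pU i z).
  have d2 := @is_derive_chain R _ (fun z => 2 * U z) expR z (basisv R i) _ _ (is_derive_expR _) d1.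
  have d3 := is_derive_mulr (cst 4) (is_derive_expr 2 (pderiv_qf i z)).
  apply: (is_derive_ext (is_derive_mulr d2 d3)) => //.
  rewrite /phi /lam -[2.-1]/1%N expr1.
  by move: (U z) (partial i U z) (qf z) (expR (2 * U z)) => *; ring.
have dlam i : pderiv (lam i) (fun l => llam l i).
  move=> l z; have d1 := is_derive_mulr (@pderiv_coord R i l z) (pderiv_qf l z).
  apply: (is_derive_ext (is_derive_addr (pU1 i l z) (is_derive_mulr (is_derive_constr (-2) z (basisv R l)) d1))) => //.
  by rewrite /llam mul0r add0r.
rewrite (gauss_conformal phi0 dphi dlam) /llam !eqxx.
have := solution_laplacian a0 a1 hK bv hv b y w1; rewrite -/U.
move: (partial 0 (partial 0 U) y) (partial 1 (partial 1 U) y) => A B AB.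
have e := sqn_qf y; rewrite /sqn in e.
have -> : A + -2 * (true%:R * qf y + y 0 0 * (-2 * y 0 0 * qf y ^+ 2))
    + (B + -2 * (true%:R * qf y + y 1 0 * (-2 * y 1 0 * qf y ^+ 2)))
    = A + B - 4 * qf y + 4 * ((y 0 0 ^+ 2 + y 1 0 ^+ 2) * qf y) * qf y by rewrite /=; ring.
(* The Laplacian of ln (2 qf) is - 4 qf^2, the curvature of the round sphere; it cancels the 1 in
   [AB], which is the mean of the density. *)
rewrite AB e /phi -[U y]/(v (chart b y)).
have q0 : qf y != 0 by rewrite gt_eqF// qf_gt0.
have x0 : expR (2 * v (chart b y)) != 0 by rewrite gt_eqF// expR_gt0.
move: (expR _) (K _) (qf y) x0 q0 => E k0 q x0 q0.
by field; rewrite x0 q0.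
Qed.

End Assembly.

Theorem theorem1p6 (R : realType) (m : nat) (alpha : R) (Gamma : set 'M[R]_3)
    (hm : (4 <= m)%N) (halpha0 : 0 < alpha) (halpha1 : alpha < 1)
    (hGamma : finite_subgroup_O3 Gamma)
    (hbreak : breaks_conformal_action Gamma)
    (K : 'cV[R]_3 -> R)
    (hKinv : invariant_fun Gamma K)
    (hK : holder_pos (m - 2) alpha K) :
  exists g : tensor2 R,
    [/\ riemannian_metric m alpha g,
        invariant_metric Gamma g,
        pointwise_conformal g (@round_metric R) &
        is_gauss_curvature g K].
Proof.
have a1' := ltW halpha1; have [hKs [x0 Sx0 Kx0]] := hK.
have hKc b : Hc (m - 2) alpha (K \o @chart R b) by apply/holder_planeP => //; exact: hKs.
have [/finite_seqP[s Gs] GO G1 GM GV] := hGamma.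
have inG A : (A \in undup s) = (A \in s) by rewrite mem_undup.
have GP A : Gamma A <-> A \in undup s by rewrite inG Gs.
have Gu : uniq (undup s) by exact: undup_uniq.
have Go A : A \in undup s -> A^T *m A = 1%:M by move/GP; exact: GO.
have G1' : 1%:M \in undup s by exact/GP.
have GM' A B : A \in undup s -> B \in undup s -> A *m B \in undup s.
  by move=> /GP hA /GP hB; apply/GP; exact: GM.
have GT A : A \in undup s -> A^T \in undup s.
  move=> hA; have AA := Go A hA; have uA := (mulmx1_unit AA).2.
  have -> : A^T = invmx A by rewrite -[LHS]mulmx1 -(mulmxV uA) mulmxA AA mul1mx.
  by apply/GP; apply: GV; exact/GP.
(* An orbit sum is fixed by Gamma, hence zero. *)
have Gfix (x : 'cV[R]_3) : \sum_(A <- undup s) A *m x = 0.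
  apply: (breaking_no_fixed GO hbreak) => B /GP hB.
  rewrite mulmx_sumr; apply/matrixP => i j; rewrite !summxE.
  under eq_bigr do rewrite mulmxA.
  exact: (gsum_mull Gu Go GM' GT (fun A => (A *m x) i j)).
have uK : UC K.
  apply: (sholder_UC halpha0); apply: locholder_sholder => // b.
  exact: Hc_locholder (hKc b).
have KG A x : A \in undup s -> sphere x -> K (A *m x) = K x.
  by move=> /GP hA; exact: hKinv.
have [v [bv vG w1 [c hv]]] := mean_field_solution Gu Go G1' GM' GT Gfix uK KG Sx0 Kx0.
exists (cmetric v); split.
- have -> : m = (m - 2).+2 by rewrite -addn2 subnK// (leq_trans _ hm).
  exact: (cmetric_riemannian halpha0 halpha1 hKc bv hv).
- move=> A x p r hA Sx _ _; rewrite /cmetric vG ?orth_dotvM//; first exact: GO.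
  exact/GP.
- by exists (fun x => expR (2 * v x)) => x _; split => //; exact: expR_gt0.
- exact: (cmetric_curvature halpha0 halpha1 hKc bv hv w1).
Qed.
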